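(* Let $\Omega\subset\mathbb R^n$ be a bounded open set with boundary $\Gamma=\partial\Omega$. Let $0\le s<t$, $\varrho>0$ and $(f,h)\in\mathcal D_\varrho^{s,t}$. Then the boundary value problem $$(1-\Delta)u=f\ \text{ in }\Omega,\qquad u|_\Gamma=h,$$ has a unique solution $u\in B^{2+s}(\Omega)$ satisfying $\|u\|_{B^{2+s}(\Omega)}\le\varrho$.
   Context: Functions are complex valued; $\hat f(\xi)=\int_{\mathbb R^n}e^{-ix\cdot\xi}f(x)\,dx$ is the Fourier transform (extended to tempered distributions); $\langle\xi\rangle=\sqrt{1+|\xi|^2}$; $C_b^0$ is the space of bounded continuous functions on $\mathbb R^n$. For $s\ge0$, $B^s=\{f\in C_b^0:\ \langle\xi\rangle^s\hat f\in L^1(\mathbb R^n)\}$ with norm $\|f\|_{B^s}=\|\langle\xi\rangle^s\hat f\|_{L^1}$. $B^s(\Omega)=\{g|_{\overline\Omega}:\ g\in B^s\}$ with norm $\|f\|_{B^s(\Omega)}=\inf\{\|g\|_{B^s}:\ g\in B^s,\ g|_{\overline\Omega}=f\}$. $B^s(\Gamma)=\{u|_\Gamma:\ u\in B^s(\Omega)\}$ with norm $\|h\|_{B^s(\Gamma)}=\inf\{\|u\|_{B^s(\Omega)}:\ u\in B^s(\Omega),\ u|_\Gamma=h\}$. For $0\le s<t$ and $\varrho>0$, $\mathcal D_\varrho^{s,t}$ is the closure in $B^s(\Omega)\times B^{2+s}(\Gamma)$ of the set $$D_\varrho^t=\{((1-\Delta)u,\,u|_\Gamma):\ u\in B^{2+t}(\Omega),\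 \|u\|_{B^{2+t}(\Omega)}\le\varrho\}.$$ *)

(* Defs.v *)
From HB Require Import structures.
From mathcomp Require Import all_boot all_order all_algebra.
From mathcomp Require Import all_classical all_reals all_analysis.
From mathcomp Require Import complex.

Set Implicit Arguments.
Unset Strict Implicit.
Unset Printing Implicit Defensive.

Import Order.TTheory GRing.Theory Num.Theory.
Import numFieldNormedType.Exports.

Local Open Scope classical_set_scope.
Local Open Scope ring_scope.
Local Open Scope complex_scope.

(* Lebesgue measure on R^n, as an iterated product carried by n-tuples (the
   type for which the library provides the product sigma-algebra). *)
Section LebesgueStep.
Context {R : realType} {n : nat}.
Local Notation T := (measurableTypeR R).
Variable mu : {sigma_finite_measure set (n.-tuple T) -> \bar R}.

Definition cons_coord (p : T * n.-tuple T) : n.+1.-tuple T :=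
  [tuple of p.1 :: p.2].

Lemma measurable_cons_coord : measurable_fun [set: T * n.-tuple T] cons_coord.
Proof. exact: measurable_cons. Qed.

Definition lebesgue_step : set (n.+1.-tuple T) -> \bar R :=
  pushforward (@lebesgue_measure R \x mu)%E cons_coord.

Let lebesgue_step_measure : {measure set (n.+1.-tuple T) -> \bar R} :=
  measure_function_pushforward__canonical__measure_function_Measure
    (@lebesgue_measure R \x mu)%E measurable_cons_coord.

Let lebesgue_step0 : lebesgue_step set0 = 0%E.
Proof. exact: (measure0 lebesgue_step_measure). Qed.

Let lebesgue_step_ge0 A : (0 <= lebesgue_step A)%E.
Proof. exact: (measure_ge0 lebesgue_step_measure). Qed.

Let lebesgue_step_sigma_additive : semi_sigma_additive lebesgue_step.
Proof. exact: (@measure_semi_sigma_additive _ _ _ lebesgue_step_measure). Qed.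

HB.instance Definition _ := isMeasure.Build _ _ _ lebesgue_step
  lebesgue_step0 lebesgue_step_ge0 lebesgue_step_sigma_additive.

Let lebesgue_step_sigma_finite : sigma_finite setT lebesgue_step.
Proof.
pose uncons (t : n.+1.-tuple T) : T * n.-tuple T :=
  (tnth t ord0, [tuple of behead t]).
have unconsK : cancel cons_coord uncons.
  by move=> [a t]; congr pair; apply/val_inj.
have muncons : measurable_fun setT uncons.
  by apply: measurable_fun_pair; [exact: measurable_tnth|exact: measurable_behead].
have /sigma_finiteP[F [TF ndF Foo]] := sigma_finiteT (@lebesgue_measure R).
have /sigma_finiteP[G [TG ndG Goo]] := sigma_finiteT mu.
exists (fun k => uncons @^-1` (F k `*` G k)).
  rewrite -preimage_bigcup -(preimage_setT uncons); congr (_ @^-1` _).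
  rewrite -setXTT TF TG; apply/seteqP; split => -[x y].
    move=> [/= [k _ Fkx] [l _ Gly]]; exists (maxn k l) => //; split.
      by move: x Fkx; exact/subsetPset/ndF/leq_maxl.
    by move: y Gly; exact/subsetPset/ndG/leq_maxr.
  by move=> [k _ [/= Fkx Gky]]; split; exists k.
move=> k; have [mF Fkoo] := Foo k; have [mG Gkoo] := Goo k.
split.
  by rewrite -[X in measurable X]setTI; apply: muncons => //; exact: measurableX.
rewrite /lebesgue_step /pushforward -comp_preimage.
rewrite (_ : uncons \o cons_coord = id); last exact/funext.
by rewrite preimage_id product_measure1E// lte_mul_pinfty// ge0_fin_numE.
Qed.

HB.instance Definition _ := Measure_isSigmaFinite.Build _ _ _ lebesgue_step
  lebesgue_step_sigma_finite.

End LebesgueStep.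

Fixpoint lebesgue_Rn (R : realType) (n : nat) :
    {sigma_finite_measure set (n.-tuple (measurableTypeR R)) -> \bar R} :=
  if n is m.+1
  return {sigma_finite_measure set (n.-tuple (measurableTypeR R)) -> \bar R}
  then lebesgue_step (lebesgue_Rn R m)
  else \d_ ([tuple] : 0.-tuple (measurableTypeR R)).

Section Barron.
Context {R : realType} {n : nat}.
Notation Rn := 'rV[R]_n.
Notation C := R[i].
Notation normc := ComplexField.Normc.normc.

Definition row_of (x : n.-tuple (measurableTypeR R)) : Rn :=
  \row_(i < n) tnth x i.

Definition Rn_integrable (F : Rn -> R) : Prop :=
  (lebesgue_Rn R n).-integrable setT (EFin \o (F \o row_of)).

Definition Rn_int (F : Rn -> R) : R :=
  \int[lebesgue_Rn R n]_x F (row_of x).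

(* R[i] carries no canonical normed R-module structure, so continuity,
   derivatives and integrals are taken on real and imaginary parts. *)
Definition re (f : Rn -> C) (x : Rn) : R := complex.Re (f x).
Definition im (f : Rn -> C) (x : Rn) : R := complex.Im (f x).

Definition C_integrable (F : Rn -> C) : Prop :=
  Rn_integrable (re F) /\ Rn_integrable (im F).

Definition C_int (F : Rn -> C) : C := Rn_int (re F) +i* Rn_int (im F).

Definition dotp (x y : Rn) : R := \sum_(i < n) x ord0 i * y ord0 i.

Definition japanese (x : Rn) : R := Num.sqrt (1 + dotp x x).

Definition pderiv (i : 'I_n) (f : Rn -> R) (x : Rn) : R :=
  'D_(delta_mx ord0 i) f x.

Definition iter_partial (l : seq 'I_n) (f : Rn -> R) : Rn -> R :=
  foldr pderiv f l.

Definition schwartz_real (phi : Rn -> R) : Prop :=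
  forall l : seq 'I_n,
    (forall x, differentiable (iter_partial l phi) x) /\
    forall k : nat, exists M : R,
      forall x, japanese x ^+ k * `|iter_partial l phi x| <= M.

Definition schwartz (phi : Rn -> C) : Prop :=
  schwartz_real (re phi) /\ schwartz_real (im phi).

Definition fourier_integral (phi : Rn -> C) (xi : Rn) : C :=
  C_int (fun x => (cos (dotp x xi) -i* sin (dotp x xi)) * phi x).

(* The tempered distribution \hat f, defined by duality, is the integrable
   function g.  Integrable representatives are enough for B^s: since s >= 0 and
   <xi> >= 1, <xi>^s \hat f in L^1 forces \hat f in L^1. *)
Definition is_fourier (f g : Rn -> C) : Prop :=
  C_integrable g /\
  forall phi, schwartz phi ->
    C_int (fun x => f x * fourier_integral phi x) =
    C_int (fun xi => g xi * phi xi).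

(* A representative of \hat f (unique up to a null set when there is one). *)
Definition fourier (f : Rn -> C) : Rn -> C := xget (fun=> 0) (is_fourier f).

Definition Cb0 (f : Rn -> C) : Prop :=
  [/\ continuous (re f), continuous (im f) &
      exists M : R, forall x, normc (f x) <= M].

Definition weighted (s : R) (g : Rn -> C) (xi : Rn) : C :=
  (japanese xi `^ s)%:C * g xi.

Definition in_B (s : R) (f : Rn -> C) : Prop :=
  [/\ Cb0 f, (exists g, is_fourier f g) &
      C_integrable (weighted s (fourier f))].

Definition norm_B (s : R) (f : Rn -> C) : R :=
  Rn_int (fun xi => normc (weighted s (fourier f) xi)).

(* Functions on a subset A of R^n (the closure of Omega, or Gamma) are encoded
   by total functions considered up to equality on A; all the notions below only
   depend on the values on A. *)
Definition eq_on (A : set Rn) (f g : Rn -> C) : Prop :=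
  forall x, A x -> f x = g x.

Definition boundary (Omega : set Rn) : set Rn := closure Omega `\` Omega°.

Definition in_B_dom (Omega : set Rn) (s : R) (f : Rn -> C) : Prop :=
  exists2 g, in_B s g & eq_on (closure Omega) g f.

Definition norm_B_dom (Omega : set Rn) (s : R) (f : Rn -> C) : R :=
  inf [set norm_B s g | g in [set g | in_B s g /\ eq_on (closure Omega) g f]].

Definition in_B_bnd (Omega : set Rn) (s : R) (h : Rn -> C) : Prop :=
  exists2 u, in_B_dom Omega s u & eq_on (boundary Omega) u h.

Definition norm_B_bnd (Omega : set Rn) (s : R) (h : Rn -> C) : R :=
  inf [set norm_B_dom Omega s u |
        u in [set u | in_B_dom Omega s u /\ eq_on (boundary Omega) u h]].

Definition laplacian (u : Rn -> C) (x : Rn) : C :=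
  (\sum_(i < n) iter_partial [:: i; i] (re u) x) +i*
  (\sum_(i < n) iter_partial [:: i; i] (im u) x).

(* On the open set Omega the Laplacian is the classical one: elements of
   B^(2+s)(Omega), s >= 0, are twice continuously differentiable there. *)
Definition helmholtz_eq (Omega : set Rn) (u f : Rn -> C) : Prop :=
  forall x, Omega x -> u x - laplacian u x = f x.

Definition is_solution (Omega : set Rn) (f h u : Rn -> C) : Prop :=
  helmholtz_eq Omega u f /\ eq_on (boundary Omega) u h.

(* (1 - Delta) u, as an element of B^t(Omega), i.e. a continuous function on the
   closure of Omega, is determined by its values in Omega. *)
Definition D_set (Omega : set Rn) (t rho : R) (f h : Rn -> C) : Prop :=
  exists u, [/\ in_B_dom Omega (2 + t) u, norm_B_dom Omega (2 + t) u <= rho,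
    in_B_dom Omega t f, helmholtz_eq Omega u f & eq_on (boundary Omega) u h].

Definition D_closure (Omega : set Rn) (s t rho : R) (f h : Rn -> C) : Prop :=
  [/\ in_B_dom Omega s f, in_B_bnd Omega (2 + s) h &
    forall e : R, 0 < e -> exists f' h', [/\ D_set Omega t rho f' h',
      norm_B_dom Omega s (f \- f') < e &
      norm_B_bnd Omega (2 + s) (h \- h') < e]].

End Barron.

(* Main.v *)
(* By Fourier inversion and uniqueness, B^s is the weighted L^1 space of the densities
   \hat f.  The approximating data have solutions u_k with densities G_k of norm at most
   rho + 1/k in the weight 2 + t.  After a smooth cutoff outside closure Omega the densities
   become uniformly bounded and Lipschitz, so a subsequence converges pointwise, and since
   s < t it converges in the weight 2 + s; the limit gives u.  Uniqueness is the maximum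
   principle for 1 - Delta. *)

From HB Require Import structures.
From mathcomp Require Import all_boot all_order all_algebra.
From mathcomp Require Import all_classical all_reals all_analysis.
From mathcomp Require Import measurable_realfun lebesgue_integral_under complex ring lra.
Require Import Defs.

Import Order.TTheory GRing.Theory Num.Theory.
Import numFieldNormedType.Exports.
Local Open Scope classical_set_scope.
Local Open Scope ring_scope.

Set Implicit Arguments.
Unset Strict Implicit.
Unset Printing Implicit Defensive.

(** * Integration on R^n *)

(** A bound on weighted L^1 norms alone gives no compactness: densities may concentrate and tend to
    a measure. What is free is the extension outside closure Omega, and the cutoff spends this
    freedom: multiplication by it convolves the density with a fixed kernel, whose smoothness
    controls the result pointwise. The price is a constant factor in the norm, so the bound rho
    cannot be read off the limit density; it comes from G_k minus a correction that is small in the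
    weight 2 + s. The equation passes to the limit algebraically. On densities 1 - Delta is
    multiplication by <xi>^2, so the defects of the limit, in Omega and on the boundary, are inverse
    transforms of arbitrarily small densities and vanish. Since 1 - Delta is local, the cutoff does
    not disturb the equation in Omega. The analysis is kept real: a cosine transform with a phase
    replaces the complex exponential. The mass of the standard Gaussian stands in for (2 pi)^(n/2),
    and its positivity is all that is known about it. *)

Section AffineOneDim.
Context {R : realType}.
Local Notation T := (measurableTypeR R).
Local Notation lam := (@lebesgue_measure R).

Lemma measurable_affine (a b : R) : measurable_fun setT (fun r : T => a * r + b : T).
Proof. by apply: measurable_funD => //; exact: measurable_funM. Qed.

(** The pushforward rescaled by |a| agrees with Lebesgue measure on half-open intervals, hence
    everywhere by uniqueness. A negative [a] reverses the interval and moves the closed end to the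
    left, so the two signs are computed separately. *)
Lemma lebesgue_measure_affine (a b : R) (A : set T) : a != 0 -> measurable A ->
  lam ((fun r : T => a * r + b : T) @^-1` A) = ((`|a|^-1)%:E * lam A)%E.
Proof.
move=> a0 mA.
have a1 : 0 < `|a| by rewrite normr_gt0.
pose nu : {measure set T -> \bar R} :=
  mscale (NngNum (ltW a1))
  (measure_function_pushforward__canonical__measure_function_Measure lam (measurable_affine a b)).
rewrite (@lebesgue_measure_unique _ nu _ A)//.
  by rewrite /nu /= /mscale/= /pushforward muleA -EFinM mulVf ?gt_eqF// mul1e.
move=> X [[x y] /= _ <-]; rewrite /nu /= /mscale/= /pushforward.
have [xy|xy] := leP y x.
  rewrite (_ : `]x, y]%classic = set0) ?preimage_set0 ?measure0 ?mule0//.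
  by apply: set_itv_ge; rewrite bnd_simp -leNgt.
have [a_gt0|a_le0] := ltP 0 a.
  rewrite [X in lam X = _](_ : _ = `]x, y]%classic)//.
  rewrite [X in (_ * lam X)%E](_ : _ = `](x - b) / a, (y - b) / a]%classic); last first.
    apply/seteqP; split => r /=; rewrite !in_itv/= ltr_pdivrMr// ler_pdivlMr//
      => /andP[? ?]; apply/andP; split; nra.
  rewrite !lebesgue_measure_itv/= !lte_fin xy ltr_pM2r ?invr_gt0// ltrD2r xy.
  rewrite gtr0_norm// -!EFinD -EFinM; congr EFin; field; lra.
have a_lt0 : a < 0 by rewrite lt_neqAle a0.
rewrite [X in (_ * lam X)%E](_ : _ = `[(y - b) / a, (x - b) / a[%classic); last first.
  apply/seteqP; split => r /=; rewrite !in_itv/= ltr_ndivlMr// ler_ndivrMr//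
    => /andP[? ?]; apply/andP; split; nra.
rewrite !lebesgue_measure_itv/= !lte_fin xy ltr_nM2r ?invr_lt0// ltrD2r xy.
rewrite ltr0_norm// -!EFinD -EFinM; congr EFin; field; lra.
Qed.

Lemma ge0_integral_affine (a b : R) (f : T -> \bar R) : a != 0 ->
  measurable_fun setT f -> (forall r, 0 <= f r)%E ->
  (\int[lam]_r f (a * r + b)%R = (`|a|^-1)%:E * \int[lam]_r f r)%E.
Proof.
move=> a0 mf f0.
have a1 : 0 < `|a|^-1 by rewrite invr_gt0 normr_gt0.
pose nu : {measure set T -> \bar R} := mscale (NngNum (ltW a1)) lam.
transitivity (\int[pushforward lam (fun r : T => (a * r + b)%R : T)]_r f r)%E.
  rewrite (ge0_integral_pushforward (measurable_affine a b))//.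
transitivity (\int[nu]_r f r)%E; last first.
  by rewrite ge0_integral_mscale.
apply: eq_measure_integral => [|m A mA _]; first exact: measurable_affine.
by have := lebesgue_measure_affine b a0 mA.
Qed.

End AffineOneDim.

(** * Iterated integrals and affine substitutions on tuples *)

Section LebesgueRn.
Context {R : realType}.
Local Notation T := (measurableTypeR R).
Local Notation lam := (@lebesgue_measure R).

Lemma ge0_integral_cons n (f : n.+1.-tuple T -> \bar R) :
  measurable_fun setT f -> (forall t, 0 <= f t)%E ->
  (\int[lebesgue_Rn R n.+1]_t f t =
   \int[lam]_r \int[lebesgue_Rn R n]_t f [tuple of r :: t])%E.
Proof.
move=> mf f0.
transitivity (\int[pushforward (lam \x lebesgue_Rn R n)%E (@cons_coord R n)]_t f t)%E.
  by [].
rewrite (ge0_integral_pushforward (@measurable_cons_coord R n))//.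
rewrite preimage_setT (fubini_tonelli1 (f \o cons_coord)) //.
  by apply: measurableT_comp => //; exact: measurable_cons_coord.
by move=> x; exact: f0.
Qed.

Definition affine_tuple n (a : R) (b t : n.-tuple T) : n.-tuple T :=
  [tuple (a * tnth t i + tnth b i : T) | i < n].

Lemma measurable_affine_tuple n a b : measurable_fun setT (@affine_tuple n a b).
Proof.
apply/measurable_fun_tnthP => i.
rewrite (_ : _ \o _ = fun t : n.-tuple T => (a * tnth t i + tnth b i : T)).
  apply: measurable_funD => //; apply: measurable_funM => //.
  exact: measurable_tnth.
by apply/funext => t /=; rewrite tnth_mktuple.
Qed.

(** Tonelli splits off the first coordinate, which contributes one factor 1 / |a| by the
    one-dimensional substitution; induction supplies the other n. *)
Lemma ge0_integral_affine_tuple n (a : R) (b : n.-tuple T) (f : n.-tuple T -> \bar R) :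
  a != 0 -> measurable_fun setT f -> (forall t, 0 <= f t)%E ->
  (\int[lebesgue_Rn R n]_t f (affine_tuple a b t) =
   ((`|a| ^+ n)^-1)%:E * \int[lebesgue_Rn R n]_t f t)%E.
Proof.
move=> a0; elim: n b f => [|n IHn] b f mf f0.
  rewrite expr0 invr1 mul1e; apply: eq_integral => t _.
  by rewrite (tuple0 t); congr f; exact: tuple0.
have mfc r : measurable_fun setT (fun t : n.-tuple T => f [tuple of r :: t]).
  by apply: (@measurableT_comp _ _ _ _ _ _ f) => //; exact: measurable_cons.
rewrite ge0_integral_cons//; last first.
  by apply: (@measurableT_comp _ _ _ _ _ _ f) => //; exact: measurable_affine_tuple.
rewrite [in RHS]ge0_integral_cons//.
pose b0 := tnth b ord0; pose b' : n.-tuple T := [tuple of behead b].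
have Hc (r : T) (t : n.-tuple T) : affine_tuple a b [tuple of r :: t] =
    [tuple of (a * r + b0 : T) :: affine_tuple a b' t].
  apply: eq_from_tnth => i; rewrite tnth_mktuple.
  have [->|i0] := eqVneq i ord0; first by rewrite !tnth0.
  have [j ->] : exists j, i = lift ord0 j.
    by case: (unliftP ord0 i) => [j ->|ij]; [exists j|rewrite ij eqxx in i0].
  rewrite !tnthS tnth_mktuple; congr (_ * _ + _).
  by rewrite [in LHS](tuple_eta b) tnthS.
under eq_integral => r _ do under eq_integral => t _ do rewrite Hc.
under eq_integral => r _ do rewrite (IHn _ (fun t => f [tuple of (a * r + b0 : T) :: t]))//.
have mF : measurable_fun setT
    (fun r : T => \int[lebesgue_Rn R n]_t f [tuple of r :: t])%E.
  apply: (measurable_fun_fubini_tonelli_F (f \o cons_coord)) => //.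
    by apply: measurableT_comp => //; exact: measurable_cons_coord.
  by move=> x; exact: f0.
rewrite ge0_integralZl; last 4 first.
- exact: measurableT.
- by apply: (measurableT_comp mF); exact: measurable_affine.
- by move=> r _; exact: integral_ge0.
- by rewrite lee_fin invr_ge0 exprn_ge0.
rewrite (@ge0_integral_affine _ a b0
  (fun r : T => \int[lebesgue_Rn R n]_t f [tuple of r :: t])%E)//; last first.
  by move=> r; exact: integral_ge0.
by rewrite muleA -EFinM exprS invfM mulrC.
Qed.

End LebesgueRn.

(** * Measurability and integration of functions of row vectors *)

Section RnIntegral.
Context {R : realType} {n : nat}.
Local Notation Rn := 'rV[R]_n.
Local Notation T := (n.-tuple (measurableTypeR R)).
Local Notation mu := (lebesgue_Rn R n).
Implicit Types (F G H g : Rn -> R).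

Definition Rn_measurable (F : Rn -> R) : Prop :=
  measurable_fun [set: T] (F \o @row_of R n).

Lemma Rn_measurable_coord (i : 'I_n) : Rn_measurable (fun x => x ord0 i).
Proof.
rewrite /Rn_measurable (_ : _ \o _ = fun t : T => tnth t i).
  exact: measurable_tnth.
by apply/funext => t /=; rewrite mxE.
Qed.

Lemma Rn_measurable_cst (k : R) : Rn_measurable (fun=> k).
Proof. exact: measurable_cst. Qed.

Lemma Rn_measurableD F G : Rn_measurable F -> Rn_measurable G ->
  Rn_measurable (fun x => F x + G x).
Proof. by move=> mF mG; exact: measurable_funD. Qed.

Lemma Rn_measurableM F G : Rn_measurable F -> Rn_measurable G ->
  Rn_measurable (fun x => F x * G x).
Proof. by move=> mF mG; exact: measurable_funM. Qed.

Lemma Rn_measurable_comp (g : R -> R) F : measurable_fun setT g ->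
  Rn_measurable F -> Rn_measurable (fun x => g (F x)).
Proof. by move=> mg mF; exact: (measurableT_comp mg mF). Qed.

Lemma Rn_measurable_norm F : Rn_measurable F -> Rn_measurable (fun x => `|F x|).
Proof. exact: (Rn_measurable_comp (@normr_measurable R setT)). Qed.

Lemma rat_dense (xi : Rn) (d : R) : 0 < d -> exists q : 'rV[rat]_n, `|xi - map_mx ratr q| < d.
Proof.
move=> d0.
have /choice[q qP] : forall i, exists q : rat, `|xi ord0 i - ratr q| < d.
  move=> i; have : xi ord0 i - d < xi ord0 i + d by lra.
  move=> /rat_in_itvoo[r]; rewrite in_itv/= => /andP[r1 r2]; exists r.
  by rewrite ltr_distlC; apply/andP; split; lra.
exists (\row_i q i).
have : ball xi d (map_mx ratr (\row_i q i)).
  by split => // i j; rewrite (ord1 i) !mxE /ball/=; exact: qP.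
by rewrite -ball_normE.
Qed.

(** The topology lives on row vectors and the sigma-algebra on tuples; this links them. U is the
    union of the balls inside it with rational centre and radius 1 / (k + 1), a countable family,
    and balls of the sup norm are boxes, measurable coordinate by coordinate. *)
Lemma open_row_of_measurable (U : set Rn) : open U ->
  measurable (@row_of R n @^-1` U).
Proof.
move=> oU; pose d (k : nat) : R := k.+1%:R^-1.
have d0 (k : nat) : 0 < d k by rewrite invr_gt0.
pose c (p : 'rV[rat]_n * nat) : set Rn := ball (map_mx ratr p.1 : Rn) (d p.2).
have -> : U = \bigcup_(p : 'rV[rat]_n * nat) (if `[< c p `<=` U >] then c p else set0).
  apply/seteqP; split => x; last first.
    by move=> [p _]; case: asboolP => // + cx; apply.
  move=> Ux; have /nbhs_ballP[e /= e0 eU] : nbhs x U by exact: open_nbhs_nbhs.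
  have e2 : 0 < e / 2 by rewrite divr_gt0.
  have [k _ /(_ k (leqnn k)) /= ke] := near_infty_natSinv_lt (PosNum e2).
  have [q xq] := rat_dense x (d0 k).
  have qx : c (q, k) x by rewrite /c -ball_normE /= distrC.
  exists (q, k) => //; case: asboolP => // cU; exfalso; apply: cU => y qy.
  have sub := le_ball (x := map_mx ratr q : Rn) (ltW ke).
  exact: eU _ (ball_splitr (sub _ qx) (sub _ qy)).
rewrite preimage_bigcup; apply: countable_bigcupT_measurable => // p.
case: asboolP => // _; last by rewrite preimage_set0.
rewrite (_ : _ @^-1` _ = \big[setI/setT]_(i < n)
   [set t : T | `|ratr (p.1 ord0 i) - tnth t i| < d p.2]).
  apply: bigsetI_measurable => i _.
  have mf : measurable_fun setT (fun t : T => `|ratr (p.1 ord0 i) - tnth t i|).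
    apply: measurableT_comp => //; apply: measurable_funB => //.
    exact: measurable_tnth.
  have := mf measurableT _ (measurable_itv `]-oo, d p.2[).
  by rewrite setTI set_itvNyo.
rewrite -bigcap_seq; apply/seteqP; split => t /= tP.
  by move=> i _; have := tP.2 ord0 i; rewrite !mxE.
split=> [|i j]; [exact: d0|rewrite (ord1 i) !mxE; apply: tP]; exact: mem_index_enum.
Qed.

Lemma continuous_Rn_measurable (F : Rn -> R) : continuous F -> Rn_measurable F.
Proof.
move=> /continuousP cF; apply: (measurability _ (RGenOpens.measurableE R)).
move=> _ [_ [a [b ->] <-]]; rewrite setTI comp_preimage.
by apply: open_row_of_measurable; exact/cF/interval_open.
Qed.

Lemma Rn_integrable_measurable F : Rn_integrable F -> Rn_measurable F.
Proof. by case/integrableP => /measurable_EFinP. Qed.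

Lemma Rn_integrable_le F G : Rn_measurable F ->
  (forall x, `|F x| <= G x) -> Rn_integrable G -> Rn_integrable F.
Proof.
move=> mF FG; apply: le_integrable => //; first exact/measurable_EFinP.
by move=> t _ /=; rewrite lee_fin (le_trans (FG _))// ler_norm.
Qed.

Lemma Rn_integrableD F G : Rn_integrable F -> Rn_integrable G ->
  Rn_integrable (fun x => F x + G x).
Proof. by move=> iF iG; exact: (integrableD measurableT iF iG). Qed.

Lemma Rn_integrableZ (k : R) F : Rn_integrable F -> Rn_integrable (fun x => k * F x).
Proof. by move=> iF; exact: (integrableZl measurableT k iF). Qed.

Lemma Rn_integrableN F : Rn_integrable F -> Rn_integrable (fun x => - F x).
Proof. by move=> iF; exact: (integrableN iF). Qed.

Lemma Rn_integrableB F G : Rn_integrable F -> Rn_integrable G ->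
  Rn_integrable (fun x => F x - G x).
Proof. by move=> iF iG; apply: Rn_integrableD => //; exact: Rn_integrableN. Qed.

Lemma Rn_integrable_norm F : Rn_integrable F -> Rn_integrable (fun x => `|F x|).
Proof. by move=> iF; exact: integrable_norm. Qed.

Lemma Rn_integrable0 : @Rn_integrable R n (fun=> 0).
Proof. exact: integrable0. Qed.

Lemma Rn_integrableM_bounded (M : R) F g : Rn_measurable g -> (forall x, `|g x| <= M) ->
  Rn_integrable F -> Rn_integrable (fun x => F x * g x).
Proof.
move=> mg gM iF; apply: (@Rn_integrable_le _ (fun x => M * `|F x|)).
- by apply: Rn_measurableM => //; exact: Rn_integrable_measurable.
- by move=> x; rewrite normrM mulrC ler_wpM2r.
- exact/Rn_integrableZ/Rn_integrable_norm.
Qed.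

Lemma eq_Rn_int F G : F =1 G -> Rn_int F = Rn_int G.
Proof. by move=> /funext ->. Qed.

Lemma Rn_intD F G : Rn_integrable F -> Rn_integrable G ->
  Rn_int (fun x => F x + G x) = Rn_int F + Rn_int G.
Proof. by move=> iF iG; exact: RintegralD. Qed.

Lemma Rn_intB F G : Rn_integrable F -> Rn_integrable G ->
  Rn_int (fun x => F x - G x) = Rn_int F - Rn_int G.
Proof. by move=> iF iG; exact: RintegralB. Qed.

Lemma Rn_intZ (k : R) F : Rn_integrable F -> Rn_int (fun x => k * F x) = k * Rn_int F.
Proof. by move=> iF; exact: RintegralZl. Qed.

Lemma Rn_int_le F G : Rn_integrable F -> Rn_integrable G ->
  (forall x, F x <= G x) -> Rn_int F <= Rn_int G.
Proof. by move=> iF iG FG; apply: le_Rintegral. Qed.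

Lemma Rn_int_ge0 F : (forall x, 0 <= F x) -> 0 <= Rn_int F.
Proof. by move=> F0; apply: Rintegral_ge0. Qed.

Lemma Rn_int_norm F : Rn_integrable F -> `|Rn_int F| <= Rn_int (fun x => `|F x|).
Proof. by move=> iF; apply: le_normr_Rintegral. Qed.

Lemma Rn_int0 : @Rn_int R n (fun=> 0) = 0.
Proof. by rewrite /Rn_int /Rintegral integral0. Qed.

Lemma EFin_Rn_int F : Rn_integrable F ->
  (Rn_int F)%:E = (\int[mu]_t (F (row_of t))%:E)%E.
Proof. by move=> iF; rewrite /Rn_int /Rintegral fineK//; exact: integrable_fin_num. Qed.

Lemma Rn_dominated_convergence (F : nat -> Rn -> R) (G H : Rn -> R) :
  (forall k : nat, Rn_measurable (F k)) -> Rn_integrable H ->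
  (forall (k : nat) x, `|F k x| <= H x) -> (forall x, F ^~ x @ \oo --> G x) ->
  Rn_integrable G /\ (fun k : nat => Rn_int (F k)) @ \oo --> Rn_int G.
Proof.
move=> mF iH FH FG.
have mG : Rn_measurable G by apply: (measurable_fun_cvg mF) => t _; exact: FG.
have [|||||] := @dominated_convergence _ _ _ mu setT measurableT
    (fun k t => (F k (row_of t))%:E) (fun t => (G (row_of t))%:E) (EFin \o (H \o row_of)).
- move=> k. apply/measurable_EFinP; exact: mF.
- apply/measurable_EFinP; exact: mG.
- by apply: aeW => t _; apply: cvg_EFin; [exact: nearW|exact: FG].
- exact: iH.
- by apply: aeW => t k _; rewrite lee_fin.
move=> iG _ cFG; split => //.
apply: fine_cvg; rewrite fineK; last exact: (integrable_fin_num measurableT iG).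
exact: cFG.
Qed.

End RnIntegral.

Section RnAffine.
Context {R : realType} {n : nat}.
Local Notation Rn := 'rV[R]_n.
Local Notation T := (n.-tuple (measurableTypeR R)).
Local Notation mu := (lebesgue_Rn R n).
Implicit Types (F G : Rn -> R).

Definition tuple_of_row (b : Rn) : T := [tuple (b ord0 i : measurableTypeR R) | i < n].

Lemma row_of_affine_tuple (a : R) (b : Rn) t :
  row_of (affine_tuple a (tuple_of_row b) t) = a *: row_of t + b.
Proof. by apply/rowP => i; rewrite !mxE !tnth_mktuple. Qed.

Lemma Rn_measurable_affine (a : R) (b : Rn) F : Rn_measurable F ->
  Rn_measurable (fun x => F (a *: x + b)).
Proof.
move=> mF; rewrite /Rn_measurable.
rewrite (_ : _ \o _ = (F \o row_of) \o affine_tuple a (tuple_of_row b)).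
  by apply: measurableT_comp => //; exact: measurable_affine_tuple.
by apply/funext => t /=; rewrite row_of_affine_tuple.
Qed.

Lemma ge0_Rn_integral_affine (a : R) (b : Rn) F : a != 0 -> Rn_measurable F ->
  (forall x, 0 <= F x) ->
  (\int[mu]_t (F (a *: row_of t + b))%:E =
   ((`|a| ^+ n)^-1)%:E * \int[mu]_t (F (row_of t))%:E)%E.
Proof.
move=> a0 mF F0; under eq_integral do rewrite -row_of_affine_tuple.
rewrite (@ge0_integral_affine_tuple _ _ a (tuple_of_row b) (EFin \o (F \o row_of)))//.
  exact/measurable_EFinP.
by move=> t; rewrite lee_fin; exact: F0.
Qed.

Lemma Rn_integrable_affine (a : R) (b : Rn) F : a != 0 -> Rn_integrable F ->
  Rn_integrable (fun x => F (a *: x + b)).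
Proof.
move=> a0 iF; have mF := Rn_integrable_measurable iF.
apply/integrableP; split.
  by apply/measurable_EFinP; exact: (Rn_measurable_affine a b mF).
rewrite [ltLHS](_ : _ = ((`|a| ^+ n)^-1 * Rn_int (fun x => `|F x|))%:E) ?ltry//.
rewrite EFinM (EFin_Rn_int (Rn_integrable_norm iF)).
by rewrite -(ge0_Rn_integral_affine b a0 (Rn_measurable_norm mF)).
Qed.

(** The substitution is known for nonnegative functions, and F is the difference of the two
    nonnegative functions |F| and |F| - F. *)
Lemma Rn_int_affine (a : R) (b : Rn) F : a != 0 -> Rn_integrable F ->
  Rn_int (fun x => F (a *: x + b)) = (`|a| ^+ n)^-1 * Rn_int F.
Proof.
move=> a0 iF.
have H G : Rn_integrable G -> (forall x, 0 <= G x) ->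
    Rn_int (fun x => G (a *: x + b)) = (`|a| ^+ n)^-1 * Rn_int G.
  move=> iG G0; apply: EFin_inj; rewrite EFinM.
  rewrite (EFin_Rn_int iG) (EFin_Rn_int (Rn_integrable_affine b a0 iG)).
  by rewrite ge0_Rn_integral_affine//; exact: Rn_integrable_measurable.
have iN := Rn_integrable_norm iF.
have iNF := Rn_integrableB iN iF.
have NF0 x : 0 <= `|F x| - F x by rewrite subr_ge0 ler_norm.
have -> : Rn_int F = Rn_int (fun x => `|F x|) - Rn_int (fun x => `|F x| - F x).
  by rewrite -Rn_intB//; apply: eq_Rn_int => x; ring.
rewrite mulrBr -!H// -Rn_intB//.
- by apply: eq_Rn_int => x; ring.
- exact: (Rn_integrable_affine b a0 iN).
- exact: (Rn_integrable_affine b a0 iNF).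
Qed.

Lemma Rn_integrable_shift (b : Rn) F : Rn_integrable F ->
  Rn_integrable (fun x => F (x + b)).
Proof.
move=> /(Rn_integrable_affine b (oner_neq0 R)).
by under [X in Rn_integrable X]eq_fun do rewrite scale1r.
Qed.

Lemma Rn_int_shift (b : Rn) F : Rn_integrable F ->
  Rn_int (fun x => F (x + b)) = Rn_int F.
Proof.
move=> /(Rn_int_affine b (oner_neq0 R)).
under eq_Rn_int do rewrite scale1r.
by rewrite normr1 expr1n invr1 mul1r.
Qed.

End RnAffine.

Lemma measurable_big_sum d (U : measurableType d) (R : realType) (I : Type) (s : seq I)
    (h : I -> U -> R) :
  (forall i, measurable_fun setT (h i)) ->
  measurable_fun setT (fun z => \sum_(i <- s) h i z).
Proof.
move=> mh; elim: s => [|i s IHs].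
  by under eq_fun do rewrite big_nil; exact: measurable_cst.
by under eq_fun do rewrite big_cons; exact: measurable_funD.
Qed.

(** * Fubini's theorem with explicit dominating functions *)

Section RnFubini.
Context {R : realType} {n : nat}.
Local Notation Rn := 'rV[R]_n.
Local Notation T := (n.-tuple (measurableTypeR R)).
Local Notation mu := (lebesgue_Rn R n).

Definition Rn_measurable2 (F : Rn -> Rn -> R) : Prop :=
  measurable_fun [set: T * T] (fun z => F (row_of z.1) (row_of z.2)).

Lemma Rn_measurable2_fst (F : Rn -> R) : Rn_measurable F ->
  Rn_measurable2 (fun x _ => F x).
Proof. by move=> mF; exact: (measurableT_comp mF measurable_fst). Qed.

Lemma Rn_measurable2_snd (F : Rn -> R) : Rn_measurable F ->
  Rn_measurable2 (fun _ y => F y).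
Proof. by move=> mF; exact: (measurableT_comp mF measurable_snd). Qed.

Lemma Rn_measurable2D F G : Rn_measurable2 F -> Rn_measurable2 G ->
  Rn_measurable2 (fun x y => F x y + G x y).
Proof. by move=> mF mG; exact: measurable_funD. Qed.

Lemma Rn_measurable2M F G : Rn_measurable2 F -> Rn_measurable2 G ->
  Rn_measurable2 (fun x y => F x y * G x y).
Proof. by move=> mF mG; exact: measurable_funM. Qed.

Lemma Rn_measurable2_comp (g : R -> R) F : measurable_fun setT g ->
  Rn_measurable2 F -> Rn_measurable2 (fun x y => g (F x y)).
Proof. by move=> mg mF; exact: (measurableT_comp mg mF). Qed.

Lemma Rn_measurable2_dotp : Rn_measurable2 (@dotp R n).
Proof.
rewrite /Rn_measurable2 /dotp.
apply: (@measurable_big_sum _ _ _ _ _ (fun i (z : T * T) =>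
  row_of z.1 ord0 i * row_of z.2 ord0 i)) => i.
apply: measurable_funM.
  exact: (Rn_measurable2_fst (Rn_measurable_coord i)).
exact: (Rn_measurable2_snd (Rn_measurable_coord i)).
Qed.

Lemma Rn_measurable2_sub (F : Rn -> R) : Rn_measurable F ->
  Rn_measurable2 (fun x y => F (x - y)).
Proof.
move=> mF; pose d (z : T * T) : T := [tuple (tnth z.1 i - tnth z.2 i : measurableTypeR R) | i < n].
rewrite /Rn_measurable2 (_ : (fun z => _) = (F \o row_of) \o d); last first.
  by apply/funext => z /=; congr F; apply/rowP => i; rewrite !mxE tnth_mktuple.
apply: measurableT_comp => //; apply/measurable_fun_tnthP => i.
rewrite (_ : _ \o _ = fun z : T * T => (tnth z.1 i - tnth z.2 i : measurableTypeR R)).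
  apply: measurable_funB.
    by apply: (measurableT_comp (measurable_tnth i)); exact: measurable_fst.
  by apply: (measurableT_comp (measurable_tnth i)); exact: measurable_snd.
by apply/funext => z /=; rewrite tnth_mktuple.
Qed.

(** The bound [A] on the inner integrals of |F| makes F integrable on the product by Tonelli, after
    which both orders of integration are available. *)
Lemma Rn_fubini (F : Rn -> Rn -> R) (A : Rn -> R) : Rn_measurable2 F ->
  (forall x, Rn_integrable (F x)) -> Rn_integrable A ->
  (forall x, Rn_int (fun y => `|F x y|) <= A x) ->
  [/\ Rn_integrable (fun x => Rn_int (F x)),
      Rn_integrable (fun y => Rn_int (F ^~ y)) &
      Rn_int (fun x => Rn_int (F x)) = Rn_int (fun y => Rn_int (F ^~ y))].
Proof.
move=> mF iF iA FA.
pose f (z : T * T) : \bar R := (F (row_of z.1) (row_of z.2))%:E.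
have mf : measurable_fun setT f by exact/measurable_EFinP.
have imf : (mu \x mu)%E.-integrable setT f.
  apply/(integrable12ltyP _ _ mf).
  have /integrableP[_] := iA; apply: le_lt_trans.
  apply: ge0_le_integral => //.
  - by move=> t _; exact: integral_ge0.
  - apply: (@measurable_fun_fubini_tonelli_F _ _ _ _ _ _ (abse \o f)) => //.
      exact: measurableT_comp.
    by move=> z; exact: abse_ge0.
  - apply: measurableT_comp => //; apply/measurable_EFinP.
    exact: (Rn_integrable_measurable iA).
  - move=> t _ /=; rewrite /f/=.
    have := EFin_Rn_int (Rn_integrable_norm (iF (row_of t))).
    by rewrite /= => <-; rewrite lee_fin (le_trans (FA _))// ler_norm.
have FE : fubini_F mu f = fun t => (Rn_int (F (row_of t)))%:E.
  by apply/funext => u; rewrite EFin_Rn_int.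
have GE : (fun t : T => Rn_int (F ^~ (row_of t))) = fine \o fubini_G mu f by [].
have iG : mu.-integrable setT (fubini_G mu f).
  apply/integrableP; split; first exact: (measurable_fubini_G imf).
  apply: le_lt_trans ((integrable21ltyP _ _ mf).1 imf).
  apply: ge0_le_integral => //.
  - by apply: measurableT_comp => //; exact: (measurable_fubini_G imf).
  - apply: (@measurable_fun_fubini_tonelli_G _ _ _ _ _ _ (abse \o f)) => //.
      exact: measurableT_comp.
    by move=> z; exact: abse_ge0.
  - move=> t _; apply: le_abse_integral => //.
    exact: (measurableT_comp mf (pair2_measurable t)).
(* The slices in the other variable are controlled only almost everywhere. Where their integral is
   infinite, [fine] returns 0; this happens on a null set and changes neither integrability nor the
   integral. *)
have iG' : mu.-integrable setT (EFin \o (fine \o fubini_G mu f)).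
  apply: le_integrable iG => //.
    apply/measurable_EFinP; apply: measurableT_comp => //.
    exact: (measurable_fubini_G imf).
  by move=> t _ /=; case: (fubini_G _ _ _) => [r| |] //=; rewrite normr0 leey.
split.
- by have := integrable_fubini_F imf; rewrite FE.
- exact: iG'.
- apply: EFin_inj; rewrite EFin_Rn_int; last by have := integrable_fubini_F imf; rewrite FE.
  rewrite EFin_Rn_int; last exact: iG'.
  have := integral12_prod_meas1 imf; rewrite FE => ->.
  rewrite -(integral21_prod_meas1 imf).
  apply: ae_eq_integral => //.
  + exact: (measurable_fubini_G imf).
  + by case/integrableP : iG'.
  + apply: filterS (integrable_ae measurableT iG) => t /(_ I) ft _ /=.
    by rewrite -[LHS]fineK.
Qed.

Lemma Rn_fubini_prod (F : Rn -> Rn -> R) (A B : Rn -> R) : Rn_measurable2 F ->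
  Rn_integrable A -> Rn_integrable B -> (forall x y, `|F x y| <= A x * B y) ->
  [/\ Rn_integrable (fun x => Rn_int (F x)),
      Rn_integrable (fun y => Rn_int (F ^~ y)) &
      Rn_int (fun x => Rn_int (F x)) = Rn_int (fun y => Rn_int (F ^~ y))].
Proof.
move=> mF iA iB FAB.
(* Slices are measurable at points of the form [row_of t], and [row_of] is onto. *)
have mFx x : Rn_measurable (F x).
  have := FAB x; case: (pselect (exists t : T, row_of t = x)) => [[t <-] _|H].
    exact: (measurableT_comp mF (pair1_measurable t)).
  exfalso; apply: H; exists (tuple_of_row x).
  by apply/rowP => i; rewrite mxE tnth_mktuple.
have iFx x : Rn_integrable (F x).
  by apply: (Rn_integrable_le (mFx x) (FAB x)); exact: Rn_integrableZ.
apply: (@Rn_fubini _ (fun x => A x * Rn_int B)) => //.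
  under [X in Rn_integrable X]eq_fun do rewrite mulrC.
  exact: Rn_integrableZ.
move=> x; rewrite -Rn_intZ//; apply: Rn_int_le => //.
- exact: Rn_integrable_norm.
- exact: Rn_integrableZ.
Qed.

End RnFubini.

(** * The integrable weight <x>^(-2n) *)

Section Weight.
Context {R : realType}.

Lemma integral_oneDsqrV :
  (\int[@lebesgue_measure R]_x ((oneDsqr x)^-1)%:E = pi%:E)%E.
Proof.
rewrite (@ge0_symfun_integralT _ (fun x : R => (oneDsqr x)^-1))//=.
- rewrite (_ : [set x | _] = `[0, +oo[%classic); last first.
    by apply/seteqP; split => x/=; rewrite in_itv/= andbT.
  by rewrite integral0y_oneDsqr -EFinM mulrCA divff// mulr1.
- exact: continuous_oneDsqrV.
- by move=> x /=; rewrite /oneDsqr sqrrN.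
Qed.

Definition inv_oneDsqr_tuple n (t : n.-tuple (measurableTypeR R)) : R :=
  \prod_(i < n) (oneDsqr (tnth t i : R))^-1.

Lemma inv_oneDsqr_gt0 (x : R) : 0 < (oneDsqr x)^-1.
Proof. by rewrite invr_gt0 (lt_le_trans ltr01)// oneDsqr_ge1. Qed.

Lemma inv_oneDsqr_tuple_ge0 n (t : n.-tuple (measurableTypeR R)) : 0 <= inv_oneDsqr_tuple t.
Proof. by apply: prodr_ge0 => i _; exact/ltW/inv_oneDsqr_gt0. Qed.

Lemma measurable_inv_oneDsqr : measurable_fun setT (fun x : R => (oneDsqr x)^-1).
Proof. by apply: continuous_measurable_fun; exact: continuous_oneDsqrV. Qed.

Lemma measurable_inv_oneDsqr_tuple n : measurable_fun setT (@inv_oneDsqr_tuple n).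
Proof.
rewrite /inv_oneDsqr_tuple; elim: (index_enum _) => [|i s IHs].
  by under eq_fun do rewrite big_nil; exact: measurable_cst.
under eq_fun do rewrite big_cons; apply: measurable_funM => //.
apply: (measurableT_comp measurable_inv_oneDsqr); exact: measurable_tnth.
Qed.

Lemma integral_inv_oneDsqr_tuple n :
  (\int[lebesgue_Rn R n]_t (inv_oneDsqr_tuple t)%:E < +oo)%E.
Proof.
elim: n => [|n IHn].
  rewrite integral_dirac//=.
    by rewrite diracE mem_set// mul1e ltry.
  by apply/measurable_EFinP; exact: measurable_inv_oneDsqr_tuple.
have mI : measurable_fun setT (fun t => (@inv_oneDsqr_tuple n t)%:E).
  by apply/measurable_EFinP; exact: measurable_inv_oneDsqr_tuple.
have pI t : setT t -> (0 <= (@inv_oneDsqr_tuple n t)%:E)%E.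
  by move=> _; rewrite lee_fin inv_oneDsqr_tuple_ge0.
rewrite ge0_integral_cons; last 2 first.
- by apply/measurable_EFinP; exact: measurable_inv_oneDsqr_tuple.
- by move=> t; rewrite lee_fin inv_oneDsqr_tuple_ge0.
under eq_integral => r _.
  rewrite (_ : (\int[_]_t _)%E = ((oneDsqr (r : R))^-1)%:E *
      \int[lebesgue_Rn R n]_t (inv_oneDsqr_tuple t)%:E)%E; last first.
    have r0 : (0 <= ((oneDsqr (r : R))^-1)%:E)%E by rewrite lee_fin ltW// inv_oneDsqr_gt0.
    rewrite -(@ge0_integralZl _ _ _ _ _ measurableT _ mI _ pI r0).
    apply: eq_integral => t _; rewrite -EFinM /inv_oneDsqr_tuple big_ord_recl tnth0.
    by congr (_ * _)%:E; apply: eq_bigr => i _; rewrite tnthS.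
  over.
have mJ : measurable_fun setT (fun r : measurableTypeR R => ((oneDsqr (r : R))^-1)%:E).
  by apply/measurable_EFinP; exact: measurable_inv_oneDsqr.
have pJ (r : measurableTypeR R) : setT r -> (0 <= ((oneDsqr (r : R))^-1)%:E)%E.
  by move=> _; rewrite lee_fin ltW// inv_oneDsqr_gt0.
rewrite (@ge0_integralZr _ _ _ _ _ measurableT _ mJ _ pJ (integral_ge0 _ pI)).
rewrite integral_oneDsqrV; move: IHn.
have : (0 <= \int[lebesgue_Rn R n]_t (inv_oneDsqr_tuple t)%:E)%E.
  by apply: integral_ge0 => t _; rewrite lee_fin inv_oneDsqr_tuple_ge0.
by case: (\int[_]_t _)%E => // r _ _; rewrite -EFinM ltry.
Qed.

Context {n : nat}.
Local Notation Rn := 'rV[R]_n.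

Lemma dotp_ge0 (x : Rn) : 0 <= dotp x x.
Proof. by apply: sumr_ge0 => i _; rewrite -expr2 sqr_ge0. Qed.

Definition jap2 (x : Rn) : R := 1 + dotp x x.

Lemma jap2_ge1 (x : Rn) : 1 <= jap2 x.
Proof. by rewrite lerDl dotp_ge0. Qed.

Lemma jap2_gt0 (x : Rn) : 0 < jap2 x.
Proof. exact: lt_le_trans (jap2_ge1 x). Qed.

Lemma coord_sqr_le (x : Rn) i : x ord0 i ^+ 2 <= dotp x x.
Proof.
rewrite /dotp (bigD1 i)//= -expr2 lerDl.
by apply: sumr_ge0 => j _; rewrite -expr2 sqr_ge0.
Qed.

Lemma Rn_measurable_jap2 : Rn_measurable jap2.
Proof.
apply: Rn_measurableD; first exact: Rn_measurable_cst.
rewrite /Rn_measurable /dotp.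
apply: (@measurable_big_sum _ _ _ _ _ (fun i t => row_of t ord0 i * row_of t ord0 i)) => i.
by apply: measurable_funM; exact: Rn_measurable_coord.
Qed.

Lemma measurable_inv : measurable_fun setT (fun x : R => x^-1).
Proof.
have m1 : measurable_fun [set~ (0 : R)] (fun x : R => x^-1).
  apply: open_continuous_measurable_fun.
    by apply: closed_openC; exact: closed_eq.
  by move=> x /set_mem /= /eqP x0; exact: inv_continuous.
rewrite -(setUv [set (0:R)]); apply/measurable_funU => //.
  exact: measurableC.
by split => //; exact: measurable_fun_set1.
Qed.

(** Each factor 1 + x_i^2 is at most [jap2 x], so the function lies below a product of n Cauchy
    profiles, integrable by Tonelli. It serves as the common dominating function for everything that
    decays rapidly. *)
Lemma Rn_integrable_jap2 : Rn_integrable (fun x : Rn => (jap2 x ^+ n)^-1).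
Proof.
apply: (@Rn_integrable_le _ _ _ (fun x : Rn => \prod_(i < n) (oneDsqr (x ord0 i))^-1)).
- apply: (Rn_measurable_comp measurable_inv).
  by apply: (Rn_measurable_comp (exprn_measurable n)); exact: Rn_measurable_jap2.
- move=> x; rewrite ger0_norm ?invr_ge0 ?exprn_ge0 ?(ltW (jap2_gt0 _))//.
  rewrite prodfV lef_pV2 ?posrE; last 2 first.
  + by rewrite exprn_gt0// jap2_gt0.
  + by apply: prodr_gt0 => i _; rewrite (lt_le_trans ltr01)// oneDsqr_ge1.
  rewrite -[X in _ <= _ ^+ X]card_ord -prodr_const; apply: ler_prod => i _.
  rewrite (le_trans ler01) ?oneDsqr_ge1//=.
  by rewrite /oneDsqr lerD2l coord_sqr_le.
- have H : (fun t => (\prod_(i < n) (oneDsqr (row_of t ord0 i))^-1)) =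
      @inv_oneDsqr_tuple n.
    by apply/funext => t; apply: eq_bigr => i _; rewrite mxE.
  rewrite /Rn_integrable; apply/integrableP; split.
    by apply/measurable_EFinP; rewrite [X in measurable_fun _ X]H; exact: measurable_inv_oneDsqr_tuple.
  rewrite [ltLHS](_ : _ = \int[lebesgue_Rn R n]_t (inv_oneDsqr_tuple t)%:E)%E.
    exact: integral_inv_oneDsqr_tuple.
  apply: eq_integral => t _ /=.
  rewrite ger0_norm; first by rewrite -[in RHS]H.
  by apply: prodr_ge0 => i _; exact/ltW/inv_oneDsqr_gt0.
Qed.

End Weight.

(** * Schwartz functions *)

Section Schwartz.
Context {R : realType} {n : nat}.
Local Notation Rn := 'rV[R]_n.
Implicit Types (f g : Rn -> R).
Local Notation e_ i := (delta_mx ord0 i : Rn).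

Lemma japanese_sqr (x : Rn) : japanese x ^+ 2 = jap2 x.
Proof. by rewrite sqr_sqrtr// ltW// (jap2_gt0 x). Qed.

Lemma japanese_ge1 (x : Rn) : 1 <= japanese x.
Proof. by rewrite -[leLHS]sqrtr1 ler_wsqrtr// (jap2_ge1 x). Qed.

Definition rapid f : Prop :=
  forall k : nat, exists M : R, forall x, jap2 x ^+ k * `|f x| <= M.

Lemma rapidD f g : rapid f -> rapid g -> rapid (fun x => f x + g x).
Proof.
move=> rf rg k; have [M HM] := rf k; have [N HN] := rg k; exists (M + N) => x.
rewrite (le_trans _ (lerD (HM x) (HN x)))// -mulrDr ler_wpM2l ?ler_normD//.
by rewrite exprn_ge0// ltW// jap2_gt0.
Qed.

Lemma rapidZ (c : R) f : rapid f -> rapid (fun x => c * f x).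
Proof.
move=> rf k; have [M HM] := rf k; exists (`|c| * M) => x.
by rewrite normrM mulrCA ler_wpM2l.
Qed.

Lemma rapid_le f g : rapid g -> (forall x, `|f x| <= `|g x|) -> rapid f.
Proof.
move=> rg fg k; have [M HM] := rg k; exists M => x.
by rewrite (le_trans _ (HM x))// ler_wpM2l// exprn_ge0// ltW// jap2_gt0.
Qed.

Lemma rapid_coord i f : rapid f -> rapid (fun x => x ord0 i * f x).
Proof.
move=> rf k; have [M HM] := rf k.+1; exists M => x.
rewrite (le_trans _ (HM x))// normrM mulrA ler_wpM2r// exprSr.
rewrite ler_wpM2l ?exprn_ge0 ?(ltW (jap2_gt0 x))//.
have := coord_sqr_le x i; rewrite -real_normK ?num_real// /jap2.
by have := normr_ge0 (x ord0 i); nra.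
Qed.

Lemma rapid_bound f : rapid f -> exists M : R, forall x, `|f x| <= M * (jap2 x ^+ n)^-1.
Proof.
move=> rf; have [M HM] := rf n; exists M => x.
by rewrite ler_pdivlMr ?exprn_gt0 ?jap2_gt0// mulrC.
Qed.

Lemma rapid_bounded f : rapid f -> exists M : R, forall x, `|f x| <= M.
Proof. by move=> rf; have [M HM] := rf 0; exists M => x; have := HM x; rewrite mul1r. Qed.

Lemma rapid_integrable f : Rn_measurable f -> rapid f -> Rn_integrable f.
Proof.
move=> mf /rapid_bound[M HM].
by apply: (Rn_integrable_le mf HM); exact/Rn_integrableZ/Rn_integrable_jap2.
Qed.

(** Even powers of <x> suffice because <x> >= 1; with them the square root disappears from all decay
    estimates. *)
Lemma schwartz_realP (phi : Rn -> R) : schwartz_real phi <->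
  forall l, (forall x, differentiable (iter_partial l phi) x) /\ rapid (iter_partial l phi).
Proof.
split=> H l; have [d r] := H l; split => // k.
  by have [M HM] := r (2 * k)%N; exists M => x; rewrite -japanese_sqr -exprM.
have [M HM] := r k; exists M => x; rewrite (le_trans _ (HM x))// ler_wpM2r//.
rewrite -japanese_sqr lerXn2r ?nnegrE ?sqr_ge0 ?(le_trans ler01 (japanese_ge1 x))//.
by have := japanese_ge1 x; nra.
Qed.

(** The difference quotients on both sides are the same function of h, so directional derivatives
    can be computed by one-variable calculus. *)
Lemma is_derive_line f (x v : Rn) (d : R) :
  is_derive (0 : R) (1 : R) (fun t : R => f (x + t *: v)) d -> is_derive x v f d.
Proof.
have E : (fun h : R => h^-1 *: ((f \o shift x) (h *: v) - f x)) =
    (fun h : R => h^-1 *: (((fun t : R => f (x + t *: v)) \o shift 0) (h *: (1 : R))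
      - (fun t : R => f (x + t *: v)) 0)).
  apply/funext => h /=; have -> : h *: (1 : R) = h by exact: mulr1.
  by rewrite (addr0 h) scale0r (addr0 x) (addrC (h *: v)).
by case=> d1 d2; split; rewrite ?/derivable ?/derive E.
Qed.

Lemma is_derive_to_line f (x v : Rn) (t d : R) : is_derive (x + t *: v) v f d ->
  is_derive t (1 : R) (fun t : R => f (x + t *: v)) d.
Proof.
have E : (fun h : R => h^-1 *: ((f \o shift (x + t *: v)) (h *: v) - f (x + t *: v))) =
    (fun h : R => h^-1 *: (((fun t : R => f (x + t *: v)) \o shift t) (h *: (1 : R))
      - (fun t : R => f (x + t *: v)) t)).
  apply/funext => h /=; have -> : h *: (1 : R) = h by exact: mulr1.
  by rewrite scalerDl addrCA.
by case=> d1 d2; split; rewrite ?/derivable ?/derive -E.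
Qed.

Lemma coord_line (x : Rn) i (t : R) j : (x + t *: e_ i) ord0 j = x ord0 j + t * (i == j)%:R.
Proof. by rewrite !mxE eqxx/= (eq_sym j). Qed.

Lemma is_derive_coord (x : Rn) i j :
  is_derive x (e_ i) (fun y : Rn => y ord0 j) ((i == j)%:R : R).
Proof.
apply: is_derive_line; under eq_fun do rewrite coord_line.
by apply: is_derive_eq; rewrite /GRing.scale/=; ring.
Qed.

Lemma is_derive_pderiv f x i : differentiable f x ->
  is_derive x (e_ i) f (pderiv i f x).
Proof. by move=> df; apply: DeriveDef => //; exact: diff_derivable. Qed.

Lemma pderivE f x i d : is_derive x (e_ i) f d -> pderiv i f x = d.
Proof. by case. Qed.

(* A set of functions is Schwartz as soon as the first derivatives of its members
   fall into its span with polynomial coefficients (coord_span_schwartz). *)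
Inductive coord_span (S : (Rn -> R) -> Prop) : (Rn -> R) -> Prop :=
| coord_span_gen g : S g -> coord_span S g
| coord_spanD f g : coord_span S f -> coord_span S g -> coord_span S (fun x => f x + g x)
| coord_spanX i f : coord_span S f -> coord_span S (fun x => x ord0 i * f x)
| coord_spanZ (c : R) f : coord_span S f -> coord_span S (fun x => c * f x).

Lemma coord_span_schwartz (S : (Rn -> R) -> Prop) :
  (forall g, S g -> [/\ forall x, differentiable g x, rapid g &
     forall i, exists2 g', coord_span S g' & forall x, is_derive x (e_ i) g (g' x)]) ->
  forall f, coord_span S f -> schwartz_real f.
Proof.
move=> HS.
(* The induction carries stability of the span under partial derivatives, which then yields iterated
   derivatives of every order. *)
have H f : coord_span S f -> [/\ forall x, differentiable f x, rapid f &
    forall i, coord_span S (pderiv i f)].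
  elim=> {f} [g /HS[dg rg g'] |f g _ [df rf f'] _ [dg rg g']|i f Sf [df rf f']|c f Sf [df rf f']].
  - split => // i; have [h Sh hP] := g' i.
    by rewrite (_ : pderiv i g = h)//; apply/funext => x; exact: pderivE.
  - split => [x||i]; [exact: differentiableD|exact: rapidD|].
    rewrite (_ : pderiv _ _ = fun x => pderiv i f x + pderiv i g x).
      exact: coord_spanD.
    apply/funext => x; apply: pderivE.
    by apply: is_deriveD; exact: is_derive_pderiv.
  - split => [x||j]; [|exact: rapid_coord|].
      exact: (differentiableM (differentiable_coord x ord0 i) (df x)).
    rewrite (_ : pderiv _ _ = fun x => x ord0 i * pderiv j f x + (j == i)%:R * f x).
      by apply: coord_spanD; [exact: coord_spanX|exact: coord_spanZ].
    apply/funext => x; apply: pderivE; rewrite mulrC [X in _ + X]mulrC [_ * x ord0 i]mulrC.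
    exact: (is_deriveM (is_derive_coord x j i) (is_derive_pderiv j (df x))).
  - split => [x||j]; [|exact: rapidZ|].
      exact: (differentiableM (differentiable_cst c x) (df x)).
    rewrite (_ : pderiv _ _ = fun x => c * pderiv j f x); first exact: coord_spanZ.
    apply/funext => x; apply: pderivE.
    exact: (is_deriveZ c (is_derive_pderiv j (df x))).
move=> f Sf; apply/schwartz_realP => l.
suff /H[] : coord_span S (iter_partial l f) by [].
by elim: l => //= i l /H[].
Qed.

Lemma iter_partial_rcons l i f : iter_partial (rcons l i) f = iter_partial l (pderiv i f).
Proof. by rewrite /iter_partial foldr_rcons. Qed.

Lemma schwartz_real_differentiable f x : schwartz_real f -> differentiable f x.
Proof. by move=> /schwartz_realP /(_ [::]) []. Qed.

Lemma schwartz_real_rapid f : schwartz_real f -> rapid f.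
Proof. by move=> /schwartz_realP /(_ [::]) []. Qed.

Lemma schwartz_real_pderiv i f : schwartz_real f -> schwartz_real (pderiv i f).
Proof.
move=> /schwartz_realP Hf; apply/schwartz_realP => l.
by rewrite -iter_partial_rcons; exact: Hf.
Qed.

Lemma coord_span_schwartz_real f : coord_span (@schwartz_real R n) f -> schwartz_real f.
Proof.
apply: coord_span_schwartz => g Sg; split => [x||i].
- exact: schwartz_real_differentiable.
- exact: schwartz_real_rapid.
- exists (pderiv i g); first by apply: coord_span_gen; exact: schwartz_real_pderiv.
  by move=> x; apply/is_derive_pderiv/schwartz_real_differentiable.
Qed.

Lemma schwartz_realD f g : schwartz_real f -> schwartz_real g ->
  schwartz_real (fun x => f x + g x).
Proof.
by move=> Sf Sg; apply/coord_span_schwartz_real/coord_spanD; exact: coord_span_gen.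
Qed.

Lemma schwartz_realZ c f : schwartz_real f -> schwartz_real (fun x => c * f x).
Proof. by move=> Sf; apply/coord_span_schwartz_real/coord_spanZ; exact: coord_span_gen. Qed.

Lemma schwartz_real_continuous f : schwartz_real f -> continuous f.
Proof. by move=> Sf x; apply/differentiable_continuous/schwartz_real_differentiable. Qed.

Lemma schwartz_real_measurable f : schwartz_real f -> Rn_measurable f.
Proof. by move=> Sf; apply: continuous_Rn_measurable; exact: schwartz_real_continuous. Qed.

Lemma schwartz_real_integrable f : schwartz_real f -> Rn_integrable f.
Proof.
move=> Sf; apply: rapid_integrable; first exact: schwartz_real_measurable.
exact: schwartz_real_rapid.
Qed.

Lemma Rn_integrable_schwartzM f g : Rn_integrable f -> schwartz_real g ->
  Rn_integrable (fun x => f x * g x).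
Proof.
move=> ip Su; have [M HM] := rapid_bounded (schwartz_real_rapid Su).
by apply: (@Rn_integrableM_bounded _ _ M) => //; exact: schwartz_real_measurable.
Qed.

Lemma schwartz_real0 : schwartz_real (fun _ : Rn => 0 : R).
Proof.
apply: (@coord_span_schwartz (fun g => g = fun=> 0)); last exact: coord_span_gen.
move=> g ->; split => [x||i].
- exact: differentiable_cst.
- by move=> k; exists 0 => x; rewrite normr0 mulr0.
- exists (fun=> 0); first exact: coord_span_gen.
  by move=> x; exact: is_derive_cst.
Qed.

End Schwartz.

(** * Phases and Gaussians *)

Section Dotp.
Context {R : realType} {n : nat}.
Local Notation Rn := 'rV[R]_n.
Local Notation e_ i := (delta_mx ord0 i : Rn).
Implicit Types (x y v b : Rn).

Lemma dotpC x y : dotp x y = dotp y x.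
Proof. by apply: eq_bigr => i _; rewrite mulrC. Qed.

Lemma dotpDl x y v : dotp (x + y) v = dotp x v + dotp y v.
Proof. by rewrite -big_split; apply: eq_bigr => i _; rewrite mxE mulrDl. Qed.

Lemma dotpZl (k : R) x y : dotp (k *: x) y = k * dotp x y.
Proof. by rewrite mulr_sumr; apply: eq_bigr => i _; rewrite mxE mulrA. Qed.

Lemma dotpDr x y v : dotp v (x + y) = dotp v x + dotp v y.
Proof. by rewrite !(dotpC v) dotpDl. Qed.

Lemma dotpZr (k : R) x y : dotp x (k *: y) = k * dotp x y.
Proof. by rewrite !(dotpC x) dotpZl. Qed.

Lemma dotpNl x y : dotp (- x) y = - dotp x y.
Proof. by rewrite -scaleN1r dotpZl mulN1r. Qed.

Lemma dotpNr x y : dotp x (- y) = - dotp x y.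
Proof. by rewrite dotpC dotpNl dotpC. Qed.

Lemma dotp0l x : dotp 0 x = 0.
Proof. by rewrite -(scale0r x) dotpZl mul0r. Qed.

Lemma dotp_delta i y : dotp (e_ i) y = y ord0 i.
Proof.
rewrite /dotp (bigD1 i)//= !mxE !eqxx mul1r big1 ?addr0// => j ji.
by rewrite mxE (negbTE ji) andbF mul0r.
Qed.

(** Peetre's inequality, from |x + y|^2 + |x - y|^2 = 2 |x|^2 + 2 |y|^2. *)
Lemma jap2D x y : jap2 (x + y) <= 2 * jap2 x * jap2 y.
Proof.
have := dotp_ge0 (x - y); have := dotp_ge0 x; have := dotp_ge0 y.
rewrite /jap2 !(dotpDl, dotpDr, dotpNl, dotpNr) (dotpC y x); nra.
Qed.

Lemma is_derive_comp_dotp (f : R -> R) x v y (d : R) : is_derive (dotp x y) (1 : R) f d ->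
  is_derive x v (fun x => f (dotp x y)) (dotp v y * d).
Proof.
move=> df; apply: is_derive_line.
have -> : (fun t : R => f (dotp (x + t *: v) y)) = f \o (fun t : R => dotp x y + t * dotp v y).
  by apply/funext => t; rewrite /= dotpDl dotpZl.
have dg : is_derive (0 : R) (1 : R) (fun t : R => dotp x y + t * dotp v y) (dotp v y).
  by apply: is_derive_eq; rewrite /GRing.scale/=; ring.
have df' : is_derive ((fun t : R => dotp x y + t * dotp v y) 0) (1 : R) f d.
  by rewrite /= mul0r addr0.
rewrite mulrC.
exact: (@is_derive1_comp R f (fun t => dotp x y + t * dotp v y) 0 d (dotp v y) df' dg).
Qed.

Lemma is_derive_cos_dotp x v y (a : R) :
  is_derive x v (fun x => cos (dotp x y + a)) (dotp v y * cos (dotp x y + (a + pi / 2))).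
Proof.
apply: (@is_derive_comp_dotp (fun t => cos (t + a))).
apply: is_derive_eq; rewrite /GRing.scale/= addrA cosDpihalf; ring.
Qed.

Lemma differentiable_dotpl x y : differentiable (fun x => dotp x y) x.
Proof.
rewrite (_ : (fun _ => _) = \sum_(i < n) (fun x : Rn => x ord0 i * y ord0 i)).
  apply: differentiable_sum => i.
  exact: (differentiableM (differentiable_coord x ord0 i) (differentiable_cst _ _)).
by apply/funext => z; rewrite fct_sumE.
Qed.

Lemma differentiable_dotp_sqr x b : differentiable (fun x => dotp (x - b) (x - b)) x.
Proof.
rewrite (_ : (fun _ => _) = \sum_(i < n) (fun x : Rn =>
    (x ord0 i - b ord0 i) * (x ord0 i - b ord0 i))).
  apply: differentiable_sum => i.
  have H : differentiable (fun x : Rn => x ord0 i - b ord0 i) x.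
    exact: (differentiableB (differentiable_coord x ord0 i) (differentiable_cst _ _)).
  exact: (differentiableM H H).
by apply/funext => z; rewrite fct_sumE; apply: eq_bigr => i _; rewrite !mxE.
Qed.

Lemma differentiable_comp1 (f : R -> R) (g : Rn -> R) x : differentiable g x ->
  derivable f (g x) 1 -> differentiable (fun x => f (g x)) x.
Proof. by move=> dg /derivable1_diffP df; exact: (differentiable_comp dg df). Qed.

Lemma differentiable_cos_dotp x y (a : R) : differentiable (fun x => cos (dotp x y + a)) x.
Proof.
apply: (@differentiable_comp1 (fun t => cos (t + a)) (fun x => dotp x y)).
  exact: differentiable_dotpl.
by apply: ex_derive.
Qed.

Lemma norm_cos (t : R) : `|cos t| <= 1.
Proof. by rewrite ler_norml cos_geN1 cos_le1. Qed.

Lemma Rn_measurable_dotp y : Rn_measurable (dotp y).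
Proof.
apply: (@measurable_big_sum _ _ _ _ _ (fun i t => y ord0 i * row_of t ord0 i)) => i.
by apply: measurable_funM; [exact: measurable_cst|exact: Rn_measurable_coord].
Qed.

Lemma measurable_cos_shift (a : R) : measurable_fun setT (fun t : R => cos (t + a)).
Proof.
apply: continuous_measurable_fun => t.
by apply: differentiable_continuous; apply/derivable1_diffP; apply: ex_derive.
Qed.

Lemma Rn_measurable_cos_dotp y (a : R) : Rn_measurable (fun x => cos (dotp y x + a)).
Proof. exact: (Rn_measurable_comp (measurable_cos_shift a) (Rn_measurable_dotp y)). Qed.

End Dotp.

Section Gaussian.
Context {R : realType} {n : nat}.
Local Notation Rn := 'rV[R]_n.
Local Notation e_ i := (delta_mx ord0 i : Rn).

(** [a] is the inverse variance and [b] the centre. With the factor 1/2 the Fourier transform turns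
    [a] into 1 / a, up to a constant factor. *)
Definition gauss (a : R) (b x : Rn) : R := expR (- (a / 2) * dotp (x - b) (x - b)).

Lemma gauss_gt0 a b x : 0 < gauss a b x.
Proof. exact: expR_gt0. Qed.

Lemma expR_decay (c : R) (k : nat) : 0 < c ->
  exists M : R, forall u, 0 <= u -> (1 + u) ^+ k * expR (- c * u) <= M.
Proof.
move=> c0; case: k => [|k].
  exists 1 => u u0; rewrite expr0 mul1r -expR0 ler_expR; nra.
(* expR (c u) is the power k + 1 of expR (c u / (k + 1)), which is at least 1 + c u / (k + 1). The
   choice of m makes m (1 + u) a lower bound of the latter for every u >= 0. *)
pose m : R := Num.min 1 (c / k.+1%:R).
have m0 : 0 < m by rewrite lt_min ltr01 divr_gt0.
exists ((m ^+ k.+1)^-1) => u u0.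
rewrite mulNr expRN -ler_pdivlMr ?invr_gt0 ?expR_gt0// invrK.
rewrite -[leLHS]mul1r -ler_pdivrMl ?invr_gt0 ?exprn_gt0// invrK mul1r mulrC -exprMn.
rewrite [X in expR X](_ : _ = k.+1%:R * (c / k.+1%:R * u)); last first.
  by rewrite mulrCA !mulrA mulfVK.
rewrite expRM_natl lerXn2r ?nnegrE ?expR_ge0 ?mulr_ge0 ?(ltW m0)//; first lra.
apply: le_trans (expR_ge1Dx _).
have h1 : m <= 1 by rewrite ge_min lexx.
have h2 : m <= c / k.+1%:R by rewrite ge_min lexx orbT.
by move: h2; move: (c / _) => q h2; nra.
Qed.

Lemma gauss_rapid (a : R) b : 0 < a -> rapid (gauss a b).
Proof.
move=> a0 k; have [M HM] := @expR_decay (a / 2) k (divr_gt0 a0 (ltr0n _ 2)).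
exists ((2 * jap2 b) ^+ k * M) => x; rewrite (ger0_norm (ltW (gauss_gt0 _ _ _))).
(* Peetre's inequality recentres the weight at b, where the decay of the exponential applies. *)
have H : jap2 x <= 2 * jap2 b * jap2 (x - b).
  by have := jap2D (x - b) b; rewrite subrK mulrAC.
have jb := jap2_gt0 b; have jx := jap2_gt0 x; have jxb := jap2_gt0 (x - b).
apply: (@le_trans _ _ ((2 * jap2 b * jap2 (x - b)) ^+ k * gauss a b x)).
  rewrite ler_wpM2r ?(ltW (gauss_gt0 _ _ _))// lerXn2r ?nnegrE ?(ltW jx)//.
  by rewrite !mulr_ge0// ltW.
rewrite exprMn -mulrA ler_wpM2l ?exprn_ge0 ?mulr_ge0 ?(ltW jb)//.
exact: HM (dotp_ge0 _).
Qed.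

Lemma gauss_is_derive a b x i :
  is_derive x (e_ i) (gauss a b) (- a * (x ord0 i - b ord0 i) * gauss a b x).
Proof.
apply: is_derive_line.
have -> : (fun t : R => gauss a b (x + t *: e_ i)) = (fun t : R => expR (- (a / 2) *
    (dotp (x - b) (x - b) + 2 * t * (x ord0 i - b ord0 i) + t * t))).
  apply/funext => t; congr (expR (_ * _)).
  rewrite (_ : x + t *: e_ i - b = (x - b) + t *: e_ i); last by rewrite addrAC.
  have -> : x ord0 i - b ord0 i = (x - b) ord0 i by rewrite !mxE.
  move: (x - b) => z; rewrite dotpDl !dotpDr (dotpC z (_ *: _)) !dotpZl !dotpZr.
  by rewrite !dotp_delta !mxE !eqxx/=; ring.
rewrite /gauss; apply: is_derive_eq; rewrite /GRing.scale/= !(mulr0, mul0r, addr0).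
by field.
Qed.

Lemma gauss_differentiable a b x : differentiable (gauss a b) x.
Proof.
apply: (@differentiable_comp1 _ _ (fun t => expR (- (a / 2) * t))
  (fun x => dotp (x - b) (x - b))); first exact: differentiable_dotp_sqr.
by apply: ex_derive.
Qed.

Lemma gauss_schwartz (a : R) b : 0 < a -> schwartz_real (gauss a b).
Proof.
move=> a0; apply: (@coord_span_schwartz _ _ (fun g => g = gauss a b)); last exact: coord_span_gen.
move=> g ->; split => [x||i]; [exact: gauss_differentiable|exact: gauss_rapid|].
exists (fun x : Rn => - a * (x ord0 i * gauss a b x) + a * b ord0 i * gauss a b x).
  by apply: coord_spanD; apply: coord_spanZ; [apply: coord_spanX|]; exact: coord_span_gen.
move=> x; apply: (is_derive_eq (gauss_is_derive a b x i)); ring.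
Qed.

(** The products of a Schwartz function and a cosine of arbitrary phase span a space stable under
    derivatives: one term differentiates the amplitude, the other shifts the phase by pi / 2. *)
Lemma schwartz_real_cos (phi : Rn -> R) y (a : R) : schwartz_real phi ->
  schwartz_real (fun x => phi x * cos (dotp x y + a)).
Proof.
move=> Sphi.
apply: (@coord_span_schwartz _ _ (fun g => exists psi b, schwartz_real psi /\
   g = fun x => psi x * cos (dotp x y + b))); last first.
  by apply: coord_span_gen; exists phi, a.
move=> g [psi [b [Sp ->]]]; split => [x||i].
- apply: differentiableM; first exact: schwartz_real_differentiable.
  exact: differentiable_cos_dotp.
- apply: (rapid_le (schwartz_real_rapid Sp)) => x.
  by rewrite normrM ler_piMr// norm_cos.
- exists (fun x : Rn => pderiv i psi x * cos (dotp x y + b) +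
     y ord0 i * (psi x * cos (dotp x y + (b + pi / 2)))).
    apply: coord_spanD; [|apply: coord_spanZ]; apply: coord_span_gen.
      by exists (pderiv i psi), b; split => //; exact: schwartz_real_pderiv.
    by exists psi, (b + pi / 2).
  move=> x; apply: (is_derive_eq (is_deriveM (is_derive_pderiv i (schwartz_real_differentiable x Sp))
    (is_derive_cos_dotp x (e_ i) y b))).
  by rewrite /GRing.scale/= dotp_delta; ring.
Qed.

End Gaussian.

(** * Cosine transforms *)

Section CosTransform.
Context {R : realType} {n : nat}.
Local Notation Rn := 'rV[R]_n.
Local Notation T := (n.-tuple (measurableTypeR R)).
Local Notation e_ i := (delta_mx ord0 i : Rn).
Implicit Types (p q phi psi : Rn -> R) (x y v : Rn) (a : R).

(** Brings continuity of integrals within reach of dominated convergence, which concerns sequences.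
    At a discontinuity, points at distance below 1 / (m + 1) with values at least e away form an
    offending sequence. *)
Lemma sequentially_continuous (f : Rn -> R) :
  (forall x (u : nat -> Rn), u @ \oo --> x -> (f \o u) @ \oo --> f x) -> continuous f.
Proof.
move=> fu x; apply/(@cvgrPdist_lt _ _ _ (nbhs x)) => e e0; apply/nbhs_ballP; apply: contrapT => H.
have /choice[u uP] : forall m : nat, exists y, ball x (m.+1%:R^-1) y /\ e <= `|f x - f y|.
  move=> m; apply: contrapT => H1; apply: H; exists (m.+1%:R^-1) => //= y xy.
  by rewrite ltNge; apply/negP => ey; apply: H1; exists y.
have /fu/cvgrPdist_lt/(_ _ e0) : u @ \oo --> x.
  apply/cvg_ballP => d d0; near=> m; apply: le_ball (uP m).1; apply: ltW.
  by near: m; exact: (near_infty_natSinv_lt (PosNum d0)).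
case=> m _ /(_ m (leqnn m)) /=; rewrite ltNge => /negP; apply; exact: (uP m).2.
Unshelve. all: by end_near. Qed.

(* The phase a gives access to both the real and the imaginary part of the Fourier
   integral, and differentiation is the phase shift a + pi / 2. *)
Definition ctr a p x : R := Rn_int (fun xi => p xi * cos (dotp x xi + a)).

Lemma ctr_integrable a p x : Rn_integrable p ->
  Rn_integrable (fun xi => p xi * cos (dotp x xi + a)).
Proof.
move=> ip; apply: (@Rn_integrableM_bounded _ _ 1) => // [|xi]; last exact: norm_cos.
exact: Rn_measurable_cos_dotp.
Qed.

Lemma ctr_bound a p x : Rn_integrable p -> `|ctr a p x| <= Rn_int (fun xi => `|p xi|).
Proof.
move=> ip; apply: (le_trans (Rn_int_norm (ctr_integrable a x ip))).
apply: Rn_int_le; [exact/Rn_integrable_norm/ctr_integrable|exact: Rn_integrable_norm|].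
by move=> xi; rewrite normrM ler_piMr// norm_cos.
Qed.

Lemma ctrD a p q x : Rn_integrable p -> Rn_integrable q ->
  ctr a (fun xi => p xi + q xi) x = ctr a p x + ctr a q x.
Proof.
move=> ip iq; rewrite -Rn_intD; [|exact: ctr_integrable..].
by apply: eq_Rn_int => xi; rewrite mulrDl.
Qed.

Lemma ctrZ a (k : R) p x : Rn_integrable p ->
  ctr a (fun xi => k * p xi) x = k * ctr a p x.
Proof.
move=> ip; rewrite -Rn_intZ; last exact: ctr_integrable.
by apply: eq_Rn_int => xi; rewrite mulrA.
Qed.

Lemma ctrN a p x : Rn_integrable p -> ctr a (fun xi => - p xi) x = - ctr a p x.
Proof.
move=> ip; rewrite -[RHS]mulN1r -ctrZ//.
by congr ctr; apply/funext => xi; rewrite mulN1r.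
Qed.

Lemma ctrB a p q x : Rn_integrable p -> Rn_integrable q ->
  ctr a (fun xi => p xi - q xi) x = ctr a p x - ctr a q x.
Proof.
move=> ip iq; rewrite -Rn_intB; [|exact: ctr_integrable..].
by apply: eq_Rn_int => xi; rewrite mulrBl.
Qed.

Lemma ctrDpi a p x : Rn_integrable p -> ctr (a + pi) p x = - ctr a p x.
Proof.
move=> ip; rewrite -mulN1r -Rn_intZ; last exact: ctr_integrable.
by apply: eq_Rn_int => xi; rewrite addrA cosDpi; ring.
Qed.

Lemma ctr_continuous a p : Rn_integrable p -> continuous (ctr a p).
Proof.
move=> ip; apply: sequentially_continuous => x u ux.
have [||||_] // := @Rn_dominated_convergence _ _
    (fun k xi => p xi * cos (dotp (u k) xi + a)) (fun xi => p xi * cos (dotp x xi + a))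
    (fun xi => `|p xi|).
- move=> k; apply: Rn_measurableM; first exact: Rn_integrable_measurable.
  exact: Rn_measurable_cos_dotp.
- exact: Rn_integrable_norm.
- by move=> k xi; rewrite normrM ler_piMr// norm_cos.
- move=> xi; apply: cvgM; first exact: cvg_cst.
  apply: (@cvg_comp _ _ _ u (fun y => cos (dotp y xi + a)) _ (nbhs x)) => //.
  exact: (differentiable_continuous (differentiable_cos_dotp x xi a)).
Qed.

(** Differentiation under the integral along the line x + t v with |t| < 1; the derivative of the
    integrand is bounded by |(v . xi) p(xi)|, independently of t. *)
Lemma is_derive_ctr a p x v : Rn_integrable p ->
  Rn_integrable (fun xi => dotp v xi * p xi) ->
  is_derive x v (ctr a p) (ctr (a + pi / 2) (fun xi => dotp v xi * p xi) x).
Proof.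
move=> ip ivp; apply: is_derive_line.
pose f (t : R) (y : T) : R :=
  p (row_of y) * cos (dotp (x + t *: v) (row_of y) + a).
have df (t : R) (y : T) : is_derive t (1 : R) (f ^~ y)
    (dotp v (row_of y) * p (row_of y) * cos (dotp (x + t *: v) (row_of y) + (a + pi / 2))).
  have H := is_derive_cos_dotp (x + t *: v) v (row_of y) a.
  apply: (is_derive_eq (is_deriveZ (p (row_of y)) (is_derive_to_line H))).
  by rewrite /GRing.scale/=; ring.
have I0 : `]-1, 1[%classic (0 : R) by rewrite /= in_itv/= ltrN10 ltr01.
have intf (t : R) : `]-1, 1[%classic t -> (lebesgue_Rn R n).-integrable setT (EFin \o f t).
  by move=> _; exact: ctr_integrable.
have derf (t : R) (y : T) : `]-1, 1[%classic t -> setT y -> derivable (f ^~ y) t 1.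
  by move=> _ _; apply: ex_derive; exact: df.
pose G (y : T) : R := `|dotp v (row_of y) * p (row_of y)|.
have G0 (y : T) : 0 <= G y by exact: normr_ge0.
have iG : (lebesgue_Rn R n).-integrable setT (EFin \o G) by exact: (Rn_integrable_norm ivp).
have fG (t : R) (y : T) : `]-1, 1[%classic t -> setT y -> `|partial1of2 f t y| <= G y.
  move=> _ _; rewrite /partial1of2 derive1E (@derive_val _ _ _ _ _ _ _ (df t y)) normrM ler_piMr//.
  exact: norm_cos.
have E : (fun t : R => ctr a p (x + t *: v)) =
    (fun t : R => \int[lebesgue_Rn R n]_(y in setT) f t y) by [].
apply: DeriveDef.
  rewrite E; exact: (derivable_under_integral measurableT I0 intf derf G0 iG fG).
rewrite E -derive1E (differentiation_under_integral measurableT I0 intf derf G0 iG fG).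
apply: eq_Rintegral => y _.
by rewrite /partial1of2 derive1E (@derive_val _ _ _ _ _ _ _ (df 0 y)) scale0r addr0.
Qed.

Lemma is_derive_ctr_coord a p x i : Rn_integrable p ->
  Rn_integrable (fun xi : Rn => xi ord0 i * p xi) ->
  is_derive x (e_ i) (ctr a p) (ctr (a + pi / 2) (fun xi : Rn => xi ord0 i * p xi) x).
Proof.
move=> ip; have -> : (fun xi : Rn => xi ord0 i * p xi) = (fun xi : Rn => dotp (e_ i) xi * p xi).
  by apply/funext => xi; rewrite dotp_delta.
exact: is_derive_ctr.
Qed.

Lemma jap2_decay_ge0 (psi : Rn -> R) (M : R) :
  (forall x, `|psi x| <= M * (jap2 x ^+ n)^-1) -> 0 <= M.
Proof.
move=> /(_ 0)/(le_trans (normr_ge0 _)).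
by rewrite pmulr_lge0// invr_gt0 exprn_gt0// jap2_gt0.
Qed.

(** Peetre's inequality gives [jap2 x] <= 4 [jap2 (x + v)], whence the factor 4 ^ n. The condition
    on v covers steps of length at most 1 along a coordinate axis. *)
Lemma rapid_shift_bound (psi : Rn -> R) (M : R) x v : jap2 v <= 2 ->
  (forall x, `|psi x| <= M * (jap2 x ^+ n)^-1) ->
  `|psi (x + v)| <= 4 ^+ n * M * (jap2 x ^+ n)^-1.
Proof.
move=> v2 HM.
have M0 := jap2_decay_ge0 HM.
apply: (le_trans (HM _)); rewrite mulrAC [leRHS]mulrC ler_wpM2l//.
rewrite -lef_pV2 ?posrE ?mulr_gt0 ?exprn_gt0 ?invr_gt0 ?exprn_gt0 ?jap2_gt0//.
rewrite invfM !invrK mulrC ler_pdivrMr ?exprn_gt0// -exprMn.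
have jx := jap2_gt0 x; have jxv := jap2_gt0 (x + v).
rewrite lerXn2r ?nnegrE ?mulr_ge0 ?(ltW jx) ?(ltW jxv)//.
have := jap2D (x + v) (- v); rewrite addrK.
have -> : jap2 (- v) = jap2 v by rewrite /jap2 dotpNl dotpNr opprK.
move: v2 jxv; move: (jap2 (x + v)) (jap2 v) => u w; nra.
Qed.

Lemma jap2_delta i (c : R) : jap2 (c *: e_ i) = 1 + c ^+ 2.
Proof. by rewrite /jap2 dotpZl dotpZr dotp_delta !mxE !eqxx mulr1 expr2. Qed.

(* The difference quotients of psi have integral zero by translation invariance. *)
Lemma Rn_int_pderiv0 psi dpsi i (M : R) : Rn_measurable psi ->
  (forall x, is_derive x (e_ i) psi (dpsi x)) ->
  (forall x, `|psi x| <= M * (jap2 x ^+ n)^-1) ->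
  (forall x, `|dpsi x| <= M * (jap2 x ^+ n)^-1) -> Rn_int dpsi = 0.
Proof.
move=> mpsi dP bpsi bdpsi.
have ipsi : Rn_integrable psi.
  by apply: (Rn_integrable_le mpsi bpsi); exact/Rn_integrableZ/Rn_integrable_jap2.
pose h (k : nat) : R := k.+1%:R^-1.
have h0 k : 0 < h k by rewrite /h invr_gt0.
have h1 k : h k <= 1 by rewrite /h invf_le1 ?ltr0n// ler1n.
pose D k x := (h k)^-1 * (psi (x + h k *: e_ i) - psi x).
have ish k := Rn_integrable_shift (h k *: e_ i) ipsi.
have iD k : Rn_integrable (D k) by apply: Rn_integrableZ; exact: Rn_integrableB.
have D0 k : Rn_int (D k) = 0.
  rewrite /D Rn_intZ; last exact: Rn_integrableB.
  by rewrite Rn_intB// Rn_int_shift// subrr mulr0.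
have [||||_] := @Rn_dominated_convergence _ _ D dpsi
    (fun x => 4 ^+ n * M * (jap2 x ^+ n)^-1).
- by move=> k; exact: Rn_integrable_measurable.
- exact/Rn_integrableZ/Rn_integrable_jap2.
- move=> k x; rewrite /D.
  (* The mean value theorem replaces the difference quotient by a value of [dpsi] at distance at
     most 1 from x, which the shift bound dominates uniformly in k. *)
  have dl (t : R) := is_derive_to_line (dP (x + t *: e_ i)).
  have [|c] := @MVT R (fun t => psi (x + t *: e_ i)) (fun t => dpsi (x + t *: e_ i)) 0 (h k) (h0 k) (fun t _ => dl t).
  + apply: continuous_subspaceT => t; apply: differentiable_continuous.
    by apply/derivable1_diffP; apply: ex_derive; exact: dl.
  rewrite in_itv/= => /andP[c0 ch]; rewrite scale0r addr0 subr0 => ->.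
  rewrite mulrC mulfK ?gt_eqF//.
  apply: rapid_shift_bound => //; rewrite jap2_delta.
  by have := h1 k; nra.
- move=> x.
  have [dx <-] := dP x; rewrite /D.
  have /cvgr_dnbhsP/(_ h) := dx.
  rewrite -/('D_(e_ i) psi x) => H.
  have -> : (fun k => (h k)^-1 * (psi (x + h k *: e_ i) - psi x)) =
      (fun k => (h k)^-1 *: ((psi \o shift x) (h k *: e_ i) - psi x)).
    by apply/funext => k /=; rewrite (addrC x).
  apply: H; split=> [k|]; first by rewrite gt_eqF.
  exact: cvg_harmonic.
under eq_fun do rewrite D0.
by move=> /(cvg_unique _ (cvg_cst _)) <-.
Qed.

(** Integration by parts: the derivative of phi(y) cos (x . y + a) in y_i integrates to 0, and its
    two terms are the two sides of the identity. *)
Lemma schwartz_ctr_pderiv a phi i x : schwartz_real phi ->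
  ctr a (pderiv i phi) x = - (x ord0 i * ctr (a + pi / 2) phi x).
Proof.
move=> Sphi; have Sd := schwartz_real_pderiv i Sphi.
have ip := schwartz_real_integrable Sphi; have id := schwartz_real_integrable Sd.
pose psi y := phi y * cos (dotp x y + a).
pose dpsi y := pderiv i phi y * cos (dotp x y + a) +
  x ord0 i * (phi y * cos (dotp x y + (a + pi / 2))).
have [M HM] := rapid_bound (schwartz_real_rapid Sphi).
have [N HN] := rapid_bound (schwartz_real_rapid Sd).
have M0 := jap2_decay_ge0 HM.
have N0 := jap2_decay_ge0 HN.
suff : Rn_int dpsi = 0.
  rewrite /dpsi Rn_intD; [|exact: ctr_integrable|exact/Rn_integrableZ/ctr_integrable].
  by rewrite Rn_intZ; [move=> /eqP; rewrite addr_eq0 => /eqP|exact: ctr_integrable].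
have jy y : 0 < (jap2 y ^+ n)^-1 by rewrite invr_gt0 exprn_gt0// jap2_gt0.
apply: (@Rn_int_pderiv0 psi dpsi i (M + N + `|x ord0 i| * M)).
- apply: Rn_measurableM; first exact: schwartz_real_measurable.
  exact: Rn_measurable_cos_dotp.
- move=> y; rewrite /psi; under eq_fun do rewrite dotpC.
  apply: (is_derive_eq (is_deriveM (is_derive_pderiv i (schwartz_real_differentiable y Sphi))
    (is_derive_cos_dotp y (e_ i) x a))).
  by rewrite /GRing.scale/= dotp_delta /dpsi dotpC; ring.
- move=> y; rewrite /psi normrM (le_trans (ler_piMr _ (norm_cos _)))//.
  rewrite (le_trans (HM y))// ler_wpM2r ?(ltW (jy y))//.
  by have := normr_ge0 (x ord0 i); nra.
- move=> y; rewrite /dpsi (le_trans (ler_normD _ _))// !mulrDl.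
  rewrite -addrA [leRHS]addrCA.
  rewrite lerD//.
    rewrite normrM (le_trans (ler_piMr _ (norm_cos _)))//.
  rewrite -[leLHS]add0r lerD// ?mulr_ge0 ?(ltW (jy y))//.
  rewrite normrM -mulrA ler_wpM2l//.
  by rewrite normrM (le_trans (ler_piMr _ (norm_cos _))).
Qed.

Definition one_sub_laplacian phi x := phi x - \sum_(i < n) pderiv i (pderiv i phi) x.

Lemma schwartz_sum (s : seq 'I_n) (F : 'I_n -> Rn -> R) :
  (forall i, schwartz_real (F i)) -> schwartz_real (fun x => \sum_(i <- s) F i x).
Proof.
move=> SF; elim: s => [|i s IHs].
  by under [X in schwartz_real X]eq_fun do rewrite big_nil; exact: schwartz_real0.
by under [X in schwartz_real X]eq_fun do rewrite big_cons; exact: schwartz_realD.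
Qed.

Lemma schwartz_one_sub_laplacian phi : schwartz_real phi ->
  schwartz_real (one_sub_laplacian phi).
Proof.
move=> Sphi; apply: schwartz_realD => //.
under [X in schwartz_real X]eq_fun do rewrite -mulN1r.
apply/schwartz_realZ/schwartz_sum => i.
by do 2 apply: schwartz_real_pderiv.
Qed.

Lemma ctr_sum (s : seq 'I_n) a (F : 'I_n -> Rn -> R) x :
  (forall i, Rn_integrable (F i)) ->
  ctr a (fun xi => \sum_(i <- s) F i xi) x = \sum_(i <- s) ctr a (F i) x /\
  Rn_integrable (fun xi => \sum_(i <- s) F i xi).
Proof.
move=> iF; elim: s => [|i s [IHs is_]].
  under [X in ctr a X]eq_fun do rewrite big_nil.
  under [X in Rn_integrable X]eq_fun do rewrite big_nil.
  rewrite big_nil; split; last exact: Rn_integrable0.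
  by rewrite /ctr -[RHS](@Rn_int0 R n); apply: eq_Rn_int => xi; rewrite mul0r.
under [X in ctr a X]eq_fun do rewrite big_cons.
under [X in Rn_integrable X]eq_fun do rewrite big_cons.
by rewrite big_cons ctrD// IHs; split => //; exact: Rn_integrableD.
Qed.

Lemma ctr_one_sub_laplacian a phi x : schwartz_real phi ->
  ctr a (one_sub_laplacian phi) x = jap2 x * ctr a phi x.
Proof.
move=> Sphi; have ip := schwartz_real_integrable Sphi.
have idd i : Rn_integrable (pderiv i (pderiv i phi)).
  by apply: schwartz_real_integrable; do 2 apply: schwartz_real_pderiv.
have [E isum] := ctr_sum (index_enum 'I_n) a x idd.
rewrite /one_sub_laplacian ctrB// E /jap2 mulrDl mul1r; congr (_ + _).
rewrite /dotp mulr_suml -sumrN; apply: eq_bigr => i _.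
rewrite schwartz_ctr_pderiv; last exact: schwartz_real_pderiv.
rewrite schwartz_ctr_pderiv// -addrA -splitr.
by rewrite ctrDpi//; ring.
Qed.

(** [jap2] ^ k times the transform of phi is the transform of (1 - Delta)^k phi, a Schwartz
    function, hence bounded by its L^1 norm. *)
Lemma ctr_rapid a phi : schwartz_real phi -> rapid (ctr a phi).
Proof.
move=> Sphi k.
have Sk j : schwartz_real (iter j one_sub_laplacian phi).
  by elim: j => //= j; exact: schwartz_one_sub_laplacian.
exists (Rn_int (fun y => `|iter k one_sub_laplacian phi y|)) => x.
rewrite (le_trans _ (ctr_bound a x (schwartz_real_integrable (Sk k))))//.
suff -> : ctr a (iter k one_sub_laplacian phi) x = jap2 x ^+ k * ctr a phi x.
  by rewrite normrM ger0_norm// exprn_ge0// ltW// jap2_gt0.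
elim: k => [|k IHk]; first by rewrite expr0 mul1r.
by rewrite iterS ctr_one_sub_laplacian ?IHk ?exprS ?mulrA.
Qed.

Lemma ctr_schwartz_integrable a phi : schwartz_real phi -> Rn_integrable (ctr a phi).
Proof.
move=> Sphi; apply: rapid_integrable; last exact: ctr_rapid.
apply: continuous_Rn_measurable; exact: (ctr_continuous (schwartz_real_integrable Sphi)).
Qed.

End CosTransform.

(** * Fourier transforms of Gaussians and inversion for Schwartz functions *)

Section Inversion.
Context {R : realType} {n : nat}.
Local Notation Rn := 'rV[R]_n.
Implicit Types (p phi F : Rn -> R) (x y : Rn) (a : R).

Lemma cos_addr_phase (t b : R) : cos (t + b) = cos b * cos t + sin b * cos (t + pi / 2).
Proof. by rewrite cosD cosDpihalf; ring. Qed.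

Lemma ctr_phase a b p x : Rn_integrable p ->
  ctr (a + b) p x = cos b * ctr a p x + sin b * ctr (a + pi / 2) p x.
Proof.
move=> ip; rewrite -(Rn_intZ _ (ctr_integrable a x ip)) -(Rn_intZ _ (ctr_integrable (a + pi / 2) x ip)).
rewrite -Rn_intD; [|by apply/Rn_integrableZ/ctr_integrable..].
by apply: eq_Rn_int => y; rewrite !addrA (cos_addr_phase (dotp x y + a)); ring.
Qed.

Lemma gauss_integrable (a : R) b : 0 < a -> Rn_integrable (@gauss R n a b).
Proof. by move=> a0; apply: schwartz_real_integrable; exact: gauss_schwartz. Qed.

Lemma gauss_measurable (a : R) b : 0 < a -> Rn_measurable (@gauss R n a b).
Proof. by move=> a0; apply: Rn_integrable_measurable; exact: gauss_integrable. Qed.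

Lemma gauss_scale (e : R) b (z : Rn) : e != 0 ->
  gauss (e ^- 2) b (e *: z + b) = gauss 1 0 z.
Proof.
move=> e0; rewrite /gauss addrK subr0 dotpZl dotpZr; congr expR; field.
by rewrite e0.
Qed.

Lemma gauss_scale0 (e : R) (z : Rn) : gauss (e ^+ 2) 0 z = gauss 1 0 (e *: z).
Proof. by rewrite /gauss !subr0 dotpZl dotpZr; congr expR; field. Qed.

Lemma gauss_sym a b x : gauss a b x = gauss a x b.
Proof.
by rewrite /gauss -(opprB x b) dotpNl dotpNr opprK.
Qed.

Definition gauss_mass : R := Rn_int (@gauss R n 1 0).

Lemma lebesgue_Rn_setT_gt0 m : (0 < lebesgue_Rn R m setT)%E.
Proof.
elim: m => [|m IHm]; first by rewrite /= diracT lte_fin.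
have -> : lebesgue_Rn R m.+1 setT = (\int[lebesgue_Rn R m.+1]_t (cst 1%E) t)%E.
  by rewrite integral_cst// mul1e.
rewrite ge0_integral_cons//.
under eq_integral => r _ do rewrite (integral_cst _ measurableT) mul1e.
rewrite (integral_cst _ measurableT) mule_gt0//.
apply: (@lt_le_trans _ _ (@lebesgue_measure R `[0, 1]%classic)).
  by rewrite lebesgue_measure_itv/= lte_fin ltr01 oppr0 adde0 lte_fin.
by apply: le_measure => //; apply/mem_set; [exact: measurable_itv|exact: measurableT].
Qed.

(** If the integral of a positive function vanished, the whole space would be a null set. Positivity
    is what permits division by the inversion constant. *)
Lemma gauss_mass_gt0 : 0 < gauss_mass.
Proof.
have ig := @gauss_integrable 1 0 ltr01.
rewrite lt_neqAle eq_sym Rn_int_ge0 ?andbT; last by move=> x; exact/ltW/gauss_gt0.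
apply/negP => /eqP m0.
have : (\int[lebesgue_Rn R n]_t `|(gauss 1 0 (@row_of R n t))%:E| = 0)%E.
  under eq_integral => t _ do rewrite gee0_abs ?lee_fin ?(ltW (gauss_gt0 _ _ _))//.
  by rewrite -EFin_Rn_int// -/gauss_mass m0.
have mg : measurable_fun setT (fun t => (gauss 1 0 (@row_of R n t))%:E).
  by apply/measurable_EFinP; exact: Rn_integrable_measurable.
move/(ae_eq_integral_abs _ measurableT mg) => [N [mN N0 HN]].
have := lebesgue_Rn_setT_gt0 n; rewrite (_ : setT = N) ?N0 ?ltxx//.
apply/esym/seteqP; split => // t _; apply: HN => /= /(_ I) /eqP.
by rewrite eqe gt_eqF// gauss_gt0.
Qed.

(* Along the ray r *: x, the product of the transform with expR (r ^ 2 |x| ^ 2 / 2a)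
   has zero derivative. *)
Lemma ctr_gauss_mass (a b : R) x : 0 < a -> ctr b (gauss a 0) x =
  cos b * Rn_int (@gauss R n a 0) * expR (- (2 * a)^-1 * dotp x x).
Proof.
move=> a0; pose g := @gauss R n a 0; have ig : Rn_integrable g := gauss_integrable 0 a0.
have Sg : schwartz_real g by exact: gauss_schwartz.
pose F (r : R) := ctr b g (0 + r *: x) * expR (r * r * ((2 * a)^-1 * dotp x x)).
(* The gradient of the centred Gaussian g at y is - a g(y) y, so the factor x . y produced by
   differentiating the transform can be traded for derivatives of g. *)
have dgE : (fun y => dotp x y * g y) = (fun y => \sum_(i < n) (- (x ord0 i / a)) * pderiv i g y).
  apply/funext => y; rewrite /dotp mulr_suml; apply: eq_bigr => i _.
  rewrite (pderivE (gauss_is_derive a 0 y i)) -/g mxE; field.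
  by rewrite gt_eqF.
have iF i : Rn_integrable (fun y => (- (x ord0 i / a)) * pderiv i g y).
  by apply: Rn_integrableZ; apply: schwartz_real_integrable; exact: schwartz_real_pderiv.
have idg : Rn_integrable (fun y => dotp x y * g y).
  by rewrite dgE; case: (ctr_sum (index_enum 'I_n) 0 0 iF).
have dE (r : R) : ctr (b + pi / 2) (fun y => dotp x y * g y) (r *: x) =
    - (r / a * dotp x x * ctr b g (r *: x)).
  rewrite dgE; have [-> _] := ctr_sum (index_enum 'I_n) (b + pi / 2) (r *: x) iF.
  rewrite /dotp mulr_sumr mulr_suml -sumrN; apply: eq_bigr => i _.
  rewrite ctrZ; last by apply: schwartz_real_integrable; exact: schwartz_real_pderiv.
  rewrite schwartz_ctr_pderiv// -addrA -splitr.
  by rewrite ctrDpi// mxE; field; rewrite gt_eqF.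
have dF r : is_derive r (1 : R) F 0.
  have H : is_derive (0 + r *: x) x (ctr b g) (- (r / a * dotp x x * ctr b g (r *: x))).
    by rewrite add0r -dE; exact: is_derive_ctr.
  have H1 := is_derive_to_line H.
  have H2 : is_derive r (1 : R) (fun r => expR (r * r * ((2 * a)^-1 * dotp x x)))
      (2 * r * ((2 * a)^-1 * dotp x x) * expR (r * r * ((2 * a)^-1 * dotp x x))).
    by apply: is_derive_eq; rewrite /GRing.scale/=; ring.
  apply: (is_derive_eq (is_deriveM H1 H2)); rewrite /GRing.scale/= add0r; field.
  by rewrite gt_eqF.
have := is_derive_0_is_cst 1 0 dF.
rewrite /F !mulr1 !mul0r expR0 mul1r scale1r scale0r !add0r mulr1 => E.
have -> : ctr b g x = ctr b g 0 * expR (- (2 * a)^-1 * dotp x x).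
  by rewrite -E -mulrA -expRD mulNr subrr expR0 mulr1.
congr (_ * _); rewrite /ctr -Rn_intZ//; apply: eq_Rn_int => y.
by rewrite dotp0l add0r mulrC.
Qed.

Lemma Rn_int_gauss_scale (e : R) : 0 < e ->
  Rn_int (@gauss R n (e ^+ 2) 0) = (e ^+ n)^-1 * gauss_mass.
Proof.
move=> e0; rewrite /gauss_mass -[in RHS](gtr0_norm e0).
rewrite -(Rn_int_affine 0 (lt0r_neq0 e0) (gauss_integrable 0 ltr01)).
by apply: eq_Rn_int => z; rewrite addr0 gauss_scale0.
Qed.

Lemma ctr_gauss (e b : R) x : 0 < e -> ctr b (gauss (e ^+ 2) 0) x =
  cos b * ((e ^+ n)^-1 * gauss_mass) * gauss (e ^- 2) 0 x.
Proof.
move=> e0; rewrite ctr_gauss_mass ?exprn_gt0// Rn_int_gauss_scale//; congr (_ * _).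
rewrite /gauss subr0; congr expR; field.
by rewrite gt_eqF.
Qed.

Definition eps_ (k : nat) : R := k.+1%:R^-1.

Lemma eps_gt0 k : 0 < eps_ k.
Proof. by rewrite /eps_ invr_gt0. Qed.

Lemma cvg_eps : eps_ @ \oo --> 0.
Proof. exact: cvg_harmonic. Qed.

Lemma Rn_integrable_gaussM F (M : R) (a : R) b : 0 < a -> Rn_measurable F ->
  (forall y, `|F y| <= M) -> Rn_integrable (fun y => F y * gauss a b y).
Proof.
move=> a0 mF FM; under [X in Rn_integrable X]eq_fun do rewrite mulrC.
by apply: (@Rn_integrableM_bounded _ _ M) => //; exact: gauss_integrable.
Qed.

(** The substitution y = e z + x turns a Gaussian of width e at x into a fixed one, so that as e
    tends to 0 the integrands keep one dominating function. *)
Lemma gauss_average (e : R) F x (M : R) : 0 < e -> Rn_measurable F ->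
  (forall y, `|F y| <= M) ->
  (e ^+ n)^-1 * Rn_int (fun y => F y * gauss (e ^- 2) x y) =
  Rn_int (fun z => F (e *: z + x) * gauss 1 0 z).
Proof.
move=> e0 mF FM.
have e2 : 0 < e ^- 2 by rewrite invr_gt0 exprn_gt0.
have i1 := Rn_integrable_gaussM x e2 mF FM.
rewrite -{1}(gtr0_norm e0) -(Rn_int_affine x (lt0r_neq0 e0) i1).
by apply: eq_Rn_int => z; rewrite gauss_scale// gt_eqF.
Qed.

Lemma gauss_average_bound (e : R) F x (M : R) : Rn_measurable F ->
  (forall y, `|F y| <= M) -> e != 0 ->
  `|Rn_int (fun z => F (e *: z + x) * gauss 1 0 z)| <= M * gauss_mass.
Proof.
move=> mF FM e0.
have ig := @gauss_integrable 1 0 ltr01.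
have i1 := Rn_integrable_gaussM 0 ltr01 (Rn_measurable_affine e x mF) (fun z => FM _).
rewrite (le_trans (Rn_int_norm i1))// -Rn_intZ//; apply: Rn_int_le => //.
- exact: Rn_integrable_norm.
- exact: Rn_integrableZ.
- by move=> z; rewrite normrM (gtr0_norm (gauss_gt0 _ _ _)) ler_wpM2r// ltW// gauss_gt0.
Qed.

Lemma gauss_average_cvg F x (M : R) : continuous F -> (forall y, `|F y| <= M) ->
  (fun k => Rn_int (fun z => F (eps_ k *: z + x) * gauss 1 0 z)) @ \oo --> F x * gauss_mass.
Proof.
move=> cF FM; have ig := @gauss_integrable 1 0 ltr01.
have mF := continuous_Rn_measurable cF.
rewrite /gauss_mass -Rn_intZ//.
have [||||_] // := @Rn_dominated_convergence _ _
   (fun k z => F (eps_ k *: z + x) * gauss 1 0 z) (fun z => F x * gauss 1 0 z)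
   (fun z => M * gauss 1 0 z).
- move=> k; apply: Rn_measurableM; first exact: (Rn_measurable_affine (eps_ k) x mF).
  exact: Rn_integrable_measurable.
- exact: Rn_integrableZ.
- by move=> k z; rewrite normrM (gtr0_norm (gauss_gt0 _ _ _)) ler_wpM2r// ltW// gauss_gt0.
- move=> z; apply: cvgM; last exact: cvg_cst.
  apply: (@cvg_comp _ _ _ (fun k => eps_ k *: z + x) F _ (nbhs x)); last exact: cF.
  have H : (fun k => eps_ k *: z + x) @ \oo --> 0 *: z + x.
    by apply: cvgD; [apply: cvgZr_tmp; exact: cvg_eps|exact: cvg_cst].
  by move: H; rewrite scale0r add0r.
Qed.

Lemma gauss_eps_cvg1 x : (fun k => gauss (eps_ k ^+ 2) 0 x) @ \oo --> (1 : R).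
Proof.
rewrite -expR0; apply: (@cvg_comp _ _ _ _ expR _ (nbhs (0 : R))); last exact: continuous_expR.
have : (fun k => - (eps_ k * eps_ k / 2) * dotp (x - 0) (x - 0)) @ \oo -->
    - (0 * 0 / 2) * dotp (x - 0) (x - 0).
  apply: cvgM; last exact: cvg_cst.
  by apply: cvgN; apply: cvgM; [apply: cvgM; exact: cvg_eps|exact: cvg_cst].
have -> : - (0 * 0 / 2) * dotp (x - 0) (x - 0) = 0 by ring.
by apply: cvg_trans; apply: near_eq_cvg; near=> k; rewrite expr2.
Unshelve. all: by end_near.
Qed.

Lemma gauss_le1 (a : R) b x : 0 <= a -> gauss a b x <= 1 :> R.
Proof.
move=> a0; rewrite /gauss -expR0 ler_expR.
by rewrite mulNr oppr_le0 mulr_ge0 ?dotp_ge0// divr_ge0.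
Qed.

Lemma gauss_regularization_cvg W : Rn_integrable W ->
  (fun k => Rn_int (fun x => gauss (eps_ k ^+ 2) 0 x * W x)) @ \oo --> Rn_int W.
Proof.
move=> iW; have gk k : 0 < eps_ k ^+ 2 by rewrite exprn_gt0// eps_gt0.
have [||||_] // := @Rn_dominated_convergence _ _
    (fun k x => gauss (eps_ k ^+ 2) 0 x * W x) W (fun x => `|W x|).
- move=> k; apply: Rn_measurableM; first exact: gauss_measurable.
  exact: Rn_integrable_measurable.
- exact: Rn_integrable_norm.
- move=> k x; rewrite normrM (gtr0_norm (gauss_gt0 _ _ _)) ler_piMl//.
  by rewrite gauss_le1// ltW.
- move=> x; rewrite -[X in _ --> X]mul1r; apply: cvgM; last exact: cvg_cst.
  exact: gauss_eps_cvg1.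
Qed.

Lemma ctr_shift_integrable (a : R) phi xi : schwartz_real phi ->
  Rn_integrable (fun x => ctr (- (dotp x xi + a)) phi x).
Proof.
move=> Sphi; have ip := schwartz_real_integrable Sphi.
rewrite (_ : (fun x => _) = fun x => ctr 0 phi x * cos (dotp x xi + a) -
    ctr (pi / 2) phi x * cos (dotp x xi + (a - pi / 2))); last first.
  apply/funext => x; rewrite -[- _]add0r ctr_phase// cosN sinN add0r addrA cosBpihalf; ring.
have mcos (b : R) : Rn_measurable (fun x => cos (dotp x xi + b)).
  by under [X in Rn_measurable X]eq_fun do rewrite dotpC; exact: Rn_measurable_cos_dotp.
apply: Rn_integrableB; apply: (@Rn_integrableM_bounded _ _ 1) => //;
  by [move=> x; exact: norm_cos|exact: ctr_schwartz_integrable].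
Qed.

(* The inner integral is, as a function of x, a bounded multiple of a rapidly
   decreasing function; inserting a Gaussian in x permits the exchange of the
   two integrals. *)
Lemma schwartz_inversion (a : R) phi xi : schwartz_real phi ->
  Rn_int (fun x => ctr (- (dotp x xi + a)) phi x) = cos a * gauss_mass ^+ 2 * phi xi.
Proof.
move=> Sphi; have ip := schwartz_real_integrable Sphi.
pose W x := ctr (- (dotp x xi + a)) phi x.
have iW : Rn_integrable W := ctr_shift_integrable a xi Sphi.
have gk k : 0 < eps_ k ^+ 2 by rewrite exprn_gt0// eps_gt0.
have [M HM] := rapid_bounded (schwartz_real_rapid Sphi).
(* Integrating in x first gives the transform of a wide Gaussian, which is a narrow Gaussian at
   distance y - xi: what remains is a Gaussian average of phi at xi. *)
have swap k : Rn_int (fun x => gauss (eps_ k ^+ 2) 0 x * W x) =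
    cos a * gauss_mass * Rn_int (fun z => phi (eps_ k *: z + xi) * gauss 1 0 z).
  pose H x y := gauss (eps_ k ^+ 2) 0 x * (phi y * cos (dotp x y + - (dotp x xi + a))).
  have mH : Rn_measurable2 H.
    apply: Rn_measurable2M.
      exact: (Rn_measurable2_fst (gauss_measurable 0 (gk k))).
    apply: Rn_measurable2M.
      exact: (Rn_measurable2_snd (Rn_integrable_measurable ip)).
    apply: (Rn_measurable2_comp (continuous_measurable_fun (@continuous_cos R))).
    apply: Rn_measurable2D; first exact: Rn_measurable2_dotp.
    apply: (Rn_measurable2_fst (F := fun x => - (dotp x xi + a))).
    apply: (Rn_measurable_comp (@oppr_measurable R setT)).
    apply: Rn_measurableD; last exact: Rn_measurable_cst.
    under [X in Rn_measurable X]eq_fun do rewrite dotpC.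
    exact: Rn_measurable_dotp.
  have [|_ _] := Rn_fubini_prod mH (gauss_integrable 0 (gk k)) (Rn_integrable_norm ip).
    move=> x y; rewrite /H normrM (gtr0_norm (gauss_gt0 _ _ _)) ler_wpM2l ?(ltW (gauss_gt0 _ _ _))//.
    by rewrite normrM ler_piMr// norm_cos.
  have -> : (fun x => Rn_int (H x)) = (fun x => gauss (eps_ k ^+ 2) 0 x * W x).
    by apply/funext => x; rewrite /H Rn_intZ//; exact: ctr_integrable.
  move=> ->.
  have gk' : 0 < eps_ k ^- 2 by rewrite invr_gt0 gk.
  have -> : (fun y => Rn_int (H ^~ y)) = (fun y =>
      cos a * gauss_mass * ((eps_ k ^+ n)^-1 * (phi y * gauss (eps_ k ^- 2) xi y))).
    apply/funext => y.
    have -> : Rn_int (H ^~ y) = phi y * ctr a (gauss (eps_ k ^+ 2) 0) (xi - y).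
      rewrite /ctr -Rn_intZ; last exact/ctr_integrable/gauss_integrable.
      apply: eq_Rn_int => x; rewrite /H mulrCA; congr (_ * (_ * _)).
      by rewrite -cosN; congr cos; rewrite (dotpC (xi - y)) dotpDr dotpNr; ring.
    rewrite ctr_gauss ?eps_gt0// [in gauss _ xi y]gauss_sym.
    rewrite (_ : gauss (eps_ k ^- 2) 0 (xi - y) = gauss (eps_ k ^- 2) y xi); last first.
      by rewrite /gauss subr0.
    by ring.
  have i2 := Rn_integrable_schwartzM ip (gauss_schwartz xi gk').
  rewrite Rn_intZ; last exact: Rn_integrableZ.
  rewrite Rn_intZ// (@gauss_average _ _ _ M) ?eps_gt0//.
  exact: schwartz_real_measurable.
have c1 := gauss_regularization_cvg iW.
have c2 : (fun k => Rn_int (fun x => gauss (eps_ k ^+ 2) 0 x * W x)) @ \oo -->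
    cos a * gauss_mass * (phi xi * gauss_mass).
  under eq_fun do rewrite swap.
  apply: cvgM; first exact: cvg_cst.
  exact: (gauss_average_cvg (schwartz_real_continuous Sphi) HM).
have := cvg_unique _ c1 c2; rewrite -/W => ->//.
by ring.
Qed.

End Inversion.

(** * The inverse Fourier transform *)

Section InverseFourier.
Local Open Scope complex_scope.
Context {R : realType} {n : nat}.
Local Notation Rn := 'rV[R]_n.
Local Notation C := R[i].
Local Notation normc := ComplexField.Normc.normc.
Local Notation Ct := (ctr (0 : R)).
Local Notation St := (ctr (- (pi / 2) : R)).
Local Notation m_ := (@gauss_mass R n).
Implicit Types (p u : Rn -> R) (x y xi : Rn) (G H phi : Rn -> C).

Lemma Re_mulc (z w : C) : complex.Re (z * w) =
  complex.Re z * complex.Re w - complex.Im z * complex.Im w.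
Proof. by case: z w => [a b] [c d]. Qed.

Lemma Im_mulc (z w : C) : complex.Im (z * w) =
  complex.Re z * complex.Im w + complex.Im z * complex.Re w.
Proof. by case: z w => [a b] [c d]. Qed.

Lemma normc_sqrt (z : C) : normc z = Num.sqrt (complex.Re z ^+ 2 + complex.Im z ^+ 2).
Proof. by case: z. Qed.

Lemma normc_ge0 (z : C) : 0 <= normc z.
Proof. by rewrite normc_sqrt sqrtr_ge0. Qed.

Lemma Re_le_normc (z : C) : `|complex.Re z| <= normc z.
Proof. by rewrite normc_sqrt -sqrtr_sqr ler_wsqrtr// lerDl sqr_ge0. Qed.

Lemma Im_le_normc (z : C) : `|complex.Im z| <= normc z.
Proof. by rewrite normc_sqrt -sqrtr_sqr ler_wsqrtr// lerDr sqr_ge0. Qed.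

Lemma normc_le_ReDIm (z : C) : normc z <= `|complex.Re z| + `|complex.Im z|.
Proof.
rewrite normc_sqrt -[leRHS]ger0_norm ?addr_ge0// -sqrtr_sqr ler_wsqrtr// sqrrD.
rewrite !real_normK ?num_real// -addrA lerD2l lerDr.
by rewrite mulrn_wge0// mulr_ge0.
Qed.

Lemma complex_eq (z w : C) : complex.Re z = complex.Re w ->
  complex.Im z = complex.Im w -> z = w.
Proof. by case: z w => [a b] [c d] /= -> ->. Qed.

Lemma re_add G H : re (fun xi => G xi + H xi) = (fun xi => re G xi + re H xi).
Proof. by apply/funext => x; rewrite /re raddfD. Qed.

Lemma im_add G H : im (fun xi => G xi + H xi) = (fun xi => im G xi + im H xi).
Proof. by apply/funext => x; rewrite /im raddfD. Qed.

Lemma re_opp G : re (fun xi => - G xi) = (fun xi => - re G xi).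
Proof. by apply/funext => x; rewrite /re raddfN. Qed.

Lemma im_opp G : im (fun xi => - G xi) = (fun xi => - im G xi).
Proof. by apply/funext => x; rewrite /im raddfN. Qed.

Lemma ctr_pihalf p x : Rn_integrable p -> ctr (pi / 2) p x = - St p x.
Proof.
move=> ip; rewrite -(ctrDpi (- (pi / 2)) x ip); congr (ctr _ p x); by field.
Qed.

(** The multiplication formula. After exchanging the integrals, the inner one is the inversion
    integral of u with phase a. The phases 0 and pi / 2 give the real and the imaginary part of the
    complex identity. *)
Lemma plancherel_phase (a : R) p u : Rn_integrable p -> schwartz_real u ->
  Rn_integrable (fun x => ctr a p x * Ct u x + ctr (a - pi / 2) p x * St u x) /\
  Rn_int (fun x => ctr a p x * Ct u x + ctr (a - pi / 2) p x * St u x) =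
  cos a * m_ ^+ 2 * Rn_int (fun xi => p xi * u xi).
Proof.
move=> ip Su; have iu := schwartz_real_integrable Su.
pose H x xi := p xi * (Ct u x * cos (dotp x xi + a) + St u x * cos (dotp x xi + (a - pi / 2))).
have HE x xi : H x xi = p xi * ctr (- (dotp x xi + a)) u x.
  rewrite /H -[- (dotp x xi + a)]add0r ctr_phase// cosN sinN !add0r ctr_pihalf//.
  by rewrite addrA cosBpihalf; congr (_ * _); ring.
have iCu := ctr_schwartz_integrable 0 Su.
have iSu := ctr_schwartz_integrable (- (pi / 2)) Su.
have mcos (b : R) : Rn_measurable2 (fun x xi : Rn => cos (dotp x xi + b)).
  exact: (Rn_measurable2_comp (measurable_cos_shift b) Rn_measurable2_dotp).
have mH : Rn_measurable2 H.
  apply: Rn_measurable2M; first exact: (Rn_measurable2_snd (Rn_integrable_measurable ip)).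
  apply: Rn_measurable2D; apply: Rn_measurable2M => //.
    exact: (Rn_measurable2_fst (Rn_integrable_measurable iCu)).
  exact: (Rn_measurable2_fst (Rn_integrable_measurable iSu)).
have [|iH _] := Rn_fubini_prod mH (Rn_integrableD (Rn_integrable_norm iCu) (Rn_integrable_norm iSu))
    (Rn_integrable_norm ip).
  move=> x xi; rewrite /H normrM mulrC ler_wpM2r// (le_trans (ler_normD _ _))//.
  by rewrite lerD// normrM ler_piMr// norm_cos.
have E : (fun x => Rn_int (H x)) =
    (fun x => ctr a p x * Ct u x + ctr (a - pi / 2) p x * St u x).
  apply/funext => x; rewrite -!(mulrC (ctr _ u x)).
  rewrite /ctr -(Rn_intZ _ (ctr_integrable a x ip)).
  rewrite -(Rn_intZ _ (ctr_integrable (a - pi / 2) x ip)) -Rn_intD; last 2 first.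
  - exact/Rn_integrableZ/ctr_integrable.
  - exact/Rn_integrableZ/ctr_integrable.
  by apply: eq_Rn_int => xi; rewrite /H /ctr; ring.
rewrite -E => ->; split => //.
rewrite -Rn_intZ; last exact: Rn_integrable_schwartzM.
apply: eq_Rn_int => xi; rewrite mulrCA -schwartz_inversion//.
under eq_Rn_int do rewrite HE.
rewrite Rn_intZ//.
exact: ctr_shift_integrable.
Qed.

(* m_ ^ 2 is (2 pi) ^ n; its value never matters. *)
Definition inv_fourier G x : C :=
  (m_ ^- 2 * (Ct (re G) x - St (im G) x)) +i* (m_ ^- 2 * (St (re G) x + Ct (im G) x)).

Lemma fourier_integral_re phi x : schwartz phi ->
  re (fourier_integral phi) x = Ct (re phi) x + St (im phi) x.
Proof.
move=> [Sr Si]; rewrite /re /= /ctr -Rn_intD; last 2 first.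
- by apply: ctr_integrable; exact: schwartz_real_integrable.
- by apply: ctr_integrable; exact: schwartz_real_integrable.
apply: eq_Rn_int => y; rewrite {1}/re Re_mulc /= cosBpihalf addr0 (dotpC x) /re /im; ring.
Qed.

Lemma fourier_integral_im phi x : schwartz phi ->
  im (fourier_integral phi) x = Ct (im phi) x - St (re phi) x.
Proof.
move=> [Sr Si]; rewrite /im /= /ctr -Rn_intB; last 2 first.
- by apply: ctr_integrable; exact: schwartz_real_integrable.
- by apply: ctr_integrable; exact: schwartz_real_integrable.
apply: eq_Rn_int => y; rewrite {1}/im Im_mulc /= cosBpihalf addr0 (dotpC x) /re /im; ring.
Qed.

(** Both parts of the pairing expand into combinations [D0] of phase 0, which reproduce the
    integrals of G against phi, and combinations [D1] of phase pi / 2, which integrate to 0. *)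
Lemma inv_fourier_is_fourier G : C_integrable G -> is_fourier (inv_fourier G) G.
Proof.
move=> iG; split => // phi Sphi; have [Su Sv] := Sphi; have [ip iq] := iG.
have m0 : m_ != 0 by rewrite gt_eqF// gauss_mass_gt0.
pose D0 p u x := ctr 0 p x * Ct u x + ctr (0 - pi / 2) p x * St u x.
pose D1 p u x := ctr (pi / 2) p x * Ct u x + ctr (pi / 2 - pi / 2) p x * St u x.
have d0 p u : Rn_integrable p -> schwartz_real u ->
    Rn_integrable (D0 p u) /\ Rn_int (D0 p u) = m_ ^+ 2 * Rn_int (fun xi => p xi * u xi).
  by move=> hp hu; have [? ->] := plancherel_phase 0 hp hu; rewrite cos0 mul1r.
have d1 p u : Rn_integrable p -> schwartz_real u ->
    Rn_integrable (D1 p u) /\ Rn_int (D1 p u) = 0.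
  by move=> hp hu; have [? ->] := plancherel_phase (pi / 2) hp hu; rewrite cos_pihalf !mul0r.
have D0E p u x : D0 p u x = Ct p x * Ct u x + St p x * St u x by rewrite /D0 add0r.
have D1E p u x : Rn_integrable p -> D1 p u x = Ct p x * St u x - St p x * Ct u x.
  by move=> hp; rewrite /D1 subrr ctr_pihalf//; ring.
have [i1 e1] := d0 _ _ ip Su; have [i2 e2] := d0 _ _ iq Sv.
have [i3 e3] := d0 _ _ ip Sv; have [i4 e4] := d0 _ _ iq Su.
have [j1 h1] := d1 _ _ ip Su; have [j2 h2] := d1 _ _ iq Sv.
have [j3 h3] := d1 _ _ ip Sv; have [j4 h4] := d1 _ _ iq Su.
have pu := Rn_integrable_schwartzM ip Su; have qv := Rn_integrable_schwartzM iq Sv.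
have pv := Rn_integrable_schwartzM ip Sv; have qu := Rn_integrable_schwartzM iq Su.
have FR x : complex.Re (fourier_integral phi x) = Ct (re phi) x + St (im phi) x.
  exact: fourier_integral_re.
have FI x : complex.Im (fourier_integral phi x) = Ct (im phi) x - St (re phi) x.
  exact: fourier_integral_im.
apply: complex_eq => /=.
- have -> : Rn_int (re (fun x => inv_fourier G x * fourier_integral phi x)) =
    Rn_int (fun x => m_ ^- 2 * ((D0 (re G) (re phi) x - D0 (im G) (im phi) x) +
      (D1 (re G) (im phi) x + D1 (im G) (re phi) x))).
    apply: eq_Rn_int => x; rewrite {1}/re Re_mulc FR FI/=.
    by rewrite !D0E !D1E//; ring.
  rewrite Rn_intZ; last by apply: Rn_integrableD; [exact: Rn_integrableB|exact: Rn_integrableD].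
  rewrite Rn_intD; [|exact: Rn_integrableB|exact: Rn_integrableD].
  rewrite (Rn_intB i1 i2) (Rn_intD j3 j4) e1 e2 h3 h4 addr0 addr0 -mulrBr mulKf ?expf_neq0//.
  rewrite -Rn_intB//; apply: eq_Rn_int => x; by rewrite {3}/re Re_mulc.
- have -> : Rn_int (im (fun x => inv_fourier G x * fourier_integral phi x)) =
    Rn_int (fun x => m_ ^- 2 * ((D0 (re G) (im phi) x + D0 (im G) (re phi) x) +
      (D1 (im G) (im phi) x - D1 (re G) (re phi) x))).
    apply: eq_Rn_int => x; rewrite {1}/im Im_mulc FR FI/=.
    by rewrite !D0E !D1E//; ring.
  rewrite Rn_intZ; last by apply: Rn_integrableD; [exact: Rn_integrableD|exact: Rn_integrableB].
  rewrite Rn_intD; [|exact: Rn_integrableD|exact: Rn_integrableB].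
  rewrite (Rn_intD i3 i4) (Rn_intB j2 j1) e3 e4 h1 h2 subr0 addr0 -mulrDr mulKf ?expf_neq0//.
  rewrite -Rn_intD//; apply: eq_Rn_int => x; by rewrite {3}/im Im_mulc.
Qed.

End InverseFourier.

(** * Fourier inversion for bounded continuous functions *)

Section Uniqueness.
Local Open Scope complex_scope.
Context {R : realType} {n : nat}.
Local Notation Rn := 'rV[R]_n.
Local Notation C := R[i].
Local Notation m_ := (@gauss_mass R n).
Local Notation eps k := (@eps_ R k).
Implicit Types (p q F : Rn -> R) (x y : Rn) (G f : Rn -> C).

(* A test function whose Fourier transform is a narrow Gaussian centred at y. *)
Definition wave_packet (k : nat) y x : C :=
  (gauss (eps k ^+ 2) 0 x * cos (dotp x y + 0)) +i*
  (gauss (eps k ^+ 2) 0 x * cos (dotp x y + - (pi / 2))).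

Lemma wave_packet_schwartz k y : schwartz (wave_packet k y).
Proof.
have gk : 0 < eps k ^+ 2 by rewrite exprn_gt0// eps_gt0.
split; exact/schwartz_real_cos/gauss_schwartz.
Qed.

Lemma fourier_wave_packet k y x : fourier_integral (wave_packet k y) x =
  ((eps k ^+ n)^-1 * m_ * gauss (eps k ^- 2) y x) +i* 0.
Proof.
have gk : 0 < eps k ^+ 2 by rewrite exprn_gt0// eps_gt0.
have ig := @gauss_integrable R n _ 0 gk.
have Sw := wave_packet_schwartz k y; have [Sr Si] := Sw.
have ir := schwartz_real_integrable Sr; have ii := schwartz_real_integrable Si.
have E a : ctr a (gauss (eps k ^+ 2) 0) (x - y) =
    cos a * ((eps k ^+ n)^-1 * m_) * gauss (eps k ^- 2) y x.
  by rewrite ctr_gauss ?eps_gt0//; congr (_ * _); rewrite /gauss subr0.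
apply: complex_eq.
- rewrite -[LHS]/(re _ x) fourier_integral_re//=.
  have := E 0; rewrite cos0 mul1r => <-.
  rewrite -Rn_intD; [|exact: ctr_integrable..].
  apply: eq_Rn_int => z; rewrite /re /im /= dotpDl dotpNl !addr0 !cosBpihalf cosB.
  by rewrite (dotpC y z); ring.
- rewrite -[LHS]/(im _ x) fourier_integral_im//=.
  transitivity (- ctr (- (pi / 2)) (gauss (eps k ^+ 2) 0) (x - y)); last first.
    by rewrite E cosN cos_pihalf !mul0r oppr0.
  rewrite -[RHS]mulN1r -Rn_intZ; last exact: ctr_integrable.
  rewrite -Rn_intB; [|exact: ctr_integrable..].
  apply: eq_Rn_int => z; rewrite /re /im /= dotpDl dotpNl !addr0 !cosBpihalf sinB.
  by rewrite (dotpC y z); ring.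
Qed.

(** Duality is tested on wave packets. On the side of f this is a Gaussian average that tends to
    [gauss_mass] ^ 2 f(y), since f is bounded and continuous; on the side of G it is a regularised
    inverse Fourier integral. The equality therefore holds at every point y. *)
Lemma fourier_inversion f G : Cb0 f -> is_fourier f G -> f = inv_fourier G.
Proof.
move=> [cr ci [M HM]] [[ip iq] HG]; apply/funext => y.
have m0 : m_ != 0 by rewrite gt_eqF// gauss_mass_gt0.
have rM x : `|re f x| <= M by rewrite (le_trans (Re_le_normc _)).
have iM x : `|im f x| <= M by rewrite (le_trans (Im_le_normc _)).
pose w k x := (eps k ^+ n)^-1 * m_ * gauss (eps k ^- 2) y x.
have key F : continuous F -> (forall x, `|F x| <= M) ->
    (fun k => Rn_int (fun x => F x * w k x)) @ \oo --> m_ ^+ 2 * F y.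
  move=> cF FM; have mF := continuous_Rn_measurable cF.
  rewrite (_ : m_ ^+ 2 * F y = m_ * (F y * m_)); last by ring.
  have H k : Rn_int (fun x => F x * w k x) =
      m_ * Rn_int (fun z => F (eps k *: z + y) * gauss 1 0 z).
    rewrite -(@gauss_average _ _ _ _ _ M) ?eps_gt0//.
    have e2 : 0 < eps k ^- 2 by rewrite invr_gt0 exprn_gt0// eps_gt0.
    rewrite mulrA -Rn_intZ; last exact: (Rn_integrable_gaussM y e2 mF FM).
    by apply: eq_Rn_int => x; rewrite /w; ring.
  under eq_fun do rewrite H.
  by apply: cvgM; [exact: cvg_cst|exact: (gauss_average_cvg cF FM)].
have key2 p q a b : Rn_integrable p -> Rn_integrable q ->
    (fun k => Rn_int (fun x => gauss (eps k ^+ 2) 0 x *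
       (p x * cos (dotp y x + a) + q x * cos (dotp y x + b)))) @ \oo --> ctr a p y + ctr b q y.
  move=> hp hq; rewrite -Rn_intD; [|exact: ctr_integrable..].
  have iH : Rn_integrable (fun x => p x * cos (dotp y x + a) + q x * cos (dotp y x + b)).
    by apply: Rn_integrableD; exact: ctr_integrable.
  exact: gauss_regularization_cvg.
have limE F p q a b : continuous F -> (forall x, `|F x| <= M) ->
    Rn_integrable p -> Rn_integrable q ->
    (forall k, Rn_int (fun x => F x * w k x) = Rn_int (fun x => gauss (eps k ^+ 2) 0 x *
       (p x * cos (dotp y x + a) + q x * cos (dotp y x + b)))) ->
    F y = m_ ^- 2 * (ctr a p y + ctr b q y).
  move=> cF FM hp hq E; have := key F cF FM; under eq_fun do rewrite E.
  move=> /(cvg_unique _)/(_ (key2 _ _ a b hp hq)) H.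
  by apply: (@mulfI _ (m_ ^+ 2)); rewrite ?H// ?mulVKf ?expf_neq0.
have HGk k := HG _ (wave_packet_schwartz k y).
apply: complex_eq.
- rewrite -[LHS]/(re f y).
  rewrite (limE _ _ _ 0 (- (pi / 2)) cr rM ip (Rn_integrableN iq)) ?ctrN// => k.
  have /(congr1 (@complex.Re R)) /= := HGk k.
  rewrite [LHS](_ : _ = Rn_int (fun x => re f x * w k x)).
    by move=> ->; apply: eq_Rn_int => x; rewrite /re Re_mulc /= (dotpC x y) /im; ring.
  by apply: eq_Rn_int => x; rewrite {1}/re Re_mulc fourier_wave_packet/= mulr0 subr0.
- rewrite -[LHS]/(im f y) (limE _ _ _ (- (pi / 2)) 0 ci iM ip iq)// => k.
  have /(congr1 (@complex.Im R)) /= := HGk k.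
  rewrite [LHS](_ : _ = Rn_int (fun x => im f x * w k x)).
    by move=> ->; apply: eq_Rn_int => x; rewrite /im Im_mulc /= (dotpC x y) /re; ring.
  by apply: eq_Rn_int => x; rewrite {1}/im Im_mulc fourier_wave_packet/= mulr0 add0r.
Qed.

(** psi is replaced by its Gaussian averages. By Fubini the integral of F against such an average is
    a superposition of integrals of F against Gaussians, all 0, and the averages tend to
    [gauss_mass] psi. *)
Lemma gauss_orthogonal_continuous F psi (M : R) : Rn_integrable F ->
  (forall a b, 0 < a -> Rn_int (fun x => F x * gauss a b x) = 0) ->
  continuous psi -> (forall x, `|psi x| <= M) -> Rn_int (fun x => F x * psi x) = 0.
Proof.
move=> iF F0 cpsi psiM; have mpsi := continuous_Rn_measurable cpsi.
have m0 : m_ != 0 by rewrite gt_eqF// gauss_mass_gt0.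
pose A k x := Rn_int (fun z => psi (eps k *: z + x) * gauss 1 0 z).
have gk k : 0 < eps k ^- 2 by rewrite invr_gt0 exprn_gt0// eps_gt0.
pose H k x y := (eps k ^+ n)^-1 * (F x * (psi y * gauss (eps k ^- 2) x y)).
have iH0 k x := Rn_integrable_gaussM x (gk k) mpsi psiM.
have iH k x : Rn_integrable (H k x) by do 2 apply: Rn_integrableZ.
have HA k x : Rn_int (H k x) = F x * A k x.
  rewrite /H Rn_intZ; last exact: Rn_integrableZ.
  by rewrite Rn_intZ// mulrCA (@gauss_average _ _ _ _ _ M) ?eps_gt0.
have mH k : Rn_measurable2 (H k).
  apply: Rn_measurable2M; first exact: measurable_cst.
  apply: Rn_measurable2M; first exact: (Rn_measurable2_fst (Rn_integrable_measurable iF)).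
  apply: Rn_measurable2M; first exact: (Rn_measurable2_snd mpsi).
  rewrite (_ : gauss (eps k ^- 2) =
      (fun x y : Rn => gauss (eps k ^- 2) 0 (x - y))).
    exact: Rn_measurable2_sub (gauss_measurable 0 (gk k)).
  by apply/funext => x; apply/funext => y; rewrite gauss_sym /gauss subr0.
have bH k x : Rn_int (fun y => `|H k x y|) <= M * m_ * `|F x|.
  have -> : (fun y => `|H k x y|) = (fun y => `|F x| *
      ((eps k ^+ n)^-1 * (`|psi y| * gauss (eps k ^- 2) x y))).
    apply/funext => y; rewrite /H !normrM (gtr0_norm (gauss_gt0 _ _ _)).
    by rewrite gtr0_norm ?invr_gt0 ?exprn_gt0 ?eps_gt0//; ring.
  have nM y : `| `|psi y| | <= M by rewrite normr_id.
  have mn := Rn_measurable_norm mpsi.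
  have in0 := Rn_integrable_gaussM x (gk k) mn nM.
  rewrite Rn_intZ; last exact: Rn_integrableZ.
  rewrite mulrC ler_wpM2r// Rn_intZ// (@gauss_average _ _ _ _ _ M) ?eps_gt0//.
  rewrite (le_trans (ler_norm _))//.
  by apply: (@gauss_average_bound _ _ _ (fun y => `|psi y|)); rewrite // gt_eqF// eps_gt0.
have Z k : Rn_int (fun x => F x * A k x) = 0.
  have [||_ _] := @Rn_fubini _ _ (H k) (fun x => M * m_ * `|F x|) (mH k) (iH k).
  - exact/Rn_integrableZ/Rn_integrable_norm.
  - exact: bH.
  move=> E; rewrite -(eq_Rn_int (HA k)) E {E}.
  rewrite -[RHS](@Rn_int0 R n); apply: eq_Rn_int => y.
  have iFg : Rn_integrable (fun x => F x * gauss (eps k ^- 2) y x).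
    by apply: Rn_integrable_schwartzM => //; exact: gauss_schwartz.
  rewrite (_ : (fun x => _) = (fun x => ((eps k ^+ n)^-1 * psi y) *
      (F x * gauss (eps k ^- 2) y x))); last first.
    by apply/funext => x; rewrite /H (gauss_sym _ y x); ring.
  by rewrite Rn_intZ// F0// mulr0.
have [||||_] := @Rn_dominated_convergence _ _ (fun k x => F x * A k x)
    (fun x => F x * (psi x * m_)) (fun x => M * m_ * `|F x|).
- move=> k; apply: Rn_integrable_measurable.
  have [||i1 _ _] := @Rn_fubini _ _ (H k) (fun x => M * m_ * `|F x|) (mH k) (iH k).
  + exact/Rn_integrableZ/Rn_integrable_norm.
  + exact: bH.
  suff <- : (fun x => Rn_int (H k x)) = (fun x => F x * A k x) by [].
  by apply/funext; exact: HA.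
- exact/Rn_integrableZ/Rn_integrable_norm.
- move=> k x; rewrite normrM mulrC ler_wpM2r//.
  by apply: gauss_average_bound => //; rewrite gt_eqF// eps_gt0.
- move=> x; apply: cvgM; first exact: cvg_cst.
  exact: (gauss_average_cvg cpsi psiM).
under eq_fun do rewrite Z.
move=> /(cvg_unique _)/(_ (cvg_cst _)) E.
have iFp : Rn_integrable (fun x => F x * psi x) by exact: (@Rn_integrableM_bounded _ _ M).
apply: (mulfI m0); rewrite mulr0 -E// -Rn_intZ//.
by apply: eq_Rn_int => x; ring.
Qed.

End Uniqueness.

(** * Almost everywhere uniqueness of the density *)

Section AlmostEverywhere.
Local Open Scope complex_scope.
Context {R : realType} {n : nat}.
Local Notation Rn := 'rV[R]_n.
Local Notation C := R[i].
Local Notation T := (n.-tuple (measurableTypeR R)).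
Local Notation mu := (lebesgue_Rn R n).
Implicit Types (F : Rn -> R) (x xi : Rn) (G f : Rn -> C).

Definition ramp (s : R) : R := Num.max 0 (Num.min 1 s).

Lemma ramp_ge0 s : 0 <= ramp s.
Proof. by rewrite le_max lexx. Qed.

Lemma ramp_le1 s : ramp s <= 1.
Proof. by rewrite ge_max ler01 ge_min lexx. Qed.

Lemma ramp_continuous : continuous ramp.
Proof.
move=> s; apply: continuous_max; first exact: cst_continuous.
by apply: continuous_min; [exact: cst_continuous|exact: cvg_id].
Qed.

(** Bounded continuous functions that tend to the indicator of the open orthant with corner [a];
    they carry orthogonality over from continuous functions to sets. *)
Definition ramp_box (a : 'I_n -> R) (k : nat) (x : Rn) : R :=
  \prod_(i < n) ramp (k%:R * (x ord0 i - a i)).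

Lemma continuous_big_prod (U : topologicalType) (I : Type) (s : seq I) (h : I -> U -> R) :
  (forall i, continuous (h i)) -> continuous (fun z => \prod_(i <- s) h i z).
Proof.
move=> ch; elim: s => [|i s IHs].
  rewrite (_ : (fun z => _) = cst 1); last by apply/funext => z; rewrite big_nil.
  by move=> z; exact: cvg_cst.
rewrite (_ : (fun z => _) = fun z => h i z * \prod_(j <- s) h j z); last first.
  by apply/funext => z; rewrite big_cons.
by move=> z; apply: cvgM; [exact: ch|exact: IHs].
Qed.

Lemma ramp_box_continuous a k : continuous (ramp_box a k).
Proof.
apply: continuous_big_prod => i x.
apply: (@continuous_comp _ _ _ (fun x : Rn => x ord0 i) (fun s => ramp (k%:R * (s - a i)))).
  exact: coord_continuous.
apply: (@continuous_comp _ _ _ (fun s : R => k%:R * (s - a i)) ramp); last exact: ramp_continuous.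
apply: cvgM; first exact: cvg_cst.
by apply: cvgB; [exact: cvg_id|exact: cvg_cst].
Qed.

Lemma ramp_box_norm a k x : `|ramp_box a k x| <= 1.
Proof.
rewrite ger0_norm; last by apply: prodr_ge0 => i _; exact: ramp_ge0.
by apply: prodr_ile1 => i _; rewrite ramp_ge0 ramp_le1.
Qed.

Definition orthant (a : 'I_n -> R) : set T := [set t | forall i, a i < tnth t i].

Lemma ramp_box_cvg a (t : T) :
  (fun k => ramp_box a k (row_of t)) @ \oo --> (\1_(orthant a) t : R).
Proof.
have [ta|ta] := pselect (orthant a t).
  rewrite indicE mem_set//=; apply: cvg_near_cst.
  (* Once k exceeds every 1 / (t_i - a_i), each ramp has reached its plateau 1. *)
  have [k0 Hk0] : exists k0 : nat, forall i, 1 <= k0%:R * (tnth t i - a i).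
    exists (\max_(i < n) Num.truncn (tnth t i - a i)^-1).+1 => i.
    have ti : 0 < tnth t i - a i by rewrite subr_gt0.
    rewrite -ler_pdivrMr// mul1r; apply: ltW.
    apply: (lt_le_trans (truncnS_gt _)); rewrite ler_nat ltnS.
    exact: (@leq_bigmax _ (fun i => Num.truncn (tnth t i - a i)^-1) i).
  exists k0 => // k /= k0k; apply: big1 => i _; rewrite mxE /ramp min_l; last first.
    rewrite (le_trans (Hk0 i))// ler_wpM2r ?ler_nat//.
    by rewrite subr_ge0 ltW.
  by rewrite max_r.
rewrite indicE memNset//=; apply: cvg_near_cst; apply: nearW => k.
have [i ti] : exists i, tnth t i <= a i.
  by apply: contrapT => H; apply: ta => i; rewrite ltNge; apply/negP => ?; apply: H; exists i.
rewrite /ramp_box (bigD1 i)//= mxE /ramp max_l ?mul0r// ge_min; apply/orP; right.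
by rewrite mulr_ge0_le0// subr_le0.
Qed.

Lemma orthant_measurable a : measurable (orthant a).
Proof.
rewrite (_ : orthant a = \big[setI/setT]_(i < n) [set t : T | a i < tnth t i]).
  apply: bigsetI_measurable => i _.
  have := @measurable_tnth _ (measurableTypeR R) n i measurableT _ (measurable_itv `]a i, +oo[).
  by rewrite setTI set_itvoy.
rewrite -bigcap_seq; apply/seteqP; split => t /= tP i.
  by move=> _; exact: tP.
by apply: tP; rewrite /= mem_index_enum.
Qed.

(** A half-space t_i > c is the union over m of the orthants with corner c in coordinate i and - m
    in the others, and half-spaces generate the product sigma-algebra. *)
Lemma orthants_generate (A : set T) : measurable A ->
  <<s [set orthant a | a in [set: 'I_n -> R]] >> A.
Proof.
pose T' := g_sigma_algebraType [set orthant a | a in [set: 'I_n -> R]].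
suff : measurable_fun [set: T'] (id : T' -> T).
  by move=> H mA; have := H measurableT A mA; rewrite setTI.
apply/measurable_fun_tnthP => i.
apply: (measurability _ (RGenOInfty.measurableE R)).
move=> _ [_ [c ->] <-]; rewrite setTI.
rewrite (_ : _ @^-1` _ = \bigcup_(m : nat)
    orthant (fun j => if j == i then c else - m%:R)).
  by apply: bigcupT_measurable => m; apply: sub_sigma_algebra; exists (fun j => if j == i then c else - m%:R).
apply/seteqP; split => t /=; last first.
  by move=> [m _ /(_ i)]; rewrite eqxx in_itv/= andbT.
rewrite in_itv/= andbT => ct.
exists (\max_(j < n) Num.truncn (- (tnth t j : R))).+1 => // j; case: eqVneq => [->//|_].
rewrite ltrNl; apply: (lt_le_trans (truncnS_gt _)); rewrite ler_nat ltnS.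
exact: (@leq_bigmax _ (fun i => Num.truncn (- (tnth t i : R))) j).
Qed.

(** The pi-lambda theorem: orthants are stable under intersection, and the sets over which F
    integrates to 0 form a Dynkin system, the total integral being 0. So F integrates to 0 over
    every measurable set. *)
Lemma orthant_orthogonal_ae F : Rn_integrable F ->
  \int[mu]_t F (row_of t) = 0 ->
  (forall a, \int[mu]_(t in orthant a) F (row_of t) = 0) ->
  {ae mu, forall t, F (row_of t) = 0}.
Proof.
move=> iF FT Fo; pose f t : \bar R := (F (@row_of R n t))%:E.
have if_ A : measurable A -> mu.-integrable A f.
  by move=> mA; apply: integrableS iF.
have E A : measurable A -> (\int[mu]_(t in A) F (row_of t))%:E = (\int[mu]_(t in A) f t)%E.
  by move=> mA; rewrite /Rintegral fineK//; apply: integrable_fin_num => //; exact: if_.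
pose D : set (set T) := [set A | measurable A /\ (\int[mu]_(t in A) f t = 0)%E].
pose S : set (set T) := [set orthant a | a in [set: 'I_n -> R]].
have SD : S `<=` D.
  by move=> _ [a _ <-]; split; [exact: orthant_measurable|rewrite -E ?Fo//; exact: orthant_measurable].
have dD : dynkin D.
  split.
  - by split => //; rewrite -E// FT.
  - move=> A [mA A0]; split; first exact: measurableC.
    have := @integral_setU _ _ _ mu A (~` A) f mA (measurableC mA).
    rewrite setUv A0 add0e -(E setT)// FT => <-//.
      by have /integrableP[] := if_ _ measurableT.
    by apply/disj_setPS; rewrite setICr.
  - move=> Fk tF DF; have mF k : measurable (Fk k) := (DF k).1.
    split; first exact: bigcupT_measurable.
    rewrite integral_bigcup//; last by apply: if_; exact: bigcupT_measurable.
    by apply: eseries0 => k _ _; exact: (DF k).2.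
have SI : setI_closed S.
  move=> _ _ [a _ <-] [b _ <-]; exists (fun i => Num.max (a i) (b i)) => //.
  apply/seteqP; split => t /=.
    by move=> H; split => i; have := H i; rewrite gt_max => /andP[].
  by move=> [ta tb] i; rewrite gt_max ta tb.
have all0 A : measurable A -> (\int[mu]_(t in A) f t = 0)%E.
  move=> /orthants_generate; rewrite -/S -(setI_closed_g_dynkin_g_sigma_algebra SI).
  by move=> /(_ D) [].
have [N [mN N0 HN]] := @integral_ae_eq _ _ _ mu setT measurableT (cst 0%E) f (if_ _ measurableT)
  (measurable_cst _) (fun A _ mA => etrans (all0 A mA) (esym (integral0 _ _))).
exists N; split => // t /= Ft; apply: HN => /= /(_ I) [Ft0]; exact: Ft.
Qed.

Lemma gauss_orthogonal_ae F : Rn_integrable F ->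
  (forall a b, 0 < a -> Rn_int (fun x => F x * gauss a b x) = 0) ->
  {ae mu, forall t, F (row_of t) = 0}.
Proof.
move=> iF F0; have H psi M := @gauss_orthogonal_continuous _ _ F psi M iF F0.
apply: orthant_orthogonal_ae => // [|a].
  have := H (fun=> 1) 1 (fun x => cvg_cst _).
  under eq_Rn_int do rewrite mulr1.
  by apply => x; rewrite normr1.
rewrite Rintegral_mkcond.
have := @dominated_convergence _ _ _ mu setT measurableT
  (fun k t => (F (row_of t) * ramp_box a k (row_of t))%:E)
  (fun t => (F (row_of t) * \1_(orthant a) t)%:E)
  (fun t => `|F (row_of t)|%:E).
have mF := Rn_integrable_measurable iF.
case.
- move=> k; apply/measurable_EFinP; apply: measurable_funM => //.
  exact: (continuous_Rn_measurable (@ramp_box_continuous a k)).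
- apply/measurable_EFinP; apply: measurable_funM => //.
  by apply: measurable_indic; exact: orthant_measurable.
- apply: aeW => t _; apply: cvg_EFin; first exact: nearW.
  by apply: cvgM; [exact: cvg_cst|exact: ramp_box_cvg].
- exact: (Rn_integrable_norm iF).
- by apply: aeW => t k _; rewrite lee_fin normrM ler_piMr// ramp_box_norm.
move=> _ _.
have E0 k : (\int[mu]_t (F (row_of t) * ramp_box a k (row_of t))%:E = 0)%E.
  have iFr : Rn_integrable (fun x => F x * ramp_box a k x).
    apply: (@Rn_integrableM_bounded _ _ 1) => //; last exact: ramp_box_norm.
    exact: (continuous_Rn_measurable (@ramp_box_continuous a k)).
  rewrite -(EFin_Rn_int iFr) (H _ 1)//; first exact: ramp_box_continuous.
  exact: ramp_box_norm.
under eq_fun do rewrite E0.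
move=> /(cvg_unique _)/(_ (cvg_cst _)) E.
rewrite /Rintegral (_ : (\int[mu]_x _)%E = 0%E)// -E//.
apply: eq_integral => t _; congr EFin; rewrite patchE indicE.
by case: ifPn => ta; rewrite ?mulr1 ?mulr0.
Qed.

(** Real Gaussians as test functions decouple the real and imaginary parts; each part of G - G' is
    then orthogonal to all Gaussians. *)
Lemma fourier_unique f G G' : is_fourier f G -> is_fourier f G' ->
  {ae mu, forall t, G (row_of t) = G' (row_of t)}.
Proof.
move=> [[ip iq] HG] [[ip' iq'] HG'].
have E a b : 0 < a -> C_int (fun xi => G xi * (gauss a b xi +i* 0)) =
    C_int (fun xi => G' xi * (gauss a b xi +i* 0)).
  move=> a0; rewrite -HG ?HG'//; split; try exact: schwartz_real0; exact: gauss_schwartz.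
have ae p q : Rn_integrable p -> Rn_integrable q ->
    (forall a b, 0 < a -> Rn_int (fun x => p x * gauss a b x) = Rn_int (fun x => q x * gauss a b x)) ->
    {ae mu, forall t, p (row_of t) = q (row_of t)}.
  move=> hp hq pq; apply: filterS (gauss_orthogonal_ae (Rn_integrableB hp hq) _) => [t|a b a0].
    by move=> /eqP; rewrite subr_eq0 => /eqP.
  have Sg := gauss_schwartz b a0; under eq_Rn_int do rewrite mulrBl.
  by rewrite Rn_intB ?pq ?subrr//; exact: Rn_integrable_schwartzM.
have reE H a b : re (fun xi => H xi * (gauss a b xi +i* 0)) = fun xi => re H xi * gauss a b xi.
  by apply/funext => x; rewrite /re Re_mulc/= mulr0 subr0.
have imE H a b : im (fun xi => H xi * (gauss a b xi +i* 0)) = fun xi => im H xi * gauss a b xi.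
  by apply/funext => x; rewrite /im Im_mulc/= mulr0 add0r.
have rE a b : 0 < a ->
    Rn_int (fun x => re G x * gauss a b x) = Rn_int (fun x => re G' x * gauss a b x).
  by move=> /(E a b)/(congr1 (@complex.Re R)); rewrite /= !reE.
have iE a b : 0 < a ->
    Rn_int (fun x => im G x * gauss a b x) = Rn_int (fun x => im G' x * gauss a b x).
  by move=> /(E a b)/(congr1 (@complex.Im R)); rewrite /= !imE.
by apply: filterS2 (ae _ _ ip ip' rE) (ae _ _ iq iq' iE) => t; exact: complex_eq.
Qed.

End AlmostEverywhere.

(** * Barron spaces *)

Section BarronSpace.
Local Open Scope complex_scope.
Context {R : realType} {n : nat}.
Local Notation Rn := 'rV[R]_n.
Local Notation C := R[i].
Local Notation normc := ComplexField.Normc.normc.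
Local Notation Ct := (ctr (0 : R)).
Local Notation St := (ctr (- (pi / 2) : R)).
Local Notation m_ := (@gauss_mass R n).
Local Notation T := (n.-tuple (measurableTypeR R)).
Local Notation mu := (lebesgue_Rn R n).
Local Notation e_ i := (delta_mx ord0 i : Rn).
Implicit Types (p q u F : Rn -> R) (x xi : Rn) (G H f : Rn -> C) (s t : R).

Definition weight s x : R := japanese x `^ s.

Lemma weight_gt0 s x : 0 < weight s x.
Proof. by apply: powR_gt0; exact: lt_le_trans (japanese_ge1 x). Qed.

Lemma weight_le s t x : s <= t -> weight s x <= weight t x.
Proof. by move=> st; apply: ler_powR => //; exact: japanese_ge1. Qed.

Lemma weight0 x : weight 0 x = 1.
Proof. exact: powRr0. Qed.

Lemma weight_ge1 s x : 0 <= s -> 1 <= weight s x.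
Proof. by move=> s0; rewrite -(weight0 x) weight_le. Qed.

Lemma weightD s t x : weight (s + t) x = weight s x * weight t x.
Proof.
rewrite /weight powRD// implybE; apply/orP; right.
by rewrite gt_eqF// (lt_le_trans ltr01 (japanese_ge1 x)).
Qed.

Lemma weight_nat (k : nat) x : weight (2 * k)%:R x = jap2 x ^+ k.
Proof.
rewrite /weight powR_mulrn ?exprM ?japanese_sqr//.
exact: le_trans ler01 (japanese_ge1 x).
Qed.

Lemma Rn_measurable_weight s : Rn_measurable (weight s).
Proof.
apply: (Rn_measurable_comp (measurable_powR s)).
apply: (Rn_measurable_comp (continuous_measurable_fun (@sqrt_continuous R))).
exact: Rn_measurable_jap2.
Qed.

Lemma Rn_measurable_normc G : Rn_measurable (re G) -> Rn_measurable (im G) ->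
  Rn_measurable (fun x => normc (G x)).
Proof.
move=> mr mi; under [X in Rn_measurable X]eq_fun do rewrite normc_sqrt.
apply: (Rn_measurable_comp (continuous_measurable_fun (@sqrt_continuous R))).
by apply: Rn_measurableD; apply: (Rn_measurable_comp (exprn_measurable 2)).
Qed.

Lemma normc_mul (z w : C) : normc (z * w) = normc z * normc w.
Proof. exact: ComplexField.Normc.normcM. Qed.

Lemma normc_triangle (z w : C) : normc (z + w) <= normc z + normc w.
Proof.
by have := ler_normD z w; rewrite !normc_def -!normc_sqrt -raddfD/= lecR.
Qed.

Lemma normc_opp (z : C) : normc (- z) = normc z.
Proof. by case: z => a b /=; rewrite !sqrrN. Qed.

Definition weighted_L1 s G : Prop :=
  [/\ Rn_measurable (re G), Rn_measurable (im G) &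
      Rn_integrable (fun xi => weight s xi * normc (G xi))].

Definition wnorm s G : R := Rn_int (fun xi => weight s xi * normc (G xi)).

Lemma re_weighted s G : re (weighted s G) = (fun x => weight s x * re G x).
Proof. by apply/funext => x; rewrite /re /weighted Re_mulc/= mul0r subr0. Qed.

Lemma im_weighted s G : im (weighted s G) = (fun x => weight s x * im G x).
Proof. by apply/funext => x; rewrite /im /weighted Im_mulc/= mul0r addr0. Qed.

Lemma normc_weighted s G x : normc (weighted s G x) = weight s x * normc (G x).
Proof.
by rewrite /weighted normc_mul /= expr0n/= addr0 sqrtr_sqr ger0_norm// ltW// weight_gt0.
Qed.

Lemma weighted_L1_dominated s G p : weighted_L1 s G -> Rn_measurable p ->
  (forall x, `|p x| <= normc (G x)) ->
  Rn_integrable (fun x => weight s x * p x) /\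
  Rn_int (fun x => `|weight s x * p x|) <= wnorm s G.
Proof.
move=> [mr mi iG] mp pG.
have le x : `|weight s x * p x| <= weight s x * normc (G x).
  by rewrite normrM gtr0_norm ?weight_gt0// ler_wpM2l ?(ltW (weight_gt0 _ _)).
have ip : Rn_integrable (fun x => weight s x * p x).
  by apply: (Rn_integrable_le _ le iG); apply: Rn_measurableM => //; exact: Rn_measurable_weight.
by split=> //; apply: Rn_int_le => //; exact: Rn_integrable_norm.
Qed.

Lemma weighted_L1_Re s G : weighted_L1 s G ->
  Rn_integrable (fun xi => weight s xi * re G xi) /\
  Rn_int (fun xi => `|weight s xi * re G xi|) <= wnorm s G.
Proof. by move=> wG; have [mr _ _] := wG; apply: weighted_L1_dominated => // x; exact: Re_le_normc. Qed.

Lemma weighted_L1_Im s G : weighted_L1 s G ->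
  Rn_integrable (fun xi => weight s xi * im G xi) /\
  Rn_int (fun xi => `|weight s xi * im G xi|) <= wnorm s G.
Proof. by move=> wG; have [_ mi _] := wG; apply: weighted_L1_dominated => // x; exact: Im_le_normc. Qed.

Lemma weighted_measurable s p : Rn_integrable (fun x => weight s x * p x) -> Rn_measurable p.
Proof.
move=> ip; rewrite (_ : p = fun x => (weight s x)^-1 * (weight s x * p x)); last first.
  by apply/funext => x; rewrite mulKf// gt_eqF// weight_gt0.
apply: Rn_measurableM; last exact: Rn_integrable_measurable.
by apply: (Rn_measurable_comp measurable_inv); exact: Rn_measurable_weight.
Qed.

Lemma Rn_measurable_weight_normc s G : Rn_measurable (re G) -> Rn_measurable (im G) ->
  Rn_measurable (fun x => weight s x * normc (G x)).
Proof.
by move=> mr mi; apply: Rn_measurableM; [exact: Rn_measurable_weight|exact: Rn_measurable_normc].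
Qed.

Lemma C_integrable_weightedP s G : C_integrable (weighted s G) <-> weighted_L1 s G.
Proof.
split=> [[ir ii]|wG]; last first.
  split.
    by rewrite re_weighted; have [] := weighted_L1_Re wG.
  by rewrite im_weighted; have [] := weighted_L1_Im wG.
have mr : Rn_measurable (re G) by apply: (@weighted_measurable s); rewrite -re_weighted.
have mi : Rn_measurable (im G) by apply: (@weighted_measurable s); rewrite -im_weighted.
split => //.
apply: (Rn_integrable_le _ _ (Rn_integrableD (Rn_integrable_norm ir) (Rn_integrable_norm ii))).
  exact: Rn_measurable_weight_normc.
move=> x; rewrite -normc_weighted ger0_norm ?normc_ge0//.
exact: normc_le_ReDIm.
Qed.

Lemma weighted_L1_le s t G : s <= t -> weighted_L1 t G ->
  weighted_L1 s G /\ wnorm s G <= wnorm t G.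
Proof.
move=> st [mr mi iG].
have H x : weight s x * normc (G x) <= weight t x * normc (G x).
  by rewrite ler_wpM2r ?normc_ge0// weight_le.
have iG' : Rn_integrable (fun xi => weight s xi * normc (G xi)).
  apply: Rn_integrable_le iG.
    exact: Rn_measurable_weight_normc.
  by move=> x; rewrite ger0_norm// mulr_ge0 ?normc_ge0// ltW// weight_gt0.
by split => //; exact: Rn_int_le.
Qed.

Lemma weighted_L1_parts s G : 0 <= s -> weighted_L1 s G ->
  [/\ Rn_integrable (re G), Rn_integrable (im G),
    Rn_int (fun x => `|re G x|) <= wnorm s G & Rn_int (fun x => `|im G x|) <= wnorm s G].
Proof.
move=> s0 /(weighted_L1_le s0)[wG le].
have w p : (fun x => weight 0 x * p x) = p by apply/funext => x; rewrite weight0 mul1r.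
have wN p : (fun x => `|weight 0 x * p x|) = fun x => `|p x|.
  by apply/funext => x; rewrite weight0 mul1r.
have := weighted_L1_Re wG; have := weighted_L1_Im wG; rewrite !w !wN => -[ii li] [ir lr].
by split=> //; exact: le_trans le.
Qed.

Lemma weighted_L1_integrable s G : 0 <= s -> weighted_L1 s G -> C_integrable G.
Proof. by move=> s0 wG; have [ir ii _ _] := weighted_L1_parts s0 wG. Qed.

Lemma wnorm_ge0 s G : 0 <= wnorm s G.
Proof. by apply: Rn_int_ge0 => x; rewrite mulr_ge0 ?normc_ge0// ltW// weight_gt0. Qed.

Lemma weighted_L1D s G H : weighted_L1 s G -> weighted_L1 s H ->
  weighted_L1 s (fun xi => G xi + H xi) /\
  wnorm s (fun xi => G xi + H xi) <= wnorm s G + wnorm s H.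
Proof.
move=> [mr mi iG] [mr' mi' iH].
have mrD : Rn_measurable (re (fun xi => G xi + H xi)) by rewrite re_add; exact: Rn_measurableD.
have miD : Rn_measurable (im (fun xi => G xi + H xi)) by rewrite im_add; exact: Rn_measurableD.
have iS := Rn_integrableD iG iH.
have le x : weight s x * normc (G x + H x) <= weight s x * normc (G x) + weight s x * normc (H x).
  by rewrite -mulrDr ler_wpM2l ?(ltW (weight_gt0 _ _))// normc_triangle.
have iD : Rn_integrable (fun xi => weight s xi * normc (G xi + H xi)).
  apply: Rn_integrable_le iS.
    exact: Rn_measurable_weight_normc.
  by move=> x; rewrite ger0_norm// mulr_ge0 ?normc_ge0// ltW// weight_gt0.
by split => //; rewrite /wnorm -Rn_intD//; exact: Rn_int_le.
Qed.

Lemma weighted_L1N s G : weighted_L1 s G ->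
  weighted_L1 s (fun xi => - G xi) /\ wnorm s (fun xi => - G xi) = wnorm s G.
Proof.
move=> [mr mi iG].
have E : (fun xi => weight s xi * normc (- G xi)) = (fun xi => weight s xi * normc (G xi)).
  by apply/funext => x; rewrite normc_opp.
split; last by rewrite /wnorm E.
split; last by rewrite E.
  by rewrite re_opp; exact: (Rn_measurable_comp (@oppr_measurable R setT)).
by rewrite im_opp; exact: (Rn_measurable_comp (@oppr_measurable R setT)).
Qed.

Lemma weighted_L1B s G H : weighted_L1 s G -> weighted_L1 s H ->
  weighted_L1 s (fun xi => G xi - H xi) /\
  wnorm s (fun xi => G xi - H xi) <= wnorm s G + wnorm s H.
Proof.
move=> wG /weighted_L1N[wH <-]; exact: weighted_L1D.
Qed.

Lemma inv_fourierD G H x : C_integrable G -> C_integrable H ->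
  inv_fourier (fun xi => G xi + H xi) x = inv_fourier G x + inv_fourier H x.
Proof.
move=> [iG jG] [iH jH].
by apply: complex_eq; rewrite /inv_fourier /= re_add im_add !ctrD//; ring.
Qed.

Lemma inv_fourierN G x : C_integrable G ->
  inv_fourier (fun xi => - G xi) x = - inv_fourier G x.
Proof.
move=> [iG jG].
by apply: complex_eq; rewrite /inv_fourier /= re_opp im_opp !ctrN//; ring.
Qed.

Lemma C_integrableN G : C_integrable G -> C_integrable (fun xi => - G xi).
Proof.
move=> [iG jG]; split.
  by rewrite re_opp; exact: Rn_integrableN.
by rewrite im_opp; exact: Rn_integrableN.
Qed.

Lemma inv_fourierB G H x : C_integrable G -> C_integrable H ->
  inv_fourier (fun xi => G xi - H xi) x = inv_fourier G x - inv_fourier H x.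
Proof. by move=> iG iH; rewrite inv_fourierD ?inv_fourierN//; exact: C_integrableN. Qed.

Lemma continuous_lincomb (U : topologicalType) (k l : R) (f g : U -> R) :
  continuous f -> continuous g -> continuous (fun z => k * (f z + l * g z)).
Proof.
move=> cf cg z; apply: cvgM; first exact: cvg_cst.
by apply: cvgD; [exact: cf|apply: cvgM; [exact: cvg_cst|exact: cg]].
Qed.

Lemma re_inv_fourier_continuous G : C_integrable G -> continuous (re (inv_fourier G)).
Proof.
move=> [iG jG]; rewrite (_ : re _ = fun x => m_ ^- 2 * (Ct (re G) x + -1 * St (im G) x)).
  exact: (continuous_lincomb (ctr_continuous iG) (ctr_continuous jG)).
by apply/funext => x; rewrite mulN1r.
Qed.

Lemma im_inv_fourier_continuous G : C_integrable G -> continuous (im (inv_fourier G)).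
Proof.
move=> [iG jG]; rewrite (_ : im _ = fun x => m_ ^- 2 * (St (re G) x + 1 * Ct (im G) x)).
  exact: (continuous_lincomb (ctr_continuous iG) (ctr_continuous jG)).
by apply/funext => x; rewrite mul1r.
Qed.

Lemma inv_fourier_bound s G x : 0 <= s -> weighted_L1 s G ->
  `|re (inv_fourier G) x| <= 2 * m_ ^- 2 * wnorm s G /\
  `|im (inv_fourier G) x| <= 2 * m_ ^- 2 * wnorm s G.
Proof.
move=> s0 wG; have [iG jG] := weighted_L1_integrable s0 wG.
have [_ _ ler lei] := weighted_L1_parts s0 wG.
have m0 : 0 <= m_ ^- 2 by rewrite invr_ge0 exprn_ge0// ltW// gauss_mass_gt0.
have b1 a : `|ctr a (re G) x| <= wnorm s G.
  exact: le_trans (ctr_bound a x iG) ler.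
have b2 a : `|ctr a (im G) x| <= wnorm s G.
  exact: le_trans (ctr_bound a x jG) lei.
rewrite /re /im /inv_fourier /= !normrM !(ger0_norm m0) (mulrC 2) -!mulrA !ler_wpM2l//.
  by rewrite (le_trans (ler_normD _ _))// mulr_natl mulr2n lerD.
by rewrite (le_trans (ler_normB _ _))// mulr_natl mulr2n lerD.
Qed.

Lemma Cb0_inv_fourier G : C_integrable G -> Cb0 (inv_fourier G).
Proof.
move=> iG; split; [exact: re_inv_fourier_continuous|exact: im_inv_fourier_continuous|].
have wG : weighted_L1 0 G.
  apply/C_integrable_weightedP; have [ir ii] := iG; split.
    by rewrite re_weighted; under [X in Rn_integrable X]eq_fun do rewrite weight0 mul1r.
  by rewrite im_weighted; under [X in Rn_integrable X]eq_fun do rewrite weight0 mul1r.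
exists (2 * m_ ^- 2 * wnorm 0 G + 2 * m_ ^- 2 * wnorm 0 G) => x.
have [b1 b2] := inv_fourier_bound x (lexx 0) wG.
by rewrite (le_trans (normc_le_ReDIm _))// lerD.
Qed.

Lemma Rn_integrable_ae F u : Rn_measurable F -> {ae mu, forall t : T, F (row_of t) = u (row_of t)} ->
  Rn_integrable u -> Rn_integrable F /\ Rn_int F = Rn_int u.
Proof.
move=> mF Fu iu; have mu_ := Rn_integrable_measurable iu.
have aeE : ae_eq mu setT (EFin \o (F \o row_of)) (EFin \o (u \o row_of)).
  by apply: filterS Fu => t ft _; rewrite /= ft.
split.
  apply/integrableP; split; first exact/measurable_EFinP.
  have /integrableP[_] := iu; apply: le_lt_trans.
  rewrite (ae_eq_integral (fun t : T => `|(EFin \o (u \o row_of)) t|%E))//.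
  - by apply: measurableT_comp => //; exact/measurable_EFinP.
  - by apply: measurableT_comp => //; exact/measurable_EFinP.
  - by apply: filterS Fu => t ft _; rewrite /= ft.
congr fine; apply: ae_eq_integral => //; exact/measurable_EFinP.
Qed.

(** [fourier f] is a chosen representative, equal to a given density only almost everywhere;
    weighted norms have to be carried across that equality. *)
Lemma weighted_L1_ae s G H : C_integrable H ->
  {ae mu, forall t : T, G (row_of t) = H (row_of t)} -> weighted_L1 s G ->
  weighted_L1 s H /\ wnorm s H = wnorm s G.
Proof.
move=> [ir ii] GH [mr mi iG].
have mr' := Rn_integrable_measurable ir; have mi' := Rn_integrable_measurable ii.
have mw : Rn_measurable (fun xi => weight s xi * normc (H xi)).
  exact: Rn_measurable_weight_normc.
have [|iH E] := Rn_integrable_ae mw _ iG; last by split.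
by apply: filterS GH => z ->.
Qed.

Lemma is_fourier_fourier f : (exists g, is_fourier f g) -> is_fourier f (fourier f).
Proof. exact: xgetPex. Qed.

(** With [in_B_repr] this identifies B^s, norm included, with the inverse transforms of weighted
    densities. *)
Lemma in_B_inv_fourier s G : 0 <= s -> weighted_L1 s G ->
  in_B s (inv_fourier G) /\ norm_B s (inv_fourier G) = wnorm s G.
Proof.
move=> s0 wG; have iG := weighted_L1_integrable s0 wG.
have fG := inv_fourier_is_fourier iG.
have ex : exists g, is_fourier (inv_fourier G) g by exists G.
have f' := is_fourier_fourier ex.
have [wG' E] := weighted_L1_ae f'.1 (fourier_unique fG f') wG.
split; last by rewrite -E; apply: eq_Rn_int => x; rewrite normc_weighted.
split => //; first exact: Cb0_inv_fourier.
exact/C_integrable_weightedP.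
Qed.

Lemma in_B_repr s f : in_B s f -> [/\ weighted_L1 s (fourier f),
  f = inv_fourier (fourier f) & norm_B s f = wnorm s (fourier f)].
Proof.
move=> [cf /is_fourier_fourier ff /C_integrable_weightedP wf]; split => //.
  exact: fourier_inversion.
by apply: eq_Rn_int => x; rewrite normc_weighted.
Qed.

(** The infimum may not be attained, hence the strict bound. Membership makes the infimum range over
    a nonempty set. *)
Lemma norm_B_dom_lt (Omega : set Rn) s f (r : R) : in_B_dom Omega s f ->
  norm_B_dom Omega s f < r ->
  exists G, [/\ weighted_L1 s G, eq_on (closure Omega) (inv_fourier G) f & wnorm s G < r].
Proof.
move=> [g Bg gf] /inf_lt[]; first by exists (norm_B s g), g.
move=> _ [g' [Bg' g'f] <-]; have [wG gE ->] := in_B_repr Bg' => lr.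
by exists (fourier g'); split => //; rewrite -gE.
Qed.

Lemma norm_B_dom_has_lbound (Omega : set Rn) s f :
  has_lbound [set norm_B s g | g in [set g | in_B s g /\ eq_on (closure Omega) g f]].
Proof. by exists 0 => _ [g _ <-]; apply: Rn_int_ge0 => x; exact: normc_ge0. Qed.

Lemma norm_B_dom_le (Omega : set Rn) s f G : 0 <= s -> weighted_L1 s G ->
  eq_on (closure Omega) (inv_fourier G) f ->
  in_B_dom Omega s f /\ norm_B_dom Omega s f <= wnorm s G.
Proof.
move=> s0 /(in_B_inv_fourier s0)[BG <-] Gf; split; first by exists (inv_fourier G).
by apply: ge_inf; [exact: norm_B_dom_has_lbound|exists (inv_fourier G)].
Qed.

Lemma in_B_dom_repr (Omega : set Rn) s f : in_B_dom Omega s f ->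
  exists2 G, weighted_L1 s G & eq_on (closure Omega) (inv_fourier G) f.
Proof.
move=> [g Bg gf]; have [wG gE _] := in_B_repr Bg.
by exists (fourier g) => //; rewrite -gE.
Qed.

(** The two nested infima collapse: an almost optimal extension to closure Omega, followed by one to
    R^n, gives a single density. *)
Lemma norm_B_bnd_lt (Omega : set Rn) s f (r : R) : in_B_bnd Omega s f ->
  norm_B_bnd Omega s f < r ->
  exists G, [/\ weighted_L1 s G, eq_on (boundary Omega) (inv_fourier G) f & wnorm s G < r].
Proof.
move=> [u Bu uf] /inf_lt[]; first by exists (norm_B_dom Omega s u), u.
move=> _ [u' [Bu' u'f] <-] /(norm_B_dom_lt Bu')[G [wG Gu' Gr]].
exists G; split => // x [cx ix]; rewrite Gu'//; exact: u'f.
Qed.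

Lemma jap2_weight x : jap2 x = weight 2 x.
Proof. exact: esym (weight_nat 1 x). Qed.

Lemma Rn_integrable_jap2M p : Rn_measurable p ->
  Rn_integrable (fun xi => weight 2 xi * p xi) ->
  [/\ Rn_integrable p, forall i, Rn_integrable (fun xi => xi ord0 i * p xi),
   forall i, Rn_integrable (fun xi => xi ord0 i * (xi ord0 i * p xi)) &
   Rn_integrable (fun xi => jap2 xi * p xi)].
Proof.
move=> mp ip; have ij := Rn_integrable_norm ip.
have mx i := @Rn_measurable_coord R n i.
have P xi : weight 2 xi = 1 + dotp xi xi by rewrite -jap2_weight.
have D0 (xi : Rn) : 0 <= dotp xi xi := dotp_ge0 xi.
have W xi : `|weight 2 xi * p xi| = (1 + dotp xi xi) * `|p xi|.
  by rewrite normrM P ger0_norm// addr_ge0.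
split.
- apply: Rn_integrable_le ij => // x; rewrite W.
  by have := D0 x; have := normr_ge0 (p x); nra.
- move=> i; apply: Rn_integrable_le ij => [|x]; first exact: Rn_measurableM.
  rewrite W normrM ler_wpM2r//.
  have := coord_sqr_le x i; rewrite -real_normK ?num_real//.
  by have := normr_ge0 (x ord0 i); nra.
- move=> i; apply: Rn_integrable_le ij => [|x]; first by do !apply: Rn_measurableM.
  rewrite W mulrA normrM ler_wpM2r// -expr2 ger0_norm ?sqr_ge0//.
  by have := coord_sqr_le x i; lra.
- by under [X in Rn_integrable X]eq_fun do rewrite jap2_weight.
Qed.

Local Notation X_ i p := (fun xi : Rn => xi ord0 i * p xi).

Lemma ctr_pderiv a p x i : Rn_integrable p ->
  Rn_integrable (X_ i p) ->
  Rn_integrable (X_ i (X_ i p)) ->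
  [/\ is_derive x (e_ i) (ctr a p) (ctr (a + pi / 2) (X_ i p) x) &
   is_derive x (e_ i) (ctr (a + pi / 2) (X_ i p))
     (- ctr a (X_ i (X_ i p)) x)].
Proof.
move=> h0 h1 h2; split; first exact: is_derive_ctr_coord.
have := is_derive_ctr_coord (a + pi / 2) x h1 h2.
rewrite -addrA -splitr.
by rewrite ctrDpi.
Qed.

Definition coord_C2 (f : Rn -> R) : Prop := forall i x,
  derivable f x (e_ i) /\ derivable (pderiv i f) x (e_ i).

(** The real and imaginary parts of [inv_fourier G] both have this shape. Each derivative shifts the
    phase by pi / 2; two shifts change the sign, so that 1 - Delta multiplies the densities by 1 +
    |xi|^2. *)
Lemma ctr2_pderiv (k a b : R) p q (f : Rn -> R) :
  f = (fun x => k * (ctr a p x + ctr b q x)) ->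
  Rn_measurable p -> Rn_measurable q ->
  Rn_integrable (fun xi => weight 2 xi * p xi) ->
  Rn_integrable (fun xi => weight 2 xi * q xi) ->
  [/\ coord_C2 f &
   forall x, f x - \sum_(i < n) iter_partial [:: i; i] f x =
    k * (ctr a (fun xi => jap2 xi * p xi) x + ctr b (fun xi => jap2 xi * q xi) x)].
Proof.
move=> fE mp mq ip iq.
have [p0 p1 p2 p3] := Rn_integrable_jap2M mp ip.
have [q0 q1 q2 q3] := Rn_integrable_jap2M mq iq.
pose d i x := k * (ctr (a + pi / 2) (X_ i p) x +
                 ctr (b + pi / 2) (X_ i q) x).
have fd i x : is_derive x (e_ i) f (d i x).
  have [h1 _] := ctr_pderiv a x p0 (p1 i) (p2 i).
  have [h2 _] := ctr_pderiv b x q0 (q1 i) (q2 i).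
  by rewrite fE; exact: (is_deriveZ k (is_deriveD h1 h2)).
have pdE i : pderiv i f = d i by apply/funext => x; exact: pderivE.
have dd i x : is_derive x (e_ i) (d i)
   (- (k * (ctr a (X_ i (X_ i p)) x +
         ctr b (X_ i (X_ i q)) x))).
  have [_ h1] := ctr_pderiv a x p0 (p1 i) (p2 i).
  have [_ h2] := ctr_pderiv b x q0 (q1 i) (q2 i).
  apply: (is_derive_eq (is_deriveZ k (is_deriveD h1 h2))).
  by rewrite /GRing.scale/=; ring.
split=> [i x|x].
  split; first by apply: ex_derive; exact: fd.
  by rewrite pdE; apply: ex_derive; exact: dd.
have -> : \sum_(i < n) iter_partial [:: i; i] f x =
   \sum_(i < n) - (k * (ctr a (X_ i (X_ i p)) x +
         ctr b (X_ i (X_ i q)) x)).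
  by apply: eq_bigr => i _ /=; rewrite pdE; exact: pderivE.
have sumE c r : Rn_integrable r ->
    (forall i, Rn_integrable (X_ i (X_ i r))) ->
    ctr c (fun xi => jap2 xi * r xi) x = ctr c r x +
      \sum_(i < n) ctr c (X_ i (X_ i r)) x.
  move=> r0 r2; have [<- isum] := ctr_sum (index_enum 'I_n) c x r2.
  rewrite -ctrD//; congr (ctr c _ x); apply/funext => xi.
  rewrite /jap2 mulrDl mul1r /dotp mulr_suml; congr (_ + _).
  by apply: eq_bigr => i _; rewrite mulrA.
rewrite (sumE a p)// (sumE b q)// {1}fE sumrN opprK -mulr_sumr big_split/=; ring.
Qed.

Definition jap2_mul G xi : C := (jap2 xi)%:C * G xi.

(** 1 - Delta has symbol [jap2], which is exactly the weight of order 2; hence it acts isometrically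
    on densities and the equation becomes algebraic. *)
Lemma helmholtz_inv_fourier s G : 0 <= s -> weighted_L1 (2 + s) G ->
  [/\ weighted_L1 s (jap2_mul G), wnorm s (jap2_mul G) = wnorm (2 + s) G,
   coord_C2 (re (inv_fourier G)), coord_C2 (im (inv_fourier G)) &
   forall x, inv_fourier G x - laplacian (inv_fourier G) x = inv_fourier (jap2_mul G) x].
Proof.
move=> s0 wG; have [mr mi iG] := wG.
have [|w2 _] := @weighted_L1_le 2 (2 + s) G _ wG; first by rewrite lerDl.
have [ir _] := weighted_L1_Re w2; have [ii _] := weighted_L1_Im w2.
have reJ : re (jap2_mul G) = (fun xi => jap2 xi * re G xi).
  by apply/funext => xi; rewrite /re Re_mulc/= mul0r subr0.
have imJ : im (jap2_mul G) = (fun xi => jap2 xi * im G xi).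
  by apply/funext => xi; rewrite /im Im_mulc/= mul0r addr0.
have nJ xi : weight s xi * normc (jap2_mul G xi) = weight (2 + s) xi * normc (G xi).
  rewrite /jap2_mul normc_mul /= expr0n/= addr0 sqrtr_sqr ger0_norm ?(ltW (jap2_gt0 _))//.
  by rewrite weightD -jap2_weight; ring.
have mj := @Rn_measurable_jap2 R n.
have [r0 _ _ rj] := Rn_integrable_jap2M mr ir.
have [i0 _ _ ij] := Rn_integrable_jap2M mi ii.
have mN : Rn_measurable (fun xi => - im G xi).
  exact: (Rn_measurable_comp (@oppr_measurable R setT)).
have iN : Rn_integrable (fun xi => weight 2 xi * - im G xi).
  by under [X in Rn_integrable X]eq_fun do rewrite mulrN; exact: Rn_integrableN.
have reE : re (inv_fourier G) = fun x => m_ ^- 2 * (Ct (re G) x + St (fun xi => - im G xi) x).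
  by apply/funext => x; rewrite ctrN.
have imE : im (inv_fourier G) = fun x => m_ ^- 2 * (St (re G) x + Ct (im G) x) by [].
have [c1 e1] := ctr2_pderiv reE mr mN ir iN.
have [c2 e2] := ctr2_pderiv imE mr mi ir ii.
split.
- split; [by rewrite reJ; exact: Rn_measurableM|by rewrite imJ; exact: Rn_measurableM|].
  by under [X in Rn_integrable X]eq_fun do rewrite nJ.
- by apply: eq_Rn_int => xi; exact: nJ.
- exact: c1.
- exact: c2.
- move=> x; apply: complex_eq.
    rewrite raddfB e1 /inv_fourier/= reJ imJ; congr (_ * (_ + _)).
    by rewrite -ctrN//; congr (ctr _ _ x); apply/funext => xi; rewrite mulrN.
  by rewrite raddfB e2 /inv_fourier/= reJ imJ.
Qed.

End BarronSpace.

(** * Smooth cutoffs *)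

Section BumpOneDim.
Context {R : realType}.

(** s^(-j) exp (-1/s), extended by 0. All exponents j are kept because differentiation leads from j
    to j + 1 and j + 2, so smoothness at 0 is settled for every order at once. *)
Definition flat (j : nat) (s : R) : R := if 0 < s then s^-1 ^+ j * expR (- s^-1) else 0.

Lemma flat_ge0 j s : 0 <= flat j s.
Proof. by rewrite /flat; case: ifPn => // s0; rewrite mulr_ge0 ?expR_ge0// exprn_ge0// invr_ge0 ltW. Qed.

Lemma flat_le0 j s : s <= 0 -> flat j s = 0.
Proof. by rewrite /flat leNgt => /negbTE ->. Qed.

Lemma flat_gt0 j s : 0 < s -> 0 < flat j s.
Proof. by move=> s0; rewrite /flat s0 mulr_gt0 ?expR_gt0// exprn_gt0// invr_gt0. Qed.

Lemma flat_bound j : exists M : R, forall s, `|flat j s| <= M.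
Proof.
have [M HM] := @expR_decay R 1 j ltr01; exists M => s.
have M0 : 0 <= M by apply: le_trans (HM 0 (lexx 0)); rewrite mulr_ge0 ?expR_ge0 ?addr0 ?expr1n.
have [s0|s0] := ltP 0 s; last by rewrite flat_le0// normr0.
have v0 : 0 < s^-1 by rewrite invr_gt0.
rewrite ger0_norm ?flat_ge0// /flat s0; apply: le_trans (HM _ (ltW v0)).
rewrite mulN1r ler_wpM2r ?expR_ge0//.
by rewrite lerXn2r ?nnegrE ?(ltW v0) ?addr_ge0 ?ler01 ?lerDr// ltW.
Qed.

(** For s > 0, [flat j s] is s^2 times the bounded [flat j.+2 s]. Quadratic smallness makes the
    derivative at 0 vanish. *)
Lemma flat_quadratic j : exists M : R, forall s, `|flat j s| <= M * s ^+ 2.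
Proof.
have [M HM] := flat_bound j.+2; exists M => s.
have M0 : 0 <= M := le_trans (normr_ge0 _) (HM 0).
have [s0|s0] := ltP 0 s; last by rewrite flat_le0// normr0 mulr_ge0// sqr_ge0.
rewrite -ler_pdivrMr ?exprn_gt0//; apply: le_trans (HM s).
rewrite !ger0_norm ?flat_ge0// /flat s0 le_eqVlt; apply/orP; left; apply/eqP.
by rewrite -exprVn !exprS; ring.
Qed.

Lemma flat_is_derive j (s : R) :
  is_derive s (1 : R) (flat j) (- j%:R * flat j.+1 s + flat j.+2 s).
Proof.
have [s0|s0|<-] := ltgtP 0 s.
- have sn : s != 0 by rewrite gt_eqF.
  have hi : is_derive s (1 : R) (fun r : R => r^-1) (- s ^- 2).
    by apply: (is_derive_eq (is_deriveV sn (is_derive_id s 1))); exact: mulr1.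
  have hp : is_derive s^-1 (1 : R) (fun y : R => y ^+ j * expR (- y))
      (j%:R * s^-1 ^+ j.-1 * expR (- s^-1) - s^-1 ^+ j * expR (- s^-1)).
    have hx : is_derive s^-1 (1 : R) (fun y : R => y ^+ j) (j%:R * s^-1 ^+ j.-1).
      apply: DeriveDef; first exact: exprn_derivable.
      by rewrite exp_derive /GRing.scale/= mulr1.
    have he : is_derive s^-1 (1 : R) (fun y : R => expR (- y)) (- expR (- s^-1)).
      by apply: is_derive_eq; rewrite /GRing.scale/=; ring.
    apply: (is_derive_eq (is_deriveM hx he)); rewrite /GRing.scale/=; ring.
  have H := @is_derive1_comp _ (fun y : R => y ^+ j * expR (- y)) (fun r : R => r^-1) s _ _ hp hi.
  apply: is_derive_eq; first apply: near_eq_is_derive H.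
    by near=> r; rewrite /= /flat ifT//; near: r; exact: lt_nbhsr.
  rewrite /flat s0 -exprVn !exprS; case: (j) => [|k]; first by rewrite expr0; ring.
  by rewrite /= exprS; ring.
- rewrite !flat_le0 ?ltW// mulr0 addr0.
  apply: (near_eq_is_derive _ (is_derive_cst 0 s 1)).
  near=> r; rewrite flat_le0//; apply: ltW; near: r; exact: lt_nbhsl.
- rewrite !flat_le0// mulr0 addr0.
  have [M HM] := flat_quadratic j.
  have L : (fun h : R => h^-1 *: ((flat j \o shift 0) (h *: (1 : R)) - flat j 0)) @ 0^' --> (0 : R).
    have M0 : 0 <= M by have := le_trans (normr_ge0 _) (HM 1); rewrite expr1n mulr1.
    have M1 : 0 < M + 1 by rewrite (lt_le_trans ltr01)// lerDr.
    apply/cvgrPdist_le => e e0; near=> h.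
    rewrite /= (flat_le0 j (lexx 0)) subr0 addr0 sub0r normrN [h *: 1]mulr1 normrM.
    have hn : h != 0 by near: h; exact: nbhs_dnbhs_neq.
    rewrite normfV mulrC ler_pdivrMr ?normr_gt0//.
    apply: (le_trans (HM h)); rewrite -real_normK ?num_real// expr2 mulrA ler_wpM2r//.
    rewrite (@le_trans _ _ ((M + 1) * `|h|))// ?ler_wpM2r ?lerDl//.
    rewrite mulrC -ler_pdivlMr//; near: h.
    by apply: dnbhs0_le; rewrite divr_gt0.
  apply: DeriveDef; first by apply/cvg_ex; exists 0.
  exact: cvg_lim.
Unshelve. all: by end_near. Qed.

Definition bump (s : R) : R := flat 0 (1 - s) * flat 0 s.

Lemma flat0_le1 s : flat 0 s <= 1.
Proof.
rewrite /flat; case: ifPn => // s0; rewrite expr0 mul1r -expR0 ler_expR oppr_le0.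
by rewrite invr_ge0 ltW.
Qed.

Lemma bump_ge0 s : 0 <= bump s.
Proof. by rewrite mulr_ge0 ?flat_ge0. Qed.

Lemma bump_le1 s : bump s <= 1.
Proof. by rewrite mulr_ile1 ?flat_ge0 ?flat0_le1. Qed.

Lemma bump_out s : s <= 0 \/ 1 <= s -> bump s = 0.
Proof.
by move=> [s0|s1]; rewrite /bump ?(flat_le0 _ s0) ?mulr0// (@flat_le0 _ (1 - s)) ?mul0r// subr_le0.
Qed.

Lemma flat_continuous j : continuous (flat j).
Proof.
move=> s; apply: differentiable_continuous; apply/derivable1_diffP; apply: ex_derive.
exact: flat_is_derive.
Qed.

Lemma bump_continuous : continuous bump.
Proof.
have c1 : continuous (fun s : R => flat 0 (1 - s)).
  move=> s; apply: (@continuous_comp R R R (fun s : R => 1 - s) (flat 0)); last exact: flat_continuous.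
  by apply: cvgB; [exact: cvg_cst|exact: cvg_id].
by move=> s; apply: cvgM; [exact: c1|exact: flat_continuous].
Qed.

Lemma bump_antiderivative : exists Th : R -> R, forall s, is_derive s (1 : R) Th (bump s).
Proof.
have ib : (@lebesgue_measure R).-integrable setT (EFin \o bump).
  (* The bump is at most 1 and vanishes outside [0, 1], where 1 + s^2 <= 2: this is the factor 2. *)
  have iq : (@lebesgue_measure R).-integrable setT (fun x => (2%:E * ((oneDsqr x)^-1)%:E)%E).
    apply: integrableZl => //; apply/integrableP; split.
      by apply/measurable_EFinP; exact: measurable_inv_oneDsqr.
    under eq_integral => x _ do rewrite gee0_abs ?lee_fin ?(ltW (inv_oneDsqr_gt0 x))//.
    by rewrite integral_oneDsqrV ltry.
  apply: le_integrable iq => //.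
    by apply/measurable_EFinP; exact: continuous_measurable_fun bump_continuous.
  move=> s _ /=; rewrite lee_fin (ger0_norm (bump_ge0 s)).
  rewrite ger0_norm ?mulr_ge0 ?(ltW (inv_oneDsqr_gt0 s))//.
  rewrite ler_pdivlMr ?(lt_le_trans ltr01 (oneDsqr_ge1 s))//.
  have [sl|sl] := ltP s 0; first by rewrite bump_out ?mul0r//; left; exact: ltW.
  have [sr|sr] := ltP 1 s; first by rewrite bump_out ?mul0r//; right; exact: ltW.
  rewrite -[leRHS]mul1r ler_pM ?bump_ge0 ?bump_le1//.
  rewrite /oneDsqr; nra.
exists (fun x => \int[@lebesgue_measure R]_(t in [set` Interval -oo%O (BRight x)]) bump t) => s.
have is_ : (@lebesgue_measure R).-integrable [set` Interval -oo%O (BRight (s + 1))] (EFin \o bump).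
  by apply: integrableS ib => //; exact: measurable_itv.
have slt : s < s + 1 by rewrite ltrDl.
have [//||d1 d2] := @continuous_FTC1 R bump -oo%O s (s + 1) slt is_.
- by rewrite ltNyr.
- exact: bump_continuous.
apply: DeriveDef; first exact: d1.
by rewrite -derive1E; exact: d2.
Qed.

End BumpOneDim.

(** * Radial cutoffs and regularity of their transforms *)

Section Cutoff.
Context {R : realType} {n : nat}.
Local Notation Rn := 'rV[R]_n.
Local Notation e_ i := (delta_mx ord0 i : Rn).
Implicit Types (chi : Rn -> R) (x y xi eta : Rn) (s t : R).

Lemma is_derive_comp_normsq (f : R -> R) x i (d : R) : is_derive (dotp x x) (1 : R) f d ->
  is_derive x (e_ i) (fun x => f (dotp x x)) (2 * x ord0 i * d).
Proof.
move=> df; apply: is_derive_line.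
have -> : (fun t : R => f (dotp (x + t *: e_ i) (x + t *: e_ i))) =
    f \o (fun t : R => dotp x x + 2 * t * x ord0 i + t * t).
  apply/funext => t /=; congr f.
  rewrite dotpDl !dotpDr (dotpC x (_ *: _)) !dotpZl !dotpZr !dotp_delta !mxE !eqxx/=; ring.
have dg : is_derive (0 : R) (1 : R) (fun t : R => dotp x x + 2 * t * x ord0 i + t * t)
    (2 * x ord0 i).
  by apply: is_derive_eq; rewrite /GRing.scale/=; ring.
have df' : is_derive ((fun t : R => dotp x x + 2 * t * x ord0 i + t * t) 0) (1 : R) f d.
  by rewrite /= !mulr0 !mul0r !addr0.
by have := @is_derive1_comp R f _ 0 d _ df' dg; rewrite mulrC.
Qed.

Lemma differentiable_normsq x : differentiable (fun x : Rn => dotp x x) x.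
Proof.
have := @differentiable_dotp_sqr R n x 0.
by under eq_fun do rewrite subr0.
Qed.

Lemma rapid_of_support (f : Rn -> R) (r M : R) :
  (forall x, r < dotp x x -> f x = 0) -> (forall x, `|f x| <= M) -> rapid f.
Proof.
move=> f0 fM k; exists ((1 + `|r|) ^+ k * M) => x.
have M0 : 0 <= M := le_trans (normr_ge0 _) (fM x).
have jx := jap2_gt0 x.
have [xr|xr] := ltP r (dotp x x).
  by rewrite f0// normr0 mulr0 mulr_ge0// exprn_ge0// addr_ge0.
rewrite ler_pM// ?exprn_ge0 ?(ltW jx)// lerXn2r ?nnegrE ?(ltW jx) ?addr_ge0//.
by rewrite /jap2 lerD2l (le_trans xr)// ler_norm.
Qed.

(** The building blocks of the derivatives of the cutoff; they vanish unless r < |x|^2 < r + 1. *)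
Definition shell (r : R) (j k : nat) x : R :=
  flat j (1 - (dotp x x - r)) * flat k (dotp x x - r).

(** chi is a normalised primitive of the bump in the variable |x|^2 - r, reversed so as to fall from
    1 to 0; the squared norm keeps it smooth at the origin. Together with the shells it spans a
    space stable under derivatives. Evenness later removes the sine part of its transform. *)
Lemma exists_cutoff (r : R) : 0 <= r -> exists chi : Rn -> R,
  [/\ schwartz_real chi, forall x, dotp x x <= r -> chi x = 1 &
      forall x, chi (- x) = chi x].
Proof.
move=> r0; have [Th dT] := @bump_antiderivative R.
have dsub (s : R) : is_derive s (1 : R) (fun s : R => s - r) 1.
  by apply: is_derive_eq; rewrite subr0.
have dTr (s : R) : is_derive s (1 : R) (fun s => Th (s - r)) (bump (s - r)).
  by have := @is_derive1_comp R Th (fun s : R => s - r) s _ _ (dT _) (dsub s); rewrite mulr1.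
have cTab (a b : R) : {within `[a, b], continuous Th}.
  apply: continuous_subspaceT => s; apply/differentiable_continuous/derivable1_diffP.
  by apply: ex_derive; exact: dT.
have TT : 0 < Th 1 - Th 0.
  have [c] := MVT ltr01 (fun s _ => dT s) (cTab _ _).
  rewrite in_itv/= => /andP[c0 c1] ->; rewrite subr0 mulr1 /bump mulr_gt0 ?flat_gt0//.
  by rewrite subr_gt0.
have Tneg (s : R) : s <= 0 -> Th s = Th 0.
  rewrite le_eqVlt => /orP[/eqP->//|s0].
  have [c] := MVT s0 (fun s _ => dT s) (cTab _ _).
  rewrite in_itv/= => /andP[sc c0]; rewrite bump_out ?mul0r; last by left; exact: ltW.
  by move=> /eqP; rewrite subr_eq0 => /eqP.
have Tpos (s : R) : 1 <= s -> Th s = Th 1.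
  rewrite le_eqVlt => /orP[/eqP<-//|s1].
  have [c] := MVT s1 (fun s _ => dT s) (cTab _ _).
  rewrite in_itv/= => /andP[c1 cs]; rewrite bump_out ?mul0r; last by right; exact: ltW.
  by move=> /eqP; rewrite subr_eq0 => /eqP.
have Tbd (s : R) : s <= 1 -> `|Th 1 - Th s| <= 1 - s.
  rewrite le_eqVlt => /orP[/eqP->|s1]; first by rewrite !subrr normr0.
  have [c _ ->] := MVT s1 (fun s _ => dT s) (cTab _ _).
  have s10 : 0 <= 1 - s by rewrite subr_ge0 ltW.
  by rewrite normrM (ger0_norm (bump_ge0 _)) (ger0_norm s10) ler_piMl// bump_le1.
pose k := (Th 1 - Th 0)^-1.
pose chi x := k * (Th 1 - Th (dotp x x - r)).
have chi_out x : r + 1 < dotp x x -> chi x = 0.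
  by move=> h; rewrite /chi Tpos ?subrr ?mulr0// lerBrDl ltW.
exists chi; split; last 2 first.
- move=> x xr; have xr0 : dotp x x - r <= 0 by rewrite subr_le0.
  by rewrite /chi (Tneg _ xr0) mulVf// gt_eqF.
- by move=> x; rewrite /chi dotpNl dotpNr opprK.
pose S (g : Rn -> R) := g = chi \/ exists j l, g = shell r j l.
apply: (@coord_span_schwartz _ _ S); last by apply: coord_span_gen; left.
have dflat (j l : nat) (s : R) : is_derive s (1 : R) (fun s => flat j (1 - (s - r)) * flat l (s - r))
    (flat j (1 - (s - r)) * (- l%:R * flat l.+1 (s - r) + flat l.+2 (s - r)) -
     flat l (s - r) * (- j%:R * flat j.+1 (1 - (s - r)) + flat j.+2 (1 - (s - r)))).
  have dg1 : is_derive s (1 : R) (fun s : R => 1 - (s - r)) (-1).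
    by apply: is_derive_eq; ring.
  have h1 := @is_derive1_comp R (flat j) (fun s : R => 1 - (s - r)) s _ _ (flat_is_derive _ _) dg1.
  have h2 := @is_derive1_comp R (flat l) (fun s : R => s - r) s _ _ (flat_is_derive _ _) (dsub s).
  by apply: (is_derive_eq (is_deriveM h1 h2)); rewrite /GRing.scale/=; ring.
have dchi (s : R) : is_derive s (1 : R) (fun s => k * (Th 1 - Th (s - r)))
    (- k * bump (s - r)).
  apply: (is_derive_eq (is_deriveZ k (is_deriveB (is_derive_cst (Th 1) s 1) (dTr s)))).
  by rewrite /GRing.scale/=; ring.
move=> g [->|[j [l ->]]]; split.
- move=> x; apply: (differentiable_comp1 (f := fun s => k * (Th 1 - Th (s - r)))).
    exact: differentiable_normsq.
  by apply: ex_derive; exact: dchi.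
- apply: (@rapid_of_support _ (r + 1) (`|k| * (1 + r))) => // x.
  have [xr|xr] := ltP (r + 1) (dotp x x).
    by rewrite chi_out// normr0 mulr_ge0// addr_ge0.
  rewrite /chi normrM ler_wpM2l//; apply: (le_trans (Tbd _ _)); first by lra.
  by have := dotp_ge0 x; lra.
- move=> i; exists (fun x : Rn => (- 2 * k) * (x ord0 i * shell r 0 0 x)).
    by apply/coord_spanZ/coord_spanX/coord_span_gen; right; exists 0%N, 0%N.
  move=> x; apply: (is_derive_eq (is_derive_comp_normsq i (dchi (dotp x x)))).
  by rewrite /shell /bump; ring.
- move=> x; apply: (differentiable_comp1 (f := fun s => flat j (1 - (s - r)) * flat l (s - r))).
    exact: differentiable_normsq.
  by apply: ex_derive; exact: dflat.
- have [M HM] := @flat_bound R j; have [N HN] := @flat_bound R l.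
  apply: (@rapid_of_support _ (r + 1) (M * N)) => x.
    by move=> xr; rewrite /shell (@flat_le0 _ j) ?mul0r//; lra.
  by rewrite /shell normrM ler_pM.
- move=> i; exists (fun x : Rn => 2 * (x ord0 i * ((- l%:R * shell r j l.+1 x + 1 * shell r j l.+2 x) +
      (j%:R * shell r j.+1 l x + -1 * shell r j.+2 l x)))).
    apply/coord_spanZ/coord_spanX/coord_spanD; apply: coord_spanD; apply/coord_spanZ/coord_span_gen;
      right; by [exists j, l.+1|exists j, l.+2|exists j.+1, l|exists j.+2, l].
  move=> x; apply: (is_derive_eq (is_derive_comp_normsq i (dflat j l (dotp x x)))).
  by rewrite /shell; ring.
Qed.

Lemma even_ctr_pihalf chi x : (forall y, chi (- y) = chi y) -> Rn_integrable chi ->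
  ctr (pi / 2) chi x = 0.
Proof.
move=> ev ic; have i1 := ctr_integrable (pi / 2) x ic.
have N1 : (-1 : R) != 0 by rewrite oppr_eq0 oner_neq0.
have := Rn_int_affine 0 N1 i1; rewrite normrN1 expr1n invr1 mul1r -/(ctr (pi / 2) chi x).
have -> : Rn_int (fun y => chi (-1 *: y + 0) * cos (dotp x (-1 *: y + 0) + pi / 2)) =
    - ctr (pi / 2) chi x.
  rewrite -[RHS]mulN1r -Rn_intZ//; apply: eq_Rn_int => y.
  by rewrite addr0 scaleN1r ev dotpNr !cosDpihalf sinN; ring.
by move=> E; lra.
Qed.

Lemma norm_cosB (u v : R) : `|cos u - cos v| <= `|u - v|.
Proof.
wlog uv : u v / u < v.
  move=> H; have [uv|vu|->] := ltgtP u v; last by rewrite !subrr.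
    exact: H.
  by rewrite distrC (distrC u); exact: H.
have [c _] := MVT uv (fun s _ => is_derive_cos s) (continuous_subspaceT (@continuous_cos R)).
rewrite distrC => ->; rewrite normrM normrN distrC ler_piMl//.
exact: sin_max.
Qed.

Lemma le_coord_norm x i : `|x ord0 i| <= `|x|.
Proof.
have /mapP[j Hj E] : `|x ord0 i| \in [seq `|x z.1 z.2| | z : 'I_1 * 'I_n].
  by apply/mapP; exists (ord0, i) => //=; rewrite mem_enum.
rewrite E [leRHS]/Num.Def.normr /= mx_normrE.
by apply/bigmax_geP; right; exists j.
Qed.

Lemma dotp_norm_le x y : `|dotp x y| <= `|x| * \sum_(i < n) `|y ord0 i|.
Proof.
rewrite /dotp (le_trans (ler_norm_sum _ _ _))// mulr_sumr; apply: ler_sum => i _.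
rewrite normrM ler_wpM2r//; exact: le_coord_norm.
Qed.

(** The constant is the sum of the absolute first moments of chi: cosine is 1-Lipschitz, and the sup
    norm pairs with the sum of the |x_i|. *)
Lemma ctr_lipschitz chi : schwartz_real chi -> exists L : R, 0 <= L /\
  forall xi eta, `|ctr 0 chi xi - ctr 0 chi eta| <= L * `|xi - eta|.
Proof.
move=> Sc; have ic := schwartz_real_integrable Sc.
have iS : Rn_integrable (fun x => \sum_(i < n) `|x ord0 i * chi x|).
  have ix i : Rn_integrable (fun x => `|x ord0 i * chi x|).
    apply: Rn_integrable_norm; apply: schwartz_real_integrable.
    by apply: coord_span_schwartz_real; apply: coord_spanX; exact: coord_span_gen.
  by have [_] := ctr_sum (index_enum 'I_n) 0 0 ix.
exists (Rn_int (fun x => \sum_(i < n) `|x ord0 i * chi x|)); split.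
  by apply: Rn_int_ge0 => x; exact: sumr_ge0.
move=> xi eta; rewrite mulrC -Rn_intZ// /ctr.
rewrite -(Rn_intB (ctr_integrable 0 xi ic) (ctr_integrable 0 eta ic)).
have iB := Rn_integrableB (ctr_integrable 0 xi ic) (ctr_integrable 0 eta ic).
apply: (le_trans (Rn_int_norm iB)); apply: Rn_int_le.
- exact: Rn_integrable_norm.
- exact: Rn_integrableZ.
move=> x; rewrite -mulrBr normrM !addr0.
apply: (@le_trans _ _ (`|chi x| * (`|xi - eta| * \sum_(i < n) `|x ord0 i|))).
  rewrite ler_wpM2l//; apply: (le_trans (norm_cosB _ _)).
  by rewrite -dotpNl -dotpDl dotp_norm_le.
rewrite mulrCA ler_wpM2l// mulr_sumr; apply: ler_sum => i _.
by rewrite normrM mulrC.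
Qed.

End Cutoff.

(** * Convolution and compactness *)

Section Convolution.
Context {R : realType} {n : nat}.
Local Notation Rn := 'rV[R]_n.
Local Notation m_ := (@gauss_mass R n).
Implicit Types (p K chi : Rn -> R) (x y xi eta : Rn) (s : R).

Lemma japaneseD x y : japanese (x + y) <= 2 * (japanese x * japanese y).
Proof.
have jp z : 0 <= japanese (z : Rn) := le_trans ler01 (japanese_ge1 z).
have h : 0 <= 2 * (japanese x * japanese y) by rewrite !mulr_ge0.
rewrite -[leRHS](ger0_norm h) -sqrtr_sqr ler_wsqrtr// !exprMn !japanese_sqr.
have := jap2D x y; have := jap2_gt0 x; have := jap2_gt0 y; rewrite -/(jap2 (x + y)).
nra.
Qed.

Lemma weight_peetre s x y : 0 <= s ->
  weight s (x + y) <= 2 `^ s * (weight s x * weight s y).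
Proof.
move=> s0; have jp z : 0 <= japanese (z : Rn) := le_trans ler01 (japanese_ge1 z).
rewrite /weight -!powRM ?mulr_ge0//; apply: ge0_ler_powR => //.
- by rewrite nnegrE.
- by rewrite nnegrE !mulr_ge0.
- exact: japaneseD.
Qed.

Lemma weight_le_jap2 s : exists N : nat, forall x, weight s x <= jap2 x ^+ N.
Proof.
exists (Num.truncn s).+1 => x; rewrite -weight_nat; apply: weight_le.
apply: ltW; apply: (lt_le_trans (truncnS_gt _)); rewrite ler_nat.
by rewrite leq_pmull.
Qed.

Lemma rapid_weight_integrable s K : Rn_measurable K -> rapid K ->
  Rn_integrable (fun x => weight s x * `|K x|).
Proof.
move=> mK rK; have [N HN] := weight_le_jap2 s.
apply: rapid_integrable.
  by apply: Rn_measurableM; [exact: Rn_measurable_weight|exact: Rn_measurable_norm].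
move=> k; have [M HM] := rK (k + N)%N; exists M => x.
apply: le_trans (HM x); rewrite normrM normr_id exprD -mulrA.
rewrite ler_wpM2l ?exprn_ge0 ?(ltW (jap2_gt0 _))// ler_wpM2r//.
by rewrite gtr0_norm ?weight_gt0.
Qed.

Definition conv K p xi : R := Rn_int (fun eta => p eta * K (xi - eta)).

Lemma Rn_measurable_subr K eta : Rn_measurable K -> Rn_measurable (fun xi => K (xi - eta)).
Proof.
move=> /(Rn_measurable_affine 1 (- eta)).
by under [X in Rn_measurable X]eq_fun do rewrite scale1r.
Qed.

Lemma Rn_measurable_subl K xi : Rn_measurable K -> Rn_measurable (fun eta => K (xi - eta)).
Proof.
move=> /(Rn_measurable_affine (-1) xi).
by under [X in Rn_measurable X]eq_fun do rewrite scaleN1r addrC.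
Qed.

Lemma Rn_measurable2_subr K : Rn_measurable K -> Rn_measurable2 (fun eta xi => K (xi - eta)).
Proof.
move=> mK; have := Rn_measurable2_sub (Rn_measurable_subl 0 mK).
rewrite (_ : (fun _ _ => _) = (fun eta xi => K (xi - eta)))//.
by apply/funext => x; apply/funext => y; rewrite sub0r opprB.
Qed.

Lemma conv_integrable K p (M : R) xi : Rn_measurable K -> (forall x, `|K x| <= M) ->
  Rn_integrable p -> Rn_integrable (fun eta => p eta * K (xi - eta)).
Proof.
move=> mK KM ip; apply: (@Rn_integrableM_bounded _ _ M) => //.
exact: Rn_measurable_subl.
Qed.

Lemma conv_bound K p (M : R) xi : Rn_measurable K -> (forall x, `|K x| <= M) ->
  Rn_integrable p -> `|conv K p xi| <= M * Rn_int (fun eta => `|p eta|).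
Proof.
move=> mK KM ip; have ic := conv_integrable xi mK KM ip.
rewrite -Rn_intZ; last exact: Rn_integrable_norm.
apply: (le_trans (Rn_int_norm ic)); apply: Rn_int_le.
- exact: Rn_integrable_norm.
- exact/Rn_integrableZ/Rn_integrable_norm.
- by move=> eta; rewrite normrM mulrC ler_wpM2r.
Qed.

Lemma conv_lipschitz K p (M L : R) xi eta : Rn_measurable K -> (forall x, `|K x| <= M) ->
  (forall x y, `|K x - K y| <= L * `|x - y|) -> Rn_integrable p ->
  `|conv K p xi - conv K p eta| <= L * Rn_int (fun z => `|p z|) * `|xi - eta|.
Proof.
move=> mK KM KL ip; have ic x := conv_integrable x mK KM ip.
have iN := Rn_integrable_norm ip.
rewrite /conv -Rn_intB// mulrAC -Rn_intZ//.
apply: (le_trans (Rn_int_norm (Rn_integrableB (ic _) (ic _)))); apply: Rn_int_le.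
- exact/Rn_integrable_norm/Rn_integrableB.
- exact: Rn_integrableZ.
- move=> z; rewrite -mulrBr normrM mulrC ler_wpM2r//.
  by apply: (le_trans (KL _ _)); rewrite opprB addrA subrK.
Qed.

(** Young's inequality with weights: Peetre's inequality distributes the weight at xi over eta and
    xi - eta at the cost 2 ^ s, then Tonelli and translation invariance separate the two factors. *)
Lemma conv_weighted s K p : 0 <= s -> Rn_measurable K -> rapid K ->
  Rn_measurable p -> Rn_integrable (fun xi => weight s xi * p xi) ->
  Rn_integrable (fun xi => weight s xi * conv K p xi) /\
  Rn_int (fun xi => `|weight s xi * conv K p xi|) <=
    2 `^ s * Rn_int (fun x => weight s x * `|K x|) * Rn_int (fun xi => `|weight s xi * p xi|).
Proof.
move=> s0 mK rK mp ip; set AK := Rn_int (fun x => weight s x * `|K x|).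
have iK := rapid_weight_integrable s mK rK.
have [M KM] := rapid_bounded rK.
have wp x : 0 < weight s x := weight_gt0 s x.
have ip0 : Rn_integrable p.
  apply: Rn_integrable_le (Rn_integrable_norm ip) => // x.
  by rewrite normrM (gtr0_norm (wp x)) ler_peMl// weight_ge1.
pose H eta xi := weight s xi * (p eta * K (xi - eta)).
pose B eta xi := 2 `^ s * `|weight s eta * p eta| * (weight s (xi - eta) * `|K (xi - eta)|).
have HB eta xi : `|H eta xi| <= B eta xi.
  rewrite /H /B !normrM !(gtr0_norm (wp _)).
  have := weight_peetre (xi - eta) eta s0; rewrite subrK => P.
  apply: (@le_trans _ _ (2 `^ s * (weight s (xi - eta) * weight s eta) *
     (`|p eta| * `|K (xi - eta)|))); first by rewrite ler_wpM2r// mulr_ge0.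
  by rewrite le_eqVlt; apply/orP; left; apply/eqP; ring.
have iB eta : Rn_integrable (B eta).
  by apply: Rn_integrableZ; exact: (Rn_integrable_shift (- eta) iK).
have BE eta : Rn_int (B eta) = 2 `^ s * AK * `|weight s eta * p eta|.
  rewrite /B Rn_intZ; last exact: (Rn_integrable_shift (- eta) iK).
  by rewrite (Rn_int_shift (- eta) iK) -/AK; ring.
have iH eta : Rn_integrable (H eta).
  apply: Rn_integrable_le (iB eta) => //.
  apply: Rn_measurableM; first exact: Rn_measurable_weight.
  by apply: Rn_measurableM; [exact: Rn_measurable_cst|exact: Rn_measurable_subr].
have mH : Rn_measurable2 H.
  apply: Rn_measurable2M; first exact: (Rn_measurable2_snd (Rn_measurable_weight s)).
  apply: Rn_measurable2M; first exact: (Rn_measurable2_fst mp).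
  exact: Rn_measurable2_subr.
have iA : Rn_integrable (fun eta => 2 `^ s * AK * `|weight s eta * p eta|).
  by apply: Rn_integrableZ; exact: Rn_integrable_norm.
have HA eta : Rn_int (fun xi => `|H eta xi|) <= 2 `^ s * AK * `|weight s eta * p eta|.
  by rewrite -BE; apply: Rn_int_le => //; exact: Rn_integrable_norm.
have cE xi : Rn_int (H ^~ xi) = weight s xi * conv K p xi.
  by rewrite /H Rn_intZ//; exact: (conv_integrable xi mK KM ip0).
have [_ i2 _] := Rn_fubini mH iH iA HA.
have iwc : Rn_integrable (fun xi => weight s xi * conv K p xi).
  by move: i2; congr Rn_integrable; exact/funext.
split => //.
have mHn : Rn_measurable2 (fun eta xi => `|H eta xi|).
  exact: (Rn_measurable2_comp (@normr_measurable R setT) mH).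
have [||j1 j2 E] := Rn_fubini mHn _ iA; first by move=> eta; exact: Rn_integrable_norm.
  by move=> eta; under eq_Rn_int do rewrite normr_id; exact: HA.
apply: (@le_trans _ _ (Rn_int (fun xi => Rn_int (fun eta => `|H eta xi|)))).
  apply: Rn_int_le; [exact: Rn_integrable_norm|exact: j2|].
  move=> xi; rewrite -cE; apply: Rn_int_norm.
  by apply: Rn_integrableZ; exact: (conv_integrable xi mK KM ip0).
rewrite -E -Rn_intZ; last exact: Rn_integrable_norm.
by apply: Rn_int_le; [exact: j1|exact: iA|exact: HA].
Qed.

(** The hypothesis on K says that its transform is the real function chi, without sine part. Moving
    xi by eta adds x . eta to the phase, so the transform of p comes out with its own phase [a]. *)
Lemma ctr_conv K chi p (a : R) x : Rn_measurable K -> rapid K ->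
  (forall b y, ctr b K y = cos b * chi y) -> Rn_integrable p ->
  ctr a (conv K p) x = chi x * ctr a p x.
Proof.
move=> mK rK Kchi ip; have iK := rapid_integrable mK rK.
have [M KM] := rapid_bounded rK.
pose H eta xi := p eta * (K (xi - eta) * cos (dotp x xi + a)).
have iKs eta : Rn_integrable (fun xi => K (xi - eta)) := Rn_integrable_shift (- eta) iK.
have iKc eta : Rn_integrable (fun xi => K (xi - eta) * cos (dotp x xi + a)).
  exact: (ctr_integrable a x (iKs eta)).
have iH eta : Rn_integrable (H eta) by exact: Rn_integrableZ.
have mH : Rn_measurable2 H.
  apply: Rn_measurable2M; first exact: (Rn_measurable2_fst (Rn_integrable_measurable ip)).
  apply: Rn_measurable2M; first exact: Rn_measurable2_subr.
  exact: (Rn_measurable2_snd (Rn_measurable_cos_dotp x a)).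
have iA : Rn_integrable (fun eta => Rn_int (fun z => `|K z|) * `|p eta|).
  by apply: Rn_integrableZ; exact: Rn_integrable_norm.
have HA eta : Rn_int (fun xi => `|H eta xi|) <= Rn_int (fun z => `|K z|) * `|p eta|.
  rewrite -(Rn_int_shift (- eta) (Rn_integrable_norm iK)) mulrC -Rn_intZ; last first.
    exact: (Rn_integrable_shift (- eta) (Rn_integrable_norm iK)).
  apply: Rn_int_le; first exact: Rn_integrable_norm.
    by apply: Rn_integrableZ; exact: (Rn_integrable_shift (- eta) (Rn_integrable_norm iK)).
  by move=> xi; rewrite /H !normrM ler_wpM2l// ler_piMr// norm_cos.
have [_ _ E] := Rn_fubini mH iH iA HA.
rewrite /ctr.
have -> : Rn_int (fun xi => conv K p xi * cos (dotp x xi + a)) = Rn_int (fun xi => Rn_int (H ^~ xi)).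
  apply: eq_Rn_int => xi; rewrite mulrC -Rn_intZ; last exact: (conv_integrable xi mK KM ip).
  by apply: eq_Rn_int => eta; rewrite /H; ring.
rewrite -E -Rn_intZ; last exact: ctr_integrable.
apply: eq_Rn_int => eta; rewrite /H (Rn_intZ _ (iKc eta)) mulrCA; congr (_ * _).
have i1 := ctr_integrable (dotp x eta + a) x iK.
rewrite mulrC -(Kchi (dotp x eta + a) x) /ctr -(Rn_int_shift (- eta) i1).
by apply: eq_Rn_int => xi; rewrite dotpDr dotpNr; congr (_ * cos _); ring.
Qed.

(** K is the transform of the cutoff divided by [gauss_mass] ^ 2, the constant of the inversion
    formula, so transforming K gives the cutoff back. *)
Lemma exists_cutoff_kernel (r : R) : 0 <= r -> exists K chi : Rn -> R,
  [/\ Rn_measurable K, rapid K,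
     exists L : R, 0 <= L /\ forall x y, `|K x - K y| <= L * `|x - y|,
     forall b y, ctr b K y = cos b * chi y & forall x, dotp x x <= r -> chi x = 1].
Proof.
move=> r0; have [chi [Sc c1 ev]] := @exists_cutoff R n r r0.
have ic := schwartz_real_integrable Sc.
have m0 : m_ != 0 by rewrite gt_eqF// gauss_mass_gt0.
have cc := ctr_continuous (a := 0) ic.
exists (fun xi => m_ ^- 2 * ctr 0 chi xi), chi; split => //.
- by apply: Rn_measurableM; [exact: Rn_measurable_cst|exact: continuous_Rn_measurable].
- by apply: rapidZ; exact: ctr_rapid.
- have [L [L0 HL]] := ctr_lipschitz Sc.
  have mm : 0 <= m_ ^- 2 by rewrite invr_ge0 exprn_ge0// ltW// gauss_mass_gt0.
  exists (m_ ^- 2 * L); split; first exact: mulr_ge0.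
  by move=> x y; rewrite -mulrBr normrM (ger0_norm mm) -mulrA ler_wpM2l.
- move=> b y; rewrite ctrZ; last exact: ctr_schwartz_integrable.
  apply: (@mulfI _ (m_ ^+ 2)); first by rewrite expf_neq0.
  rewrite mulVKf ?expf_neq0// mulrCA mulrA -schwartz_inversion// /ctr.
  apply: eq_Rn_int => z; rewrite -/(ctr (- (dotp z y + b)) chi z).
  rewrite -[- (dotp z y + b)]add0r ctr_phase// cosN sinN add0r even_ctr_pihalf//.
  by rewrite mulr0 addr0 mulrC dotpC.
Qed.

End Convolution.

(** * Extraction of convergent densities *)

Section Compactness.
Context {R : realType} {n : nat}.
Local Notation Rn := 'rV[R]_n.
Implicit Types (x y xi : Rn) (s t : R).

(** The image of U has a cluster point in a compact segment; since an ultrafilter contains every set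
    or its complement, that point is a limit. *)
Lemma ultra_limit (U : set_system nat) (a : nat -> R) (M : R) : UltraFilter U ->
  (forall k, `|a k| <= M) -> exists l : R, forall e : R, 0 < e -> U [set k | `|a k - l| < e].
Proof.
move=> UU aM; have cpt := @segment_compact R (- M) M.
have PU : ProperFilter (a @ U) by exact: fmap_proper_filter.
have UM : (a @ U) `[- M, M]%classic.
  rewrite /fmap /=; apply: filterS filterT => k _ /=.
  by rewrite in_itv/= -ler_norml.
have [l [_ cl]] := cpt _ PU UM; exists l => e e0.
have [//|UC] := in_ultra_setVsetC [set k | `|a k - l| < e] UU.
have UA : (a @ U) [set r | e <= `|r - l|].
  by rewrite /fmap/=; apply: filterS UC => k /= H; rewrite leNgt; apply/negP.
have [r [/= h1 h2]] := cl _ _ UA (nbhsx_ballx l e e0).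
by move: h1 h2; rewrite /ball/= distrC leNgt => /negP.
Qed.

(* The limit is taken along an ultrafilter; the Lipschitz bound then reduces the
   extraction of a sequence to the countably many rational points. *)
Lemma lipschitz_subsequence (I : finType) (f : nat -> I -> Rn -> R) (M L : R) : 0 <= L ->
  (forall k b x, `|f k b x| <= M) ->
  (forall k b x y, `|f k b x - f k b y| <= L * `|x - y|) ->
  exists (kap : nat -> nat) (g : I -> Rn -> R),
    (forall m, (m <= kap m)%N) /\ forall b x, (fun m => f (kap m) b x) @ \oo --> g b x.
Proof.
move=> L0 fM fL.
have [U [UU sU]] := ultraFilterLemma eventually_filter.
have /choice[g0 g0P] : forall bx : I * Rn, exists l : R, forall e : R, 0 < e ->
    U [set k | `|f k bx.1 bx.2 - l| < e].
  by move=> bx; apply: (@ultra_limit _ _ M) => // k; exact: fM.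
pose g b x := g0 (b, x).
have gP b x e : 0 < e -> U [set k | `|f k b x - g b x| < e] by exact: g0P (b, x) e.
have gL b x y : `|g b x - g b y| <= L * `|x - y|.
  apply/ler_addgt0Pl => e e0.
  have e2 : 0 < e / 2 by rewrite divr_gt0.
  have [k [/= h1 h2]] := filter_ex (filterI (gP b x _ e2) (gP b y _ e2)).
  have := fL k b x y.
  have := ler_distD (f k b x) (g b x) (g b y).
  have := ler_distD (f k b y) (f k b x) (g b y).
  by move: h1 h2; rewrite (distrC (f k b x) (g b x)); lra.
pose pt (j : nat) : option (I * 'rV[rat]_n) := unpickle j.
(* Closeness within 1 / (m + 1) at the first m + 1 entries of an enumeration of component and
   rational point. This is a finite intersection of members of U, hence satisfied by some k. *)
pose ok (m : nat) (k : nat) := (m <= k)%N /\ forall j, (j <= m)%N ->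
  forall b q, pt j = Some (b, q) ->
  `|f k b (map_mx ratr q) - g b (map_mx ratr q)| < m.+1%:R^-1.
have /choice[kap kapP] : forall m, exists k, ok m k.
  move=> m; apply: (@filter_ex _ U).
  apply: filterI; first by apply: sU; exists m.
  have : forall N, U [set k | forall j, (j < N)%N -> forall b q, pt j = Some (b, q) ->
     `|f k b (map_mx ratr q) - g b (map_mx ratr q)| < m.+1%:R^-1].
    elim=> [|N IHN]; first by apply: filterS filterT.
    have UN : U [set k | forall b q, pt N = Some (b, q) ->
        `|f k b (map_mx ratr q) - g b (map_mx ratr q)| < m.+1%:R^-1].
      case: (pt N) => [[b q]|]; last by apply: filterS filterT.
      have d0 : 0 < m.+1%:R^-1 :> R by rewrite invr_gt0.
      by apply: filterS (gP b (map_mx ratr q) _ d0) => k /= hk b' q' [<- <-].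
    apply: filterS (filterI IHN UN) => k [/= h1 h2] j; rewrite ltnS leq_eqVlt.
    by move=> /orP[/eqP->|]; [exact: h2|exact: h1].
  by move=> /(_ m.+1); apply: filterS => k /= h j jm; apply: h; rewrite ltnS.
exists kap, g; split; first by move=> m; have [] := kapP m.
move=> b x; apply/cvgrPdist_lt => e e0.
(* Three errors of at most e / 4 occur: moving from x to a rational point in f and in g, and the
   approximation at that point. L + 1 allows for L = 0. *)
have d0 : 0 < e / 4 / (L + 1) by rewrite !divr_gt0// (lt_le_trans ltr01)// lerDr.
have [q xq] := rat_dense x d0.
have e2 : 0 < e / 4 by rewrite divr_gt0.
have Lq : L * `|x - map_mx ratr q| <= e / 4.
  apply: (@le_trans _ _ ((L + 1) * (e / 4 / (L + 1)))); last first.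
    by rewrite mulrC divfK// gt_eqF// (lt_le_trans ltr01)// lerDr.
  by rewrite ler_pM// ?lerDl// ltW.
near=> m.
have pm : (pickle (b, q) <= m)%N by near: m; exists (pickle (b, q)).
have sm : m.+1%:R^-1 < e / 4 by near: m; exact: (near_infty_natSinv_lt (PosNum e2)).
have [_ h] := kapP m.
have := h _ pm b q; rewrite /pt pickleK => /(_ erefl) /lt_trans/(_ sm) h1.
have h2 := fL (kap m) b x (map_mx ratr q).
have h3 := gL b x (map_mx ratr q).
have := ler_distD (g b (map_mx ratr q)) (g b x) (f (kap m) b x).
have := ler_distD (f (kap m) b (map_mx ratr q)) (g b (map_mx ratr q)) (f (kap m) b x).
move: h1 h2; rewrite (distrC (f (kap m) b (map_mx ratr q)) (g b _)).
rewrite (distrC (f (kap m) b (map_mx ratr q)) (f (kap m) b x)); lra.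
Unshelve. all: by end_near. Qed.

(** Where [weight s] exceeds d [weight t], <x>^(t - s) is at most 1 / d. The exponent c writes
    <x>^(s + 2n) as a power of <x>^(t - s), so there [weight s] times [jap2] ^ n is bounded; |c|
    covers a negative c. *)
Lemma weight_interpolation s t (d : R) : s < t -> 0 < d ->
  exists C : R, 0 <= C /\ forall x, weight s x <= d * weight t x + C * (jap2 x ^+ n)^-1.
Proof.
move=> st d0; pose c := (s + (2 * n)%:R) / (t - s).
have ts : 0 < t - s by rewrite subr_gt0.
exists (d^-1 `^ `|c|); split; first exact: powR_ge0.
move=> x; have jn : 0 < jap2 x ^+ n by rewrite exprn_gt0// jap2_gt0.
have [h|h] := leP (weight s x) (d * weight t x).
  by rewrite (le_trans h)// lerDl mulr_ge0 ?powR_ge0// invr_ge0 ltW.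
rewrite -[leLHS]add0r lerD ?mulr_ge0 ?(ltW d0) ?(ltW (weight_gt0 _ _))//.
rewrite ler_pdivlMr// -weight_nat -weightD.
have wd : weight (t - s) x <= d^-1.
  have E : weight t x = weight s x * weight (t - s) x by rewrite -weightD addrC subrK.
  move: h; rewrite E mulrCA gtr_pMr ?weight_gt0// => h.
  by rewrite -[leRHS]mul1r ler_pdivlMr// mulrC ltW.
have -> : weight (s + (2 * n)%:R) x = weight (t - s) x `^ c.
  by rewrite /weight -powRrM /c mulrC divfK// gt_eqF.
have w1 : 1 <= weight (t - s) x by apply: weight_ge1; exact: ltW.
apply: (@le_trans _ _ (weight (t - s) x `^ `|c|)).
  by apply: ler_powR => //; exact: ler_norm.
apply: ge0_ler_powR => //; rewrite ?nnegrE ?invr_ge0 ?(ltW d0)//.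
exact: le_trans ler01 w1.
Qed.

Lemma Rn_fatou (f : nat -> Rn -> R) (g : Rn -> R) (B : R) :
  (forall k, Rn_integrable (f k)) -> (forall k x, 0 <= f k x) ->
  (forall x, f ^~ x @ \oo --> g x) -> (forall k, Rn_int (f k) <= B) ->
  Rn_integrable g /\ Rn_int g <= B.
Proof.
move=> if_ f0 fg fB.
have g0 x : 0 <= g x.
  have := fg x => /cvg_lim <-//; apply: limr_ge; first by apply/cvg_ex; exists (g x).
  exact: nearW.
have mg : Rn_measurable g.
  by apply: (measurable_fun_cvg (fun k => Rn_integrable_measurable (if_ k))) => t _; exact: fg.
have le : (\int[lebesgue_Rn R n]_z (g (row_of z))%:E <= B%:E)%E.
  have := @fatou _ _ _ (lebesgue_Rn R n) setT measurableT (fun k z => (f k (row_of z))%:E).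
  have E : (fun z => limn_einf (fun k => (f k (@row_of R n z))%:E)) = (fun z => (g (row_of z))%:E).
    apply/funext => t; have c : (fun k => (f k (row_of t))%:E) @ \oo --> (g (row_of t))%:E.
      by apply: cvg_EFin; [exact: nearW|exact: fg].
    by rewrite is_cvg_limn_einfE; [exact: cvg_lim|apply/cvg_ex; eexists; exact: c].
  rewrite E => H; apply: (le_trans (H _ _)).
  - by move=> k; apply/measurable_EFinP; exact: Rn_integrable_measurable.
  - by move=> k t _; rewrite lee_fin.
  - rewrite limn_einf_lim; apply: lime_le; first exact: is_cvg_einfs.
    apply: nearW => k; apply: (@le_trans _ _ (\int[lebesgue_Rn R n]_z (f k (row_of z))%:E)%E).
      by apply: ereal_inf_lbound; exists k => /=.
    by rewrite -(EFin_Rn_int (if_ k)) lee_fin.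
have ig : Rn_integrable g.
  apply/integrableP; split; first exact/measurable_EFinP.
  have -> : (fun z => `|(EFin \o (g \o row_of)) z|)%E = (fun z => (g (@row_of R n z))%:E).
    by apply/funext => z; rewrite /= ger0_norm.
  exact: le_lt_trans le (ltry B).
by split => //; rewrite -lee_fin EFin_Rn_int.
Qed.

Lemma Rn_measurableB (F G : Rn -> R) : Rn_measurable F -> Rn_measurable G ->
  Rn_measurable (fun x => F x - G x).
Proof. by move=> mF mG; exact: (measurable_funB mF mG). Qed.

(** Pointwise convergence is upgraded by interpolating the weight. The part in weight t is a small
    multiple of a quantity bounded by 2 B, Fatou covering the limit g; the part in [jap2] ^ (-n)
    tends to 0 by dominated convergence, thanks to the uniform bound M. *)
Lemma weighted_compactness s t (f : nat -> Rn -> R) (g : Rn -> R) (M B : R) : s < t ->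
  (forall k x, `|f k x| <= M) ->
  (forall k, Rn_integrable (fun x => weight t x * f k x)) ->
  (forall k, Rn_int (fun x => `|weight t x * f k x|) <= B) ->
  (forall x, f ^~ x @ \oo --> g x) ->
  [/\ Rn_measurable g, Rn_integrable (fun x => weight t x * g x) &
   (fun k => Rn_int (fun x => `|weight s x * (f k x - g x)|)) @ \oo --> 0].
Proof.
move=> st fM if_ fB fg.
have wp r x : 0 < weight r x := weight_gt0 r x.
have mf k : Rn_measurable (f k) := weighted_measurable (if_ k).
have mg : Rn_measurable g by apply: (measurable_fun_cvg mf) => z _; exact: fg.
have gM x : `|g x| <= M.
  have c : (fun k => `|f k x|) @ \oo --> `|g x| by apply: cvg_norm; exact: fg.
  rewrite -(cvg_lim _ c)//; apply: limr_le; first by apply/cvg_ex; exists `|g x|.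
  by apply: nearW => k; exact: fM.
have [ig gB] : Rn_integrable (fun x => `|weight t x * g x|) /\
    Rn_int (fun x => `|weight t x * g x|) <= B.
  apply: (@Rn_fatou (fun k x => `|weight t x * f k x|)) => //.
  - by move=> k; exact: Rn_integrable_norm.
  - by move=> x; apply: cvg_norm; apply: cvgM; [exact: cvg_cst|exact: fg].
have ig' : Rn_integrable (fun x => weight t x * g x).
  by apply: Rn_integrable_le ig => //; apply: Rn_measurableM => //; exact: Rn_measurable_weight.
split => //.
have B0 : 0 <= B by rewrite (le_trans _ (fB 0%N))//; exact: Rn_int_ge0.
have iD k : Rn_integrable (fun x => `|weight t x * (f k x - g x)|).
  under [X in Rn_integrable X]eq_fun do rewrite mulrBr.
  by apply: Rn_integrable_norm; exact: Rn_integrableB.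
have DB k : Rn_int (fun x => `|weight t x * (f k x - g x)|) <= B + B.
  apply: le_trans (lerD (fB k) gB); rewrite -Rn_intD//; last exact: Rn_integrable_norm.
  apply: Rn_int_le => //; first by apply: Rn_integrableD => //; exact: Rn_integrable_norm.
  by move=> x; rewrite mulrBr ler_normB.
have iJ := @Rn_integrable_jap2 R n.
have jp x : 0 < (jap2 (x : Rn) ^+ n)^-1 by rewrite invr_gt0 exprn_gt0// jap2_gt0.
have mJ := Rn_integrable_measurable iJ.
have iE k : Rn_integrable (fun x => (jap2 x ^+ n)^-1 * `|f k x - g x|).
  apply: (@Rn_integrableM_bounded _ _ (M + M)) => //.
    by apply: Rn_measurable_norm; exact: Rn_measurableB.
  by move=> x; rewrite normr_id (le_trans (ler_normB _ _))// lerD.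
have cE : (fun k => Rn_int (fun x => (jap2 x ^+ n)^-1 * `|f k x - g x|)) @ \oo --> 0.
  rewrite -(@Rn_int0 R n).
  have [||||_] // := @Rn_dominated_convergence _ _
     (fun k x => (jap2 x ^+ n)^-1 * `|f k x - g x|) (fun=> 0)
     (fun x => (M + M) * (jap2 x ^+ n)^-1).
  - by move=> k; exact: Rn_integrable_measurable.
  - exact: Rn_integrableZ.
  - move=> k x; rewrite normrM normr_id (ger0_norm (ltW (jp x))) mulrC ler_wpM2r ?(ltW (jp x))//.
    by rewrite (le_trans (ler_normB _ _))// lerD.
  - move=> x; rewrite -(mulr0 (jap2 x ^+ n)^-1); apply: cvgM; first exact: cvg_cst.
    rewrite -(normr0 R) -(subrr (g x)); apply: cvg_norm; apply: cvgB; last exact: cvg_cst.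
    exact: fg.
apply/cvgrPdist_le => e e0.
(* Half of e goes to each part; the added 1, here and in C + 1, keeps the denominators positive. *)
have d0 : 0 < e / 2 / (B + B + 1) by rewrite !divr_gt0// (lt_le_trans ltr01)// lerDr addr_ge0.
have [C [C0 HC]] := weight_interpolation st d0.
have c0 : 0 < e / 2 / (C + 1) by rewrite !divr_gt0// (lt_le_trans ltr01)// lerDr.
have /cvgrPdist_le/(_ _ c0)[N _ HN] := cE; exists N => // k /= Nk.
rewrite sub0r normrN ger0_norm ?Rn_int_ge0//.
have := HN k Nk; rewrite /= sub0r normrN ger0_norm; last first.
  by apply: Rn_int_ge0 => x; rewrite mulr_ge0// ltW.
set E := Rn_int _ => Ek.
apply: (@le_trans _ _ (e / 2 / (B + B + 1) * (B + B) + C * E)); last first.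
  have h1 : e / 2 / (B + B + 1) * (B + B) <= e / 2.
    rewrite -mulrA ler_piMr ?divr_ge0 ?(ltW e0)//.
    by rewrite mulrC ler_pdivrMr ?mul1r ?lerDl// (lt_le_trans ltr01)// lerDr addr_ge0.
  have h2 : C * E <= e / 2.
    apply: (@le_trans _ _ (C * (e / 2 / (C + 1)))); first by rewrite ler_wpM2l.
    rewrite mulrCA ler_piMr ?divr_ge0 ?(ltW e0)//.
    by rewrite ler_pdivrMr ?mul1r ?lerDl// (lt_le_trans ltr01)// lerDr.
  by lra.
apply: (@le_trans _ _ (Rn_int (fun x =>
   e / 2 / (B + B + 1) * `|weight t x * (f k x - g x)| + C * ((jap2 x ^+ n)^-1 * `|f k x - g x|)))).
  have le x : `|weight s x * (f k x - g x)| <= e / 2 / (B + B + 1) * `|weight t x * (f k x - g x)| +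
      C * ((jap2 x ^+ n)^-1 * `|f k x - g x|).
    rewrite !normrM !(gtr0_norm (wp _ _)) !mulrA -mulrDl ler_wpM2r//.
  have iS : Rn_integrable (fun x => e / 2 / (B + B + 1) * `|weight t x * (f k x - g x)| +
      C * ((jap2 x ^+ n)^-1 * `|f k x - g x|)).
    by apply: Rn_integrableD; exact: Rn_integrableZ.
  apply: Rn_int_le => //; apply: Rn_integrable_le iS.
    apply: Rn_measurable_norm; apply: Rn_measurableM; first exact: Rn_measurable_weight.
    exact: Rn_measurableB.
  by move=> x; rewrite normr_id.
rewrite Rn_intD; [|exact: Rn_integrableZ..].
rewrite !Rn_intZ// lerD2r ler_wpM2l//.
exact: ltW.
Qed.

End Compactness.

(** * Maximum principle *)

Section MaximumPrinciple.
Context {R : realType}.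

(** At the maximum [dphi] vanishes. If d were positive, [dphi] would be positive just to the right
    of 0, and by the mean value theorem phi would exceed its maximum there. *)
Lemma second_derivative_at_max (phi dphi : R -> R) (e d : R) : 0 < e ->
  (forall t, t \in `]- e, e[ -> is_derive t (1 : R) phi (dphi t)) ->
  is_derive (0 : R) (1 : R) dphi d ->
  (forall t, t \in `]- e, e[ -> phi t <= phi 0) -> d <= 0.
Proof.
move=> e0 dp [ddp dd] pmax; rewrite leNgt; apply/negP => d0.
have i0 : (0 : R) \in `]- e, e[ by rewrite in_itv/= oppr_lt0 e0.
have p0 : dphi 0 = 0.
  have [_ <-] := dp _ i0.
  have [|t ti||//|_ //] := @derive1_at_max _ phi (- e) e 0; first by lra.
  - by have [] := dp _ ti.
  - exact: i0.
have := ddp; rewrite /derivable => /cvgrPdist_lt; rewrite -/('D_1 dphi 0) dd.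
move=> /(_ _ d0)[r /= r0 Hr].
pose m := Num.min e r; have m0 : 0 < m by rewrite lt_min e0.
have me : m <= e by rewrite ge_min lexx.
have mr : m <= r by rewrite ge_min lexx orbT.
have m2 : 0 < m / 2 by rewrite divr_gt0.
have sub t : t \in `[0, m / 2] -> t \in `]- e, e[.
  by rewrite !in_itv/= => /andP[t0 tm]; apply/andP; split; lra.
have dp' t : t \in `]0, m / 2[ -> is_derive t (1 : R) phi (dphi t).
  by move=> /subset_itv_oo_cc/sub; exact: dp.
have cp : {within `[0, m / 2], continuous phi}.
  by apply: derivable_within_continuous => t /sub ti; have [] := dp _ ti.
have [c] := MVT m2 dp' cp; rewrite in_itv/= => /andP[c0 cm] Ec.
have : phi (m / 2) <= phi 0.
  by apply: pmax; rewrite in_itv/=; apply/andP; split; lra.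
rewrite -subr_le0 Ec subr0 pmulr_lle0// => dc.
have cr : c < r by lra.
have := Hr c; rewrite /ball_/= sub0r normrN gtr0_norm// => /(_ cr (lt0r_neq0 c0)).
rewrite addr0 p0 subr0 (_ : c%:A = c) ?[c%:A]mulr1// => H.
have {H} : 0 < c^-1 * dphi c.
  have := ler_norm (d - c^-1 * dphi c); move: H; rewrite /GRing.scale/=; lra.
by rewrite pmulr_rgt0 ?invr_gt0// ltNge dc.
Qed.

Context {n : nat}.
Local Notation Rn := 'rV[R]_n.
Local Notation e_ i := (delta_mx ord0 i : Rn).
Implicit Types (w : Rn -> R) (x y : Rn).

Lemma pderiv2_at_max w x (i : 'I_n) : coord_C2 w -> (\forall y \near x, w y <= w x) ->
  iter_partial [:: i; i] w x <= 0.
Proof.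
move=> cw /nbhs_ballP[r /= r0]; rewrite -ball_normE => Hr.
have den : 0 < `|e_ i| + 1 by rewrite ltr_wpDl.
(* Keeps x + t e_i inside the ball of radius r for |t| < e, whatever the norm of the basis
   vector. *)
pose e := r / (`|e_ i| + 1); have e0 : 0 < e by rewrite divr_gt0.
apply: (@second_derivative_at_max (fun t => w (x + t *: e_ i))
          (fun t => pderiv i w (x + t *: e_ i)) e _ e0).
- move=> t _; apply: is_derive_to_line; apply: DeriveDef => //.
  by have [] := cw i (x + t *: e_ i).
- apply: is_derive_to_line; rewrite scale0r addr0; apply: DeriveDef => //.
  by have [] := cw i x.
move=> t; rewrite in_itv/= => te; rewrite scale0r addr0; apply: Hr.
rewrite /ball_/= opprD addrA subrr sub0r normrN normrZ.
have : `|t| < e by rewrite ltr_norml.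
rewrite /e ltr_pdivlMr// mulrDr mulr1; have := normr_ge0 t; lra.
Qed.

Lemma bounded_closure (Omega : set Rn) : bounded_set Omega -> bounded_set (closure Omega).
Proof.
move=> [M [Mr HM]]; exists (M + 2); split; first exact: realD.
move=> N MN x clx /=.
have /HM OM : M < M + 1 by rewrite ltrDl.
have [y [Oy]] := clx _ (nbhsx_ballx x 1 ltr01).
rewrite -ball_normE /= => xy; have := OM y Oy; rewrite /=.
have := ler_distD y x 0; rewrite !subr0; lra.
Qed.

(** At a maximum c inside Omega the equation reads w(c) = Delta w(c), and the right side is a sum of
    nonpositive second derivatives. The zero order term thus gives the bound at once, and weak
    inequalities suffice. *)
Lemma helmholtz_max_principle (Omega : set Rn) w : open Omega -> bounded_set Omega ->
  continuous w -> coord_C2 w ->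
  (forall x, Omega x -> w x - \sum_(i < n) iter_partial [:: i; i] w x = 0) ->
  (forall x, boundary Omega x -> w x <= 0) -> forall x, closure Omega x -> w x <= 0.
Proof.
move=> oO bO cw w2 eqw bw x clx.
have cpt : compact (closure Omega).
  by apply: bounded_closed_compact; [exact: bounded_closure|exact: closed_closure].
have [||c] := @compact_EVT_max _ _ w (closure Omega) _ cpt; first by exists x.
  exact: continuous_subspaceT.
rewrite inE => clc cmax; apply: (le_trans (cmax x _)); first by rewrite inE.
have [Oc|nOc] := pselect (Omega c); last first.
  by apply: bw; split=> //; move/interior_id: oO => ->.
have := eqw c Oc; move/eqP; rewrite subr_eq0 => /eqP ->.
apply: sumr_le0 => i _; apply: pderiv2_at_max => //.
have : nbhs c Omega by exact: open_nbhs_nbhs.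
by apply: filterS => y Oy; apply: cmax; rewrite inE; exact: subset_closure.
Qed.

End MaximumPrinciple.

(** * The Dirichlet problem *)

Section BarronDomain.
Local Open Scope complex_scope.
Context {R : realType} {n : nat}.
Local Notation Rn := 'rV[R]_n.
Local Notation C := R[i].
Implicit Types (x y xi : Rn) (G H F D : Rn -> C) (s t : R) (Omega : set Rn).

Lemma bounded_dotp Omega : bounded_set Omega ->
  exists r : R, 0 <= r /\ forall x, closure Omega x -> dotp x x <= r.
Proof.
move=> /bounded_closure[M [_ HM]].
have /HM OM : M < M + 1 by rewrite ltrDl.
exists (n%:R * (M + 1) ^+ 2); split; first by rewrite mulr_ge0// sqr_ge0.
move=> x /OM /= xM; rewrite /dotp -[n in n%:R]card_ord -sumr_const mulr_suml.
apply: ler_sum => i _; rewrite mul1r -expr2 -real_normK ?num_real//.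
rewrite lerXn2r ?nnegrE ?(le_trans (normr_ge0 x) xM)//.
by apply: le_trans xM; exact: le_coord_norm.
Qed.

Lemma wnorm_le_parts s D : weighted_L1 s D ->
  wnorm s D <= Rn_int (fun x => `|weight s x * re D x|) + Rn_int (fun x => `|weight s x * im D x|).
Proof.
move=> wD; have [_ _ iN] := wD.
have [/Rn_integrable_norm ir _] := weighted_L1_Re wD.
have [/Rn_integrable_norm ii _] := weighted_L1_Im wD.
rewrite -(Rn_intD ir ii); apply: Rn_int_le; [exact: iN|exact: Rn_integrableD|].
move=> x; rewrite !normrM (gtr0_norm (weight_gt0 s x)) -mulrDr.
by rewrite ler_wpM2l ?(ltW (weight_gt0 _ _))//; exact: normc_le_ReDIm.
Qed.

Lemma weighted_L1_of_parts s (p q : Rn -> R) :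
  Rn_integrable (fun x => weight s x * p x) -> Rn_integrable (fun x => weight s x * q x) ->
  weighted_L1 s (fun x => p x +i* q x).
Proof.
move=> ip iq; apply/C_integrable_weightedP; split.
- by rewrite re_weighted.
- by rewrite im_weighted.
Qed.

(* Multiplying inv_fourier (G k) by a cutoff equal to 1 on closure Omega convolves
   G k with a fixed Schwartz kernel, which yields uniform Lipschitz bounds. *)
Lemma weighted_L1_compactness Omega s t (G : nat -> Rn -> C) (B : R) :
  bounded_set Omega -> 0 <= s -> s < t ->
  (forall k, weighted_L1 t (G k)) -> (forall k, wnorm t (G k) <= B) ->
  exists2 F, weighted_L1 s F & forall (N : nat) (e : R), 0 < e ->
    exists k D, [/\ (N <= k)%N, weighted_L1 s D, wnorm s D < e &
      forall x, closure Omega x -> inv_fourier D x = inv_fourier (G k) x - inv_fourier F x].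
Proof.
move=> bO s0 st wG GB; have t0 : 0 <= t by rewrite (le_trans s0)// ltW.
have [r [r0 Or]] := bounded_dotp bO.
have [K [chi [mK rK [L [L0 KL]] Kchi chi1]]] := @exists_cutoff_kernel R n r r0.
have [M KM] := rapid_bounded rK.
have M0 : 0 <= M by rewrite (le_trans _ (KM 0)).
have B0 : 0 <= B by rewrite (le_trans _ (GB 0%N))// wnorm_ge0.
(* The boolean indexes the real and imaginary parts, so that a single subsequence serves both. *)
pose p (b : bool) k : Rn -> R := if b then re (G k) else im (G k).
have ip b k : Rn_integrable (p b k).
  by have [h1 h2 _ _] := weighted_L1_parts t0 (wG k); case: b.
have pB b k : Rn_int (fun x => `|p b k x|) <= B.
  have [_ _ h1 h2] := weighted_L1_parts t0 (wG k).
  by apply: (le_trans _ (GB k)); case: b.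
have wp b k : Rn_integrable (fun x => weight t x * p b k x).
  by have [? _] := weighted_L1_Re (wG k); have [? _] := weighted_L1_Im (wG k); case: b.
have wpB b k : Rn_int (fun x => `|weight t x * p b k x|) <= B.
  have [_ h1] := weighted_L1_Re (wG k); have [_ h2] := weighted_L1_Im (wG k).
  by apply: (le_trans _ (GB k)); case: b.
pose f k b := conv K (p b k).
have fM k b x : `|f k b x| <= M * B.
  by apply: (le_trans (conv_bound x mK KM (ip b k))); rewrite ler_wpM2l.
have fL k b x y : `|f k b x - f k b y| <= (L * B) * `|x - y|.
  apply: (le_trans (conv_lipschitz x y mK KM KL (ip b k))).
  by rewrite ler_wpM2r// ler_wpM2l.
have [kap [g [mkap fg]]] := lipschitz_subsequence (mulr_ge0 L0 B0) fM fL.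
have cw b k := conv_weighted t0 mK rK (Rn_integrable_measurable (ip b k)) (wp b k).
pose AK := 2 `^ t * Rn_int (fun x => weight t x * `|K x|).
have AK0 : 0 <= AK.
  rewrite mulr_ge0 ?powR_ge0//; apply: Rn_int_ge0 => x.
  by rewrite mulr_ge0// ltW// weight_gt0.
have cpt b : [/\ Rn_measurable (g b), Rn_integrable (fun x => weight t x * g b x) &
   (fun k => Rn_int (fun x => `|weight s x * (f (kap k) b x - g b x)|)) @ \oo --> 0].
  apply: (@weighted_compactness _ _ s t (fun k => f (kap k) b) (g b) (M * B) (AK * B) st).
  - by move=> k x; exact: fM.
  - by move=> k; have [] := cw b (kap k).
  - move=> k; have [_ le] := cw b (kap k); apply: (le_trans le).
    by rewrite ler_wpM2l.
  - by move=> x; exact: fg.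
pose F x : C := g true x +i* g false x.
have wF : weighted_L1 t F.
  by apply: weighted_L1_of_parts; [have [] := cpt true|have [] := cpt false].
pose Hm m x : C := f (kap m) true x +i* f (kap m) false x.
have wH m : weighted_L1 t (Hm m).
  by apply: weighted_L1_of_parts; [have [] := cw true (kap m)|have [] := cw false (kap m)].
have [wFs _] := weighted_L1_le (ltW st) wF.
exists F => // N e e0.
have e2 : 0 < e / 2 by rewrite divr_gt0.
have [_ _ /cvgrPdist_lt/(_ _ e2)[N1 _ H1]] := cpt true.
have [_ _ /cvgrPdist_lt/(_ _ e2)[N2 _ H2]] := cpt false.
pose m := maxn N (maxn N1 N2).
have [wHs _] := weighted_L1_le (ltW st) (wH m).
have [wD _] := weighted_L1B wHs wFs.
exists (kap m), (fun x => Hm m x - F x); split.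
- by rewrite (leq_trans _ (mkap m))// leq_maxl.
- exact: wD.
- apply: (le_lt_trans (wnorm_le_parts wD)).
  have := H1 m; rewrite /= !leq_max leqnn orbT sub0r normrN => /(_ isT) h1.
  have := H2 m; rewrite /= !leq_max leqnn !orbT sub0r normrN => /(_ isT) h2.
  have := le_lt_trans (ler_norm _) h1; have := le_lt_trans (ler_norm _) h2.
  rewrite /re /im /=; lra.
move=> x clx.
have iC G' : weighted_L1 s G' -> C_integrable G' by exact: weighted_L1_integrable.
rewrite (inv_fourierB _ (iC _ wHs) (iC _ wFs)); congr (_ - _).
have cE a b : ctr a (conv K (p b (kap m))) x = ctr a (p b (kap m)) x.
  by rewrite (ctr_conv a x mK rK Kchi (ip b (kap m))) chi1 ?mul1r//; exact: Or.
by rewrite /inv_fourier -[re (Hm m)]/(conv K (p true (kap m)))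
   -[im (Hm m)]/(conv K (p false (kap m))) !cE.
Qed.

Lemma iter_partial_local Omega (f g : Rn -> R) (l : seq 'I_n) : open Omega ->
  (forall x, Omega x -> f x = g x) ->
  forall x, Omega x -> iter_partial l f x = iter_partial l g x.
Proof.
move=> oO fg; elim: l => [|i l IHl] x Ox; first exact: fg.
have OO : nbhs x Omega by apply: open_nbhs_nbhs; split.
rewrite /= /pderiv; apply: near_eq_derive; exact: (filterS IHl OO).
Qed.

Lemma laplacian_local Omega (u v : Rn -> C) : open Omega ->
  (forall x, Omega x -> u x = v x) -> forall x, Omega x -> laplacian u x = laplacian v x.
Proof.
move=> oO uv x Ox; rewrite /laplacian.
have E (f g : Rn -> R) : (forall y, Omega y -> f y = g y) ->
    \sum_(i < n) iter_partial [:: i; i] f x = \sum_(i < n) iter_partial [:: i; i] g x.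
  by move=> fg; apply: eq_bigr => i _; exact: (iter_partial_local _ oO fg Ox).
have ruv y : Omega y -> re u y = re v y by move=> Oy; rewrite /re uv.
have iuv y : Omega y -> im u y = im v y by move=> Oy; rewrite /im uv.
exact: (congr2 (@Complex R) (E _ _ ruv) (E _ _ iuv)).
Qed.

(** Different densities may represent the same function on Omega. Multiplication by [jap2] respects
    this because it is the local operator 1 - Delta on the side of functions. *)
Lemma jap2_mul_local Omega s G H : open Omega -> 0 <= s ->
  weighted_L1 (2 + s) G -> weighted_L1 (2 + s) H ->
  (forall x, Omega x -> inv_fourier G x = inv_fourier H x) ->
  forall x, Omega x -> inv_fourier (jap2_mul G) x = inv_fourier (jap2_mul H) x.
Proof.
move=> oO s0 wG wH GH x Ox.
have [_ _ _ _ eG] := helmholtz_inv_fourier s0 wG.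
have [_ _ _ _ eH] := helmholtz_inv_fourier s0 wH.
apply: (etrans (esym (eG x))); apply: (etrans _ (eH x)).
exact: (congr2 (fun a b => a - b) (GH x Ox) (laplacian_local oO GH Ox)).
Qed.

(** Point values are bounded by the constant c times the weighted norm, c being that of
    [inv_fourier_bound]. This is how the equation and the boundary condition survive the limit. *)
Lemma eq0_of_small s (z : C) x : 0 <= s ->
  (forall e : R, 0 < e -> exists2 E, weighted_L1 s E /\ wnorm s E < e & z = inv_fourier E x) ->
  z = 0.
Proof.
move=> s0 zE; pose c := 2 * (@gauss_mass R n) ^- 2.
have c0 : 0 < c by rewrite divr_gt0// exprn_gt0// gauss_mass_gt0.
have small e : 0 < e -> `|complex.Re z| < e /\ `|complex.Im z| < e.
  move=> e0; have ec : 0 < e / c by rewrite divr_gt0.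
  have [E [wE lE] ->] := zE _ ec.
  have [h1 h2] := inv_fourier_bound x s0 wE.
  have lt : c * wnorm s E < e by rewrite mulrC -ltr_pdivlMr.
  by split; [exact: le_lt_trans h1 lt|exact: le_lt_trans h2 lt].
apply: complex_eq => /=; apply/eqP; rewrite -normr_le0 leNgt; apply/negP => h;
  have [h1 h2] := small _ h; by move: h1 h2; rewrite ?ltxx.
Qed.

(** The maximum principle bounds real and imaginary parts from above only; it is applied to G and to
    - G. *)
Lemma inv_fourier_uniqueness Omega s G : open Omega -> bounded_set Omega -> 0 <= s ->
  weighted_L1 (2 + s) G -> (forall x, Omega x -> inv_fourier (jap2_mul G) x = 0) ->
  (forall x, boundary Omega x -> inv_fourier G x = 0) ->
  forall x, closure Omega x -> inv_fourier G x = 0.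
Proof.
move=> oO bO s0 wG G0 b0.
have aux (H : Rn -> C) : weighted_L1 (2 + s) H ->
    (forall x, Omega x -> inv_fourier (jap2_mul H) x = 0) ->
    (forall x, boundary Omega x -> inv_fourier H x = 0) ->
    forall x, closure Omega x -> re (inv_fourier H) x <= 0 /\ im (inv_fourier H) x <= 0.
  move=> wH H0 bH x clx.
  have iH : C_integrable H by apply: weighted_L1_integrable wH; rewrite addr_ge0.
  have [_ _ c1 c2 eqH] := helmholtz_inv_fourier s0 wH.
  have rE y : Omega y -> re (inv_fourier H) y -
      \sum_(i < n) iter_partial [:: i; i] (re (inv_fourier H)) y = 0.
    move=> Oy; have /(congr1 (@complex.Re R)) := etrans (eqH y) (H0 y Oy).
    by rewrite raddfB.
  have iE y : Omega y -> im (inv_fourier H) y -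
      \sum_(i < n) iter_partial [:: i; i] (im (inv_fourier H)) y = 0.
    move=> Oy; have /(congr1 (@complex.Im R)) := etrans (eqH y) (H0 y Oy).
    by rewrite raddfB.
  have rB y : boundary Omega y -> re (inv_fourier H) y <= 0 by move=> /bH; rewrite /re => ->.
  have iB y : boundary Omega y -> im (inv_fourier H) y <= 0 by move=> /bH; rewrite /im => ->.
  have cr := re_inv_fourier_continuous iH; have ci := im_inv_fourier_continuous iH.
  split.
  - exact: (helmholtz_max_principle oO bO cr c1 rE rB clx).
  - exact: (helmholtz_max_principle oO bO ci c2 iE iB clx).
move=> x clx; have [r1 i1] := aux G wG G0 b0 x clx.
have [wN _] := weighted_L1N wG.
have iG : C_integrable G by apply: weighted_L1_integrable wG; rewrite addr_ge0.
have [wJ _ _ _ _] := helmholtz_inv_fourier s0 wG.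
have iJ : C_integrable (jap2_mul G) by exact: weighted_L1_integrable wJ.
have [||r2 i2] := aux _ wN _ _ x clx.
- move=> y Oy; rewrite (_ : jap2_mul _ = fun xi => - jap2_mul G xi); last first.
    by apply/funext => xi; rewrite /jap2_mul mulrN.
  by rewrite inv_fourierN// G0// oppr0.
- by move=> y By; rewrite inv_fourierN// b0// oppr0.
move: r2 i2; rewrite /re /im inv_fourierN//; move: r1 i1; rewrite /re /im.
case: (inv_fourier G x) => a b /= a1 b1 a2 b2.
by apply: complex_eq => /=; lra.
Qed.

End BarronDomain.

(** * Approximating data in terms of densities *)

Section Approximation.
Context {R : realType} {n : nat}.
Local Notation Rn := 'rV[R]_n.
Local Notation C := R[i].

Lemma inv_fourier_helmholtz (Omega : set Rn) (s : R) (G u f : Rn -> C) : open Omega -> 0 <= s ->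
  weighted_L1 (2 + s) G -> (forall x, Omega x -> inv_fourier G x = u x) ->
  helmholtz_eq Omega u f -> forall x, Omega x -> inv_fourier (jap2_mul G) x = f x.
Proof.
move=> oO s0 wG Gu eqf x Ox; have [_ _ _ _ eG] := helmholtz_inv_fourier s0 wG.
have E : inv_fourier G x - laplacian (inv_fourier G) x = u x - laplacian u x.
  exact: (congr2 (fun a b => a - b) (Gu x Ox) (laplacian_local oO Gu Ox)).
exact: (etrans (esym (eG x)) (etrans E (eqf x Ox))).
Qed.

Lemma inv_fourier_jap2_mulB (s : R) (G H : Rn -> C) (x : Rn) : 0 <= s ->
  weighted_L1 (2 + s) G -> weighted_L1 (2 + s) H ->
  inv_fourier (jap2_mul (fun xi => G xi - H xi)) x =
  inv_fourier (jap2_mul G) x - inv_fourier (jap2_mul H) x.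
Proof.
move=> s0 wG wH; have [wJG _ _ _ _] := helmholtz_inv_fourier s0 wG.
have [wJH _ _ _ _] := helmholtz_inv_fourier s0 wH.
have -> : jap2_mul (fun xi => G xi - H xi) = fun xi => jap2_mul G xi - jap2_mul H xi.
  by apply/funext => xi; rewrite /jap2_mul mulrBr.
exact: inv_fourierB (weighted_L1_integrable s0 wJG) (weighted_L1_integrable s0 wJH).
Qed.

Lemma D_set_repr (Omega : set Rn) (t rho : R) (f h : Rn -> C) (e : R) : open Omega -> 0 <= t ->
  0 < e -> D_set Omega t rho f h ->
  exists G, [/\ weighted_L1 (2 + t) G, wnorm (2 + t) G < rho + e,
    forall x, Omega x -> inv_fourier (jap2_mul G) x = f x &
    forall x, boundary Omega x -> inv_fourier G x = h x].
Proof.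
move=> oO t0 e0 [u [Bu nu _ eqf eqh]].
have [G [wG Gu lt]] := norm_B_dom_lt Bu (le_lt_trans nu (ltr_pwDr e0 (lexx rho))).
have GuO x : Omega x -> inv_fourier G x = u x by move=> Ox; apply: Gu; exact: subset_closure.
exists G; split => // x.
  exact: (inv_fourier_helmholtz oO t0 wG GuO eqf).
by move=> Bx; rewrite -eqh//; apply: Gu; case: Bx.
Qed.

(** Membership of f and g provides a representative of the difference; without one the infimum would
    be taken over the empty set and a small value would say nothing. *)
Lemma norm_B_domB_lt (Omega : set Rn) (s e : R) (f g : Rn -> C) : 0 <= s ->
  in_B_dom Omega s f -> in_B_dom Omega s g -> norm_B_dom Omega s (f \- g) < e ->
  exists J, [/\ weighted_L1 s J, wnorm s J < e &
    forall x, closure Omega x -> inv_fourier J x = f x - g x].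
Proof.
move=> s0 /in_B_dom_repr[F wF Ff] /in_B_dom_repr[G wG Gg] lt.
have [wFG _] := weighted_L1B wF wG.
have iF := weighted_L1_integrable s0 wF; have iG := weighted_L1_integrable s0 wG.
have FGE : eq_on (closure Omega) (inv_fourier (fun xi => F xi - G xi)) (f \- g).
  by move=> x clx; rewrite (inv_fourierB _ iF iG) Ff// Gg.
have [B _] := norm_B_dom_le s0 wFG FGE.
by have [J [wJ JE ltJ]] := norm_B_dom_lt B lt; exists J.
Qed.

Lemma in_B_dom_inv_fourier (Omega : set Rn) (s : R) (G : Rn -> C) : 0 <= s ->
  weighted_L1 s G -> in_B_dom Omega s (inv_fourier G).
Proof.
move=> s0 wG; have GG : eq_on (closure Omega) (inv_fourier G) (inv_fourier G) by [].
by have [] := norm_B_dom_le s0 wG GG.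
Qed.

Lemma norm_B_bndB_lt (Omega : set Rn) (s e : R) (f g : Rn -> C) : 0 <= s ->
  in_B_bnd Omega s f -> in_B_bnd Omega s g -> norm_B_bnd Omega s (f \- g) < e ->
  exists J, [/\ weighted_L1 s J, wnorm s J < e &
    forall x, boundary Omega x -> inv_fourier J x = f x - g x].
Proof.
move=> s0 [u /in_B_dom_repr[F wF Fu] uf] [v /in_B_dom_repr[G wG Gv] vg] lt.
have [wFG _] := weighted_L1B wF wG.
have iF := weighted_L1_integrable s0 wF; have iG := weighted_L1_integrable s0 wG.
have B := in_B_dom_inv_fourier Omega s0 wFG.
have Bfg : in_B_bnd Omega s (f \- g).
  exists (inv_fourier (fun xi => F xi - G xi)) => // x Bx; have [clx _] := Bx.
  by rewrite (inv_fourierB _ iF iG) Fu// Gv// uf// vg.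
by have [J [wJ JE ltJ]] := norm_B_bnd_lt Bfg lt; exists J.
Qed.

Lemma in_B_dom_le (Omega : set Rn) (s t : R) (f : Rn -> C) : 0 <= s -> s <= t ->
  in_B_dom Omega t f -> in_B_dom Omega s f.
Proof.
move=> s0 st /in_B_dom_repr[G wG Gf]; have [wGs _] := weighted_L1_le st wG.
by have [] := norm_B_dom_le s0 wGs Gf.
Qed.

(** [G] is the density of an approximate solution, [J] and [N] are those of the errors it leaves in
    the equation and on the boundary. The slack e over rho pays for the infimum in the norm. *)
Lemma D_closure_repr (Omega : set Rn) (s t rho e : R) (f h : Rn -> C) :
  open Omega -> 0 <= s -> s < t -> 0 < e -> D_closure Omega s t rho f h ->
  exists G J N, [/\ [/\ weighted_L1 (2 + t) G, wnorm (2 + t) G < rho + e,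
      weighted_L1 s J & wnorm s J < e], weighted_L1 (2 + s) N, wnorm (2 + s) N < e,
    forall x, Omega x -> inv_fourier J x = f x - inv_fourier (jap2_mul G) x &
    forall x, boundary Omega x -> inv_fourier N x = h x - inv_fourier G x].
Proof.
move=> oO s0 st e0 [Bf Bh /(_ e e0)[f' [h' [Dfh nf nh]]]].
have t0 : 0 <= t by rewrite (le_trans s0)// ltW.
have [G [wG ltG Gf Gh]] := D_set_repr oO t0 e0 Dfh.
have s20 : 0 <= 2 + s by rewrite addr_ge0.
have [u [Bu nu Bf' _ eqh]] := Dfh.
have [J [wJ ltJ JE]] := norm_B_domB_lt s0 Bf (in_B_dom_le s0 (ltW st) Bf') nf.
have Bh' : in_B_bnd Omega (2 + s) h'.
  by exists u => //; apply: in_B_dom_le Bu => //; rewrite lerD2l ltW.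
have [N [wN ltN NE]] := norm_B_bndB_lt s20 Bh Bh' nh.
exists G, J, N; split => // x.
  by move=> Ox; rewrite Gf// JE//; exact: subset_closure.
by move=> Bx; rewrite Gh// NE.
Qed.

End Approximation.

Unset Implicit Arguments.

Theorem theorem4p3 (R : realType) (n : nat) (Omega : set 'rV[R]_n)
    (Omega_open : open Omega) (Omega_bounded : bounded_set Omega)
    (s t rho : R) (s_ge0 : 0 <= s) (s_lt_t : s < t) (rho_gt0 : 0 < rho)
    (f h : 'rV[R]_n -> R[i]) (fh_D : D_closure Omega s t rho f h) :
  exists u : 'rV[R]_n -> R[i],
    [/\ in_B_dom Omega (2 + s) u,
        is_solution Omega f h u,
        norm_B_dom Omega (2 + s) u <= rho &
        forall v : 'rV[R]_n -> R[i],
          in_B_dom Omega (2 + s) v -> is_solution Omega f h v ->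
          eq_on (closure Omega) v u].
Proof.
have s20 : 0 <= 2 + s by rewrite addr_ge0.
have st2 : 2 + s < 2 + t by rewrite ltrD2l.
have subO x : Omega x -> closure Omega x by exact: subset_closure.
have inv0 (k : nat) : 0 < k.+1%:R^-1 :> R by rewrite invr_gt0.
have /choice[G GP] := fun k => D_closure_repr Omega_open s_ge0 s_lt_t (inv0 k) fh_D.
have wG k : weighted_L1 (2 + t) (G k) by have [J [N [[]]]] := GP k.
have GB k : wnorm (2 + t) (G k) <= rho + 1.
  have [J [N [[_ lt _ _] _ _ _ _]]] := GP k; rewrite (le_trans (ltW lt))// lerD2l.
  by rewrite invf_le1// ler1n.
have [F wF FP] := weighted_L1_compactness Omega_bounded s20 st2 wG GB.
have iC (H : 'rV[R]_n -> R[i]) : weighted_L1 (2 + s) H -> C_integrable H by exact: weighted_L1_integrable.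
have wGs k : weighted_L1 (2 + s) (G k) by have [] := weighted_L1_le (ltW st2) (wG k).
(* The data error 1 / (k + 1) and the distance from [G k] to F are made small for the same k, as
   compactness supplies arbitrarily late indices. *)
have approx (e : R) : 0 < e -> exists k D, [/\ weighted_L1 (2 + s) D,
    k.+1%:R^-1 + wnorm (2 + s) D < e & forall x, closure Omega x ->
    inv_fourier D x = inv_fourier (G k) x - inv_fourier F x].
  move=> e0; have e2 : 0 < e / 2 by rewrite divr_gt0.
  have [m _ Hm] := near_infty_natSinv_lt (PosNum e2).
  have [k [D [mk wD ltD DE]]] := FP m _ e2; exists k, D; split => //.
  by rewrite [ltRHS]splitr ltrD//; exact: Hm.
(* In Omega the defect is the data error J plus 1 - Delta applied to [G k] - F. The small density D
   equals that difference only as a function on closure Omega, so locality is needed to pass to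
   [jap2_mul D]. *)
have FO x : Omega x -> inv_fourier (jap2_mul F) x = f x.
  move=> Ox; apply/eqP; rewrite eq_sym -subr_eq0; apply/eqP.
  apply: (@eq0_of_small _ _ s _ x s_ge0) => e e0.
  have [k [D [wD ltD DE]]] := approx _ e0.
  have [J [N [[_ _ wJ ltJ] _ _ JE _]]] := GP k.
  have [wGF _] := weighted_L1B (wGs k) wF.
  have DGF y : Omega y -> inv_fourier D y = inv_fourier (fun xi => G k xi - F xi) y.
    by move=> Oy; rewrite (inv_fourierB _ (iC _ (wGs k)) (iC _ wF)) DE//; exact: subO.
  have := jap2_mul_local Omega_open s_ge0 wD wGF DGF Ox.
  have [wJD nJD _ _ _] := helmholtz_inv_fourier s_ge0 wD.
  rewrite (inv_fourier_jap2_mulB _ s_ge0 (wGs k) wF) => DE'.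
  have iS (H : 'rV[R]_n -> R[i]) : weighted_L1 s H -> C_integrable H.
    exact: weighted_L1_integrable.
  have [wS nS] := weighted_L1D wJ wJD.
  exists (fun xi => J xi + jap2_mul D xi).
    by split => //; rewrite (le_lt_trans nS)// nJD (lt_trans _ ltD)// ltrD2r.
  by rewrite (inv_fourierD _ (iS _ wJ) (iS _ wJD)) DE' JE// addrA subrK.
(* No derivative is involved here: the defect is the sum of the functions with densities N and D, in
   the weight 2 + s. *)
have Fh x : boundary Omega x -> inv_fourier F x = h x.
  move=> Bx; apply/eqP; rewrite eq_sym -subr_eq0; apply/eqP.
  apply: (@eq0_of_small _ _ (2 + s) _ x s20) => e e0.
  have [k [D [wD ltD DE]]] := approx _ e0.
  have [J [N [_ wN ltN _ NE]]] := GP k.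
  have [wS nS] := weighted_L1D wN wD.
  exists (fun xi => N xi + D xi).
    by split => //; rewrite (le_lt_trans nS)// (lt_trans _ ltD)// ltrD2r.
  rewrite (inv_fourierD _ (iC _ wN) (iC _ wD)) NE// DE; last by case: Bx.
  by rewrite addrA subrK.
have BF := in_B_dom_inv_fourier Omega s20 wF.
have [_ _ _ _ HF] := helmholtz_inv_fourier s_ge0 wF.
exists (inv_fourier F); split => //.
- by split => // x Ox; rewrite HF FO.
(* The cutoff only preserves the norm up to a constant, so the bound rho is read off
   G k - D, which represents the same function on closure Omega. *)
- apply/ler_addgt0Pr => e e0; have [k [D [wD ltD DE]]] := approx _ e0.
  have [wGD nGD] := weighted_L1B (wGs k) wD.
  have GDF : eq_on (closure Omega) (inv_fourier (fun xi => G k xi - D xi)) (inv_fourier F).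
    move=> x clx; rewrite (inv_fourierB _ (iC _ (wGs k)) (iC _ wD)) DE//.
    by rewrite opprB addrC subrK.
  have [_ le] := norm_B_dom_le s20 wGD GDF; apply: (le_trans le); apply: (le_trans nGD).
  have [_ le2] := weighted_L1_le (ltW st2) (wG k).
  have [J [N [[_ ltG _ _] _ _ _ _]]] := GP k.
  by rewrite (le_trans (lerD (le_trans le2 (ltW ltG)) (lexx _)))// -addrA lerD2l ltW.
(* Uniqueness: the difference V - F solves the homogeneous problem with zero boundary values. *)
move=> v /in_B_dom_repr[V wV Vv] [eqv bv] x clx.
have [wVF _] := weighted_L1B wV wF.
have VFE y : inv_fourier (fun xi => V xi - F xi) y = inv_fourier V y - inv_fourier F y.
  by rewrite (inv_fourierB _ (iC _ wV) (iC _ wF)).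
apply/eqP; rewrite -subr_eq0 -Vv// -VFE; apply/eqP.
apply: (inv_fourier_uniqueness Omega_open Omega_bounded s_ge0 wVF _ _ clx) => y.
- move=> Oy; have VvO z : Omega z -> inv_fourier V z = v z by move=> Oz; apply: Vv; exact: subO.
  rewrite (inv_fourier_jap2_mulB _ s_ge0 wV wF) FO//.
  by rewrite (inv_fourier_helmholtz Omega_open s_ge0 wV VvO eqv Oy) subrr.
- by move=> By; rewrite VFE Fh// Vv ?bv ?subrr//; case: By.
Qed.
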